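(* Let $\Delta$ be a smooth lattice polytope of dimension $n$. (1) A T-curve $X$ with Newton polytope $\Delta$ satisfies $$b_0(X)\le \frac{n+1}{3}\operatorname{Vol}(\Delta).$$ (2) A T-surface $X$ with Newton polytope $\Delta$ satisfies $$b_0(X)\le \frac{7n^2+5n+12}{60}\operatorname{Vol}(\Delta).$$
   Context: A lattice polytope is a full-dimensional convex polytope $\Delta\subset\mathbb R^n$ with vertices in $\mathbb Z^n$; $\operatorname{Vol}(\Delta)$ is its lattice volume, i.e. $n!$ times its Euclidean volume. For a lattice polytope (or simplex) $\sigma$ in $\mathbb R^n$, $T(\sigma)\subset\mathbb Z^n$ is the sublattice spanned by differences of points of $\sigma\cap\mathbb Z^n$, $T_2(\sigma)=T(\sigma)\otimes\mathbb F_2\subset\mathbb F_2^n$, and $T_2^\perp(\sigma)\subset(\mathbb F_2^n)^\vee$ is the annihilator of $T_2(\sigma)$. $\Delta$ is smooth if for each vertex $v$ one has $\mathbb Z^n=\bigoplus T(\rho)$, the sum over edges $\rho$ of $\Delta$ containing $v$. A triangulation $\Gamma$ of $\Delta$ has all its vertices in $\mathbb Z^n$ and is always assumed unimodular (every $n$-simplex has Euclidean volume $1/n!$); $F_k(\Gamma)$ is the set of its $k$-simplices and $F_k(\tau)$ the set of $k$-faces of a simplex $\tau$. Let $\mathcal Q^n$ be an affine space directed by $(\mathbb F_2^n)^\vee$, identified with the set $\{+,-\}^n$ of orthants. A real phase structure $\mathcal E$ on the $k$-skeleton of $\Gamma$ (a $k$-real phase structure) is a choice, for each $\sigma\in F_k(\Gamma)$,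 of an affine subspace $\mathcal E(\sigma)\subset\mathcal Q^n$ directed by $T_2^\perp(\sigma)$ such that for every $\tau\in F_{k+1}(\Gamma)$ and $s\in\mathcal Q^n$ the number of $\sigma\in F_k(\tau)$ with $s\in\mathcal E(\sigma)$ is even. For any simplex $\tau$ put $\mathcal E(\tau)=\bigcup_{\sigma\in F_k(\tau)}\mathcal E(\sigma)$. T-manifold: take a copy $s(\Delta)$ of $\Delta$, triangulated by a copy $s(\Gamma)$ of $\Gamma$, for each $s\in\mathcal Q^n$, and for each face $F$ of $\Delta$ identify $s(F)$ with $t(F)$ (via the identity of $F$) whenever $t-s\in T_2^\perp(F)$. The result is $\widetilde\Delta$ with triangulation $\widetilde\Gamma$. Let $\operatorname{Bar}(\widetilde\Gamma)$ be the barycentric subdivision. For $\tau\in\Gamma$ and $s\in\mathcal E(\tau)$, $C_{\mathcal E}(s(\tau))$ is the full subcomplex of $\operatorname{Bar}(\widetilde\Gamma)$ on the barycenters of the faces $s(\sigma)$ of $s(\tau)$ with $s\in\mathcal E(\sigma)$. The T-manifold $X_{\mathcal E}\subset\widetilde\Delta$ is the union of all the $C_{\mathcal E}(s(\tau))$; it is a PL manifold of dimension $n-k$. A T-manifold of codimension $k$ with Newton polytope $\Delta$ is an $X_{\mathcal E}$ for $\mathcal E$ a $k$-real phase structure on a triangulation $\Gamma$ of $\Delta$. A T-curve (resp. T-surface) is a T-manifold of dimension $1$ (resp. $2$), i.e. of codimension $n-1$ (resp. $n-2$). $b_0(X)$ is the number of connected components of $X$.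
   Formalization: The bounds are stated with Vol(Δ) > 1 required when the codimension is 0 (n = 1 for curves, n = 2 for surfaces): for the unit segment and the unit triangle X is all of Δ̃, so b_0 = 1 while the bounds are 2/3 and 5/6. *)

(* Defs.v *)
From HB Require Import structures.
From Stdlib Require Import Relations.
From mathcomp Require Import all_boot all_order all_algebra finmap generic_quotient.
From mathcomp Require Import all_classical all_reals all_analysis.

Set Implicit Arguments.
Unset Strict Implicit.
Unset Printing Implicit Defensive.

Import Order.TTheory GRing.Theory Num.Theory.
Import numFieldNormedType.Exports.

Local Open Scope classical_set_scope.
Local Open Scope fset_scope.
Local Open Scope ring_scope.

(* Lebesgue measure on R^n as the iterated product of [lebesgue_measure], i.e.
   the recursive unfolding of [product_measure1]; it is only used on
   polytopes, for which all the sections are measurable. *)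
Fixpoint euclidean_volume (R : realType) (n : nat) :
    set 'rV[R]_n -> \bar R :=
  match n return set 'rV[R]_n -> \bar R with
  | 0 => fun A => (\1_A (0 : 'rV[R]_0))%:E
  | m.+1 => fun A => (\int[@lebesgue_measure R]_t
      euclidean_volume [set y : 'rV[R]_m |
        A (row_mx (const_mx t : 'rV[R]_1) y)])%E
  end.

Definition lattice_volume (R : realType) (n : nat) (P : set 'rV[R]_n) :
    \bar R :=
  ((n`!)%:R%:E * euclidean_volume P)%E.

Section Polytopes.
Context {R : realType} {n : nat}.
Implicit Types (P F : set 'rV[R]_n) (S : {fset 'rV[int]_n}).

Definition hull (A : set 'rV[R]_n) : set 'rV[R]_n :=
  smallest (@convex_set R 'rV[R]_n) A.

Definition real_point (z : 'rV[int]_n) : 'rV[R]_n := map_mx intr z.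

Definition simplex_hull S : set 'rV[R]_n := hull (real_point @` [set` S]).

(* The dimension of the affine span of a nonempty P is the largest rank of a
   family of vectors x_i - x with x and all the x_i in P. *)
Definition has_dim P (d : nat) : Prop :=
  (exists x (A : 'M[R]_(d, n)),
     [/\ P x, forall i, P (x + row i A) & \rank A = d]) /\
  (forall x m (A : 'M[R]_(m, n)),
     P x -> (forall i, P (x + row i A)) -> (\rank A <= d)%N).

Definition lattice_polytope P : Prop :=
  (exists S, P = simplex_hull S) /\ has_dim P n.

Definition face P F : Prop :=
  F !=set0 /\ exists (c : 'cV[R]_n) (b : R),
    (forall x, P x -> (x *m c) 0 0 <= b) /\
    F = [set x | P x /\ (x *m c) 0 0 = b].

Definition vertex P (v : 'rV[R]_n) : Prop := face P [set v].

Definition edge P F : Prop := face P F /\ has_dim F 1.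

Definition lattice_points P : set 'rV[int]_n := [set z | P (real_point z)].

Definition lattice_T P : set 'rV[int]_n :=
  smallest (fun H : set 'rV[int]_n => zmod_closed (mem H))
    [set x - y | x in lattice_points P & y in lattice_points P].

(* The subspace T(P) (x) F_2 of F_2^n is read as the reduction mod 2 of T(P). *)
Definition lattice_T2 P : set 'rV['F_2]_n :=
  [set map_mx (fun a : int => a%:~R : 'F_2) z | z in lattice_T P].

(* Column vectors over F_2 stand for the dual space of F_2^n (row vectors),
   and also for the affine space Q^n of orthants: s is the orthant where the
   i-th coordinate has sign (-1)^(s_i). *)
Definition T2_perp P : {set 'cV['F_2]_n} :=
  [set u : 'cV['F_2]_n |
     `[< forall v, lattice_T2 P v -> v *m u = 0 >]]%SET.

(* Z^n is the internal direct sum of the T(rho) : every z is in a unique way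
   a sum of elements t rho in T(rho), for rho an edge containing v. *)
Definition smooth P : Prop :=
  forall v, vertex P v ->
  let edges := [set rho | edge P rho /\ rho v] in
  forall z : 'rV[int]_n, exists! t : set 'rV[R]_n -> 'rV[int]_n,
    [/\ forall rho, edges rho -> lattice_T rho (t rho),
        forall rho, ~ edges rho -> t rho = 0
      & z = \sum_(rho \in edges) t rho].

End Polytopes.

(* A simplex is the nonempty finite set of its vertices, so that a k-simplex
   has k.+1 elements. *)
Definition faces_of_dim (n k : nat) (tau : {fset 'rV[int]_n}) :
    {fset {fset 'rV[int]_n}} :=
  [fset sigma in fpowerset tau | #|` sigma| == k.+1].

Section Triangulations.
Context {R : realType} {n : nat}.
Variable P : set 'rV[R]_n.
Implicit Types (Gamma : {fset {fset 'rV[int]_n}}) (sigma tau : {fset 'rV[int]_n}).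

Definition affine_simplex sigma : Prop :=
  sigma != fset0 /\ has_dim (@simplex_hull R n sigma) (#|` sigma|.-1).

Definition triangulation Gamma : Prop :=
  [/\ forall sigma, sigma \in Gamma -> affine_simplex sigma,
      forall sigma tau, tau \in Gamma -> sigma `<=` tau ->
        sigma != fset0 -> sigma \in Gamma,
      forall sigma tau, sigma \in Gamma -> tau \in Gamma ->
        (simplex_hull sigma `&` simplex_hull tau =
           @simplex_hull R n (sigma `&` tau)%fset)%classic
    & P = (\bigcup_(sigma in [set` Gamma]) simplex_hull sigma)%classic].

Definition unimodular Gamma : Prop :=
  forall sigma, sigma \in Gamma -> #|` sigma| = n.+1 ->
    euclidean_volume (@simplex_hull R n sigma) = ((n`!)%:R^-1)%:E.

Definition real_phase_structure Gamma (k : nat)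
    (E : {fset 'rV[int]_n} -> {set 'cV['F_2]_n}) : Prop :=
  (forall sigma, sigma \in Gamma -> #|` sigma| = k.+1 ->
     exists a : 'cV['F_2]_n,
       E sigma = [set s | s - a \in T2_perp (@simplex_hull R n sigma)]%SET) /\
  (forall tau, tau \in Gamma -> #|` tau| = k.+2 ->
     forall s : 'cV['F_2]_n,
       ~~ odd #|` [fset sigma in faces_of_dim k tau | s \in E sigma]|).

Definition phase (k : nat) (E : {fset 'rV[int]_n} -> {set 'cV['F_2]_n}) tau :
    {set 'cV['F_2]_n} :=
  (\bigcup_(sigma <- faces_of_dim k tau) E sigma)%SET.

Definition copies : topologicalType := {s : 'cV['F_2]_n & P}.

Definition copy (s : 'cV['F_2]_n) (x : P) : copies := existT (fun _ => P) s x.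

Definition glued (p q : copies) : Prop :=
  exists F s t (x : P),
    [/\ face P F, F (set_val x), t - s \in T2_perp F,
        p = copy s x & q = copy t x].

Definition glue_rel : rel copies :=
  fun p q => `[< clos_refl_sym_trans copies glued p q >].

Lemma glue_rel_equiv : equiv_class_of glue_rel.
Proof.
split.
- by move=> p; apply/asboolP; exact: rst_refl.
- by move=> p q; apply: asbool_equiv_eq; split; exact: rst_sym.
- move=> q p r /asboolP pq /asboolP qr; apply/asboolP; exact: rst_trans qr.
Qed.

Canonical glue_equiv_rel := EquivRelPack glue_rel_equiv.

Definition tilde : topologicalType :=
  quotient_topology {eq_quot glue_equiv_rel}%qT.

Definition tilde_proj (p : copies) : tilde := (\pi_tilde p)%qT.

Definition barycenter sigma : 'rV[R]_n :=
  (#|` sigma|%:R)^-1 *: \sum_(v <- sigma) real_point v.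

(* A simplex of the barycentric subdivision of a simplex tau is the convex
   hull of the barycenters of a nonempty chain of faces of tau; s \in phase k
   E sigma forces sigma to be nonempty. *)
Definition phase_piece (k : nat) (E : {fset 'rV[int]_n} -> {set 'cV['F_2]_n})
    (s : 'cV['F_2]_n) tau : set 'rV[R]_n :=
  [set x | exists c : {fset {fset 'rV[int]_n}},
     [/\ c != fset0,
         forall sigma, sigma \in c -> sigma `<=` tau /\ s \in phase k E sigma,
         forall sigma sigma', sigma \in c -> sigma' \in c ->
           (sigma `<=` sigma') || (sigma' `<=` sigma)
       & hull (barycenter @` [set` c]) x]].

Definition T_manifold_of Gamma (k : nat)
    (E : {fset 'rV[int]_n} -> {set 'cV['F_2]_n}) : set tilde :=
  [set p | exists tau s (x : P),
     [/\ tau \in Gamma, s \in phase k E tau,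
         phase_piece k E s tau (set_val x) & p = tilde_proj (copy s x)]].

Definition T_manifold (k : nat) (X : set tilde) : Prop :=
  exists Gamma E,
    [/\ triangulation Gamma, unimodular Gamma,
        real_phase_structure Gamma k E & X = T_manifold_of Gamma k E].

(* Dimension d means codimension k with k + d = n; this avoids the truncated
   subtraction n - d. *)
Definition T_manifold_of_dim (d : nat) (X : set tilde) : Prop :=
  exists k, (k + d)%N = n /\ T_manifold k X.

Definition T_curve : set tilde -> Prop := T_manifold_of_dim 1.

Definition T_surface : set tilde -> Prop := T_manifold_of_dim 2.

End Triangulations.

Definition b0 (R : realType) (T : topologicalType) (X : set T) : \bar R :=
  counting [set connected_component X x | x in X].

(* Main.v *)
From Stdlib Require Import Relations.
From mathcomp Require Import all_boot all_order all_algebra finmap.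
From mathcomp Require Import generic_quotient zify ring lra.

(** Why the bounds hold.

A full simplex [t] of the triangulation and an orthant [s] of its phase
determine a cell of the T-manifold, the part of it inside [s(t)]. Cells are
star-shaped around the barycenter of [s(t)], so they are connected, and they
cover the T-manifold. Let [N] be the number of full simplices. If every cell
is given the weight 1 / (number of cells of its component), then the number of
components is the total weight, so one needs an upper bound on the number of
cells per simplex, lower bounds on the size of the components, and
[N <= Vol Delta].

Neighbours. A cell has one neighbour across each facet of [t] whose phase
contains [s]: the cell of the same orthant in the simplex on the other side or,
if the facet lies in a facet [F] of [Delta], the cell of [t] in the orthant
[s + u], where [u] spans [T2_perp F]. Different facets give different
neighbours, none of them the cell itself ([nbr_inj], [nbr_neq]), and
neighbours share the barycenter of the facet. So a component that contains a
cell with [m] sides has more than [m] cells ([sides_class]). This fails only if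
[n = 1] and both facets of [t] are in the boundary, in which case [Delta] has
volume 1.

Curves. A phase of a facet has two elements, and each orthant lies in an even
number of the [n + 1] facet phases; so [t] has at most [n + 1] cells
([card_curve_phase]), each with at least two sides, and components have at
least three cells.

Surfaces. Join the facets [i] and [j] of [t] when [s] lies in the phase of the
ridge opposite to the vertices [i] and [j]. All degrees of this graph are
even, so a cell has at least three sides and components have at least four
cells. The number of cells of [t] is at most [1 + n + C(n, 2)], the bound of
Sauer and Shelah for families that shatter no triple: a shattered triple and a
base vertex would give four vertices on which all patterns occur, whereas the
parity condition survives the deletion of vertices and always leaves one
pattern out on four of them ([missing_pattern], [card_surface_phase]).
Finally, if a component has exactly four cells, they are pairwise adjacent
triangles; unless [Delta] is a single triangle, the three sides are interior
and the three simplices across them have the same apex [q] ([small_class]).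
The barycentric coordinates of [q] at the three opposite vertices are negative,
and since the coordinates add up to 1, the apex is not the same for all facets
of [t]. As two sides belong to at most two triangles, [t] has at most [n (n - 1) / 3] of these triangles
([card_triangles]). With weight 1/4 for them and 1/5 for the other cells, the
total weight is at most

  [N ((1 + n + C(n, 2)) / 5 + n (n - 1) / 60) = N (7 n^2 + 5 n + 12) / 60].

Geometry. The iterated integral that defines volumes is superadditive on sets
that overlap inside hyperplanes, because integrals are suprema over simple
functions ([euclidean_volume_superadditive]); this yields [N <= Vol Delta].
It also shows that a simplex of volume [1 / n!] is unimodular in the
arithmetic sense: otherwise the points of two cosets of the lattice spanned by
its edges would provide too many non-overlapping small cubes inside it
([volume_gt_of_nonint]). Simplices that contain a given point and lie on a
given side of it are found by following a curve that leaves every affine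
hyperplane at once ([curve_simplex]). *)

Set Implicit Arguments.
Unset Strict Implicit.
Unset Printing Implicit Defensive.

Import Order.TTheory GRing.Theory Num.Theory.

(** * Shattered families and phases on a simplex *)

Section Shatter.
Variable T : finType.
Implicit Types (F : {set {set T}}) (S A B : {set T}).

Definition shatters F S := [forall (B : {set T} | B \subset S), exists A in F, A :&: S == B].

Lemma shattersP F S :
  reflect (forall B, B \subset S -> exists2 A, A \in F & A :&: S = B) (shatters F S).
Proof.
apply: (iffP forall_inP) => h B BS; have := h B BS.
  by case/exists_inP => A FA /eqP; exists A.
by case=> A FA e; apply/exists_inP; exists A => //; apply/eqP.
Qed.

Lemma shattersS F F' S : F \subset F' -> shatters F S -> shatters F' S.
Proof.
move=> FF' /shattersP sh; apply/shattersP => B /sh[A FA <-].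
by exists A => //; apply: (subsetP FF').
Qed.

Lemma shatters_sub F S S' : S' \subset S -> shatters F S -> shatters F S'.
Proof.
move=> sS /shattersP sh; apply/shattersP => B BS.
have [A FA e] := sh B (subset_trans BS sS); exists A => //.
by rewrite -(setIidPr sS) setIA e; apply/setIidPl.
Qed.

(** Pajor's form of the Sauer-Shelah lemma. Split the family by an element x
    contained in some but not all of its members: a set S shattered by both halves
    counts twice, as S and as x |: S. *)
Lemma card_le_shatters F : #|F| <= #|[set S | shatters F S]|.
Proof.
have [m] := ubnP #|F|; elim: m F => // m IH F lt_m.
have [|F_gt1] := leqP #|F| 1.
  rewrite leq_eqVlt ltnS leqn0 => /orP[/cards1P[A ->]|/eqP->//].
  rewrite cards1 card_gt0; apply/set0Pn; exists set0; rewrite inE.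
  apply/shattersP => B; rewrite subset0 => /eqP->.
  by exists A; rewrite ?inE ?setI0.
have [A [B [FA FB neAB]]] : exists A B, [/\ A \in F, B \in F & A != B].
  by case/card_gt1P: F_gt1 => A [B [FA FB AB]]; exists A, B.
have [x xAB] : exists x, x \in A :\: B :|: B :\: A.
  apply/set0Pn; apply: contraNneq neAB => /eqP.
  rewrite setU_eq0 !setD_eq0 => /andP[sAB sBA].
  by rewrite eqEsubset sAB sBA.
pose F1 := [set C in F | x \in C]; pose F0 := [set C in F | x \notin C].
have cF : #|F| = #|F1| + #|F0|.
  rewrite -cardsUI (_ : F1 :&: F0 = set0) ?cards0 ?addn0.
    by congr #|pred_of_set _|; apply/setP => C; rewrite !inE; case: (x \in C); rewrite ?andbT ?andbF ?orbF.
  by apply/setP => C; rewrite !inE; case: (x \in C); rewrite ?andbT ?andbF.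
have [F1_gt0 F0_gt0] : 0 < #|F1| /\ 0 < #|F0|.
  by move: xAB; rewrite !inE => /orP[] /andP[xB xA]; split; rewrite card_gt0; apply/set0Pn;
    [exists A|exists B|exists B|exists A]; rewrite inE ?FA ?FB.
have le1 : #|F1| <= #|[set S | shatters F1 S]| by apply: IH; lia.
have le0 : #|F0| <= #|[set S | shatters F0 S]| by apply: IH; lia.
set S1 := [set S | _ F1 S] in le1; set S0 := [set S | _ F0 S] in le0.
have nx1 S : S \in S1 -> x \notin S.
  rewrite inE => /shattersP/(_ set0 (sub0set _))[C]; rewrite inE => /andP[_ xC] /setP/(_ x).
  by rewrite !inE xC /= => ->.
have nx0 S : S \in S0 -> x \notin S.
  rewrite inE => /shattersP/(_ S (subxx _))[C]; rewrite inE => /andP[_ xC] /setP/(_ x).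
  by rewrite !inE (negbTE xC) /= => <-.
pose S2 := [set x |: S | S in S1 :&: S0].
have cS2 : #|S2| = #|S1 :&: S0|.
  apply: card_in_imset => S S' /setIP[/nx1 xS _] /setIP[/nx1 xS' _] e.
  by rewrite -(setU1K xS) e setU1K.
rewrite cF (leq_trans (leq_add le1 le0))// -cardsUI -cS2.
rewrite -cardsUI (_ : (S1 :|: S0) :&: S2 = set0) ?cards0 ?addn0; last first.
  apply/setP => S; rewrite !inE; apply/negP => /andP[h /imsetP[S' _ e]].
  have : x \notin S by case/orP: h => h; [apply: nx1|apply: nx0]; rewrite inE.
  by rewrite e setU11.
apply/subset_leq_card/subsetP => S; rewrite !inE -orbA => /or3P[||/imsetP[S' + ->]].
- by apply: shattersS; apply/subsetP => C; rewrite inE => /andP[].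
- by apply: shattersS; apply/subsetP => C; rewrite inE => /andP[].
move=> /setIP[S1S' S0S']; have xS' := nx1 _ S1S'; move: S1S' S0S'; rewrite !inE.
move=> /shattersP sh1 /shattersP sh0; apply/shattersP => C CS.
have CxS : C :\ x \subset S' by rewrite subDset.
have [xC|xC] := boolP (x \in C).
  have [D] := sh1 _ CxS; rewrite inE => /andP[FD xD] e; exists D => //.
  by rewrite setIUr e -(setD1K xC) setU1K ?setD11// (setIidPr _)// sub1set.
have [D] := sh0 _ CxS; rewrite inE => /andP[FD xD] e; exists D => //.
rewrite setIUr e (_ : D :&: [set x] = set0); last first.
  by apply/setP => y; rewrite !inE; case: eqVneq => [->|]; rewrite ?(negbTE xD) ?andbF.
by rewrite set0U; apply/setP => y; rewrite !inE; case: eqVneq => [->|//]; rewrite (negbTE xC).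
Qed.

Lemma card_vc2 F : (forall S, #|S| = 3 -> ~~ shatters F S) ->
  #|F| <= 1 + #|T| + 'C(#|T|, 2).
Proof.
move=> no3; apply: leq_trans (card_le_shatters F) _.
have le2 : [set S : {set T} | shatters F S] \subset
    [set S : {set T} | #|S| == 0] :|: [set S : {set T} | #|S| == 1] :|: [set S : {set T} | #|S| == 2].
  apply/subsetP => S; rewrite !inE => shS.
  suff : #|S| < 3 by case: #|S| => [|[|[]]].
  rewrite ltnNge; apply/negP => /card_geqP[s [us ss sS]].
  have : #|[set y in s]| = 3 by rewrite cardsE (card_uniqP us).
  move/no3/negP; apply; apply: shatters_sub shS.
  by apply/subsetP => y; rewrite inE => /sS.
apply: leq_trans (subset_leq_card le2) _.
apply: leq_trans (leq_card_setU _ _) _; rewrite leq_add//; last by rewrite card_draws.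
apply: leq_trans (leq_card_setU _ _) _; rewrite leq_add//.
  by rewrite card_draws bin0.
by rewrite card_draws bin1.
Qed.
End Shatter.

Section Phase.
Variable K : finType.
Variable a : K -> K -> K -> bool.
Hypothesis a_sym : forall i j, a i j = a j i.
Implicit Types (J : {set K}) (x : K -> bool).

(** The elements of K are the vertices of a full simplex and x gives the values
    of an orthant on them, modulo 2 and up to a common constant. The phase of the
    ridge opposite to i and j is directed by the annihilator of the ridge, hence it
    prescribes the differences of the values on the ridge. The set J allows to
    forget the vertices outside it. *)
Definition agree J i j x := [forall l in J :\ i :\ j, forall m in J :\ i :\ j,
  x l (+) x m == a i j l (+) a i j m].

Lemma agreeP J i j x : reflect (forall l m, l \in J -> m \in J -> l != i -> l != j -> m != i -> m != j ->
  x l (+) x m = a i j l (+) a i j m) (agree J i j x).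
Proof.
apply: (iffP forall_inP) => [h l m lJ mJ li lj mi mj|h l].
  have /h/forall_inP/(_ m) : l \in J :\ i :\ j by rewrite !inE li lj.
  by rewrite !inE mi mj => /(_ mJ)/eqP.
rewrite !inE => /and3P[lj li lJ]; apply/forall_inP => m.
by rewrite !inE => /and3P[mj mi mJ]; apply/eqP/h.
Qed.

Lemma agreeC J i j x : agree J i j x = agree J j i x.
Proof. by rewrite /agree a_sym !setDDl setUC. Qed.

(** For a fixed x, the pairs i, j with [agree J i j x] are the edges of a graph on
    J; this is the parity condition of a real phase structure at the facets. *)
Definition even_degrees J := forall i x, i \in J -> ~~ odd #|[set j in J :\ i | agree J i j x]|.

Definition covered J x := exists i j, [/\ i \in J, j \in J, i != j & agree J i j x].

Lemma agreeS J J' i j x : J' \subset J -> agree J i j x -> agree J' i j x.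
Proof.
move=> /subsetP JJ /agreeP h; apply/agreeP => l m lJ mJ.
by apply: h; apply: JJ.
Qed.

Lemma two_nbrs J i j x : even_degrees J -> i \in J -> j \in J -> i != j -> agree J i j x ->
  exists2 r, r \in J :\ i & (r != j) && agree J i r x.
Proof.
move=> ev iJ jJ ij Eij; have := ev i x iJ; set D := [set _ in _ | _] => oD.
have jD : j \in D by rewrite !inE eq_sym ij jJ.
have [r] : exists r, r \in D :\ j.
  by apply/set0Pn; apply: contraNneq oD => e; rewrite (cardsD1 j) jD e cards0.
by rewrite !inE => /and3P[rj /andP[ri rJ] Er]; exists r; rewrite ?inE ?ri// rj.
Qed.

(** A vertex of this graph that has an edge has at least two, by parity, so some
    edge avoids n. *)
Lemma covered_del J n x : even_degrees J -> covered J x -> covered (J :\ n) x.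
Proof.
move=> ev [i [j [iJ jJ ij Eij]]].
wlog jn : i j iJ jJ ij Eij / i != n => [hw|].
  have [eq_in|] := eqVneq i n; last exact: (hw i j iJ jJ ij Eij).
  have jn : j != n by rewrite -eq_in eq_sym.
  by apply: (hw j i jJ iJ) jn; rewrite 1?eq_sym// agreeC.
have [r /[!inE]/andP[ri rJ] [rn Er]] : exists2 r, r \in J :\ i & r != n /\ agree J i r x.
  have [eq_jn|] := eqVneq j n; last by move=> ?; exists j => //; rewrite !inE eq_sym ij.
  by have [r rJ /andP[rj]] := two_nbrs ev iJ jJ ij Eij; exists r => //; rewrite -eq_jn.
exists i, r; split; rewrite ?inE ?rn ?jn// 1?eq_sym//.
exact: agreeS (subsetDl _ _) Er.
Qed.

Definition flip_at n x : K -> bool := fun l => x l (+) (l == n).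

(** Forgetting n leaves its value free. A value that matches exists, and only one
    of the two values does as long as another vertex m of the ridge remains. *)
Lemma agree_del J n i j x : 3 < #|J| -> n \in J -> i \in J :\ n -> j \in J :\ n -> i != j ->
  agree (J :\ n) i j x = agree J i j x (+) agree J i j (flip_at n x).
Proof.
move=> J3 nJ; rewrite !inE => /andP[ni iJ] /andP[nj jJ] ij.
have [m [mJ mi mj mn]] : exists m, [/\ m \in J, m != i, m != j & m != n].
  have [m] : exists m, m \in J :\ i :\ j :\ n.
    apply/set0Pn; rewrite -card_gt0.
    have := cardsD1 i J; have := cardsD1 j (J :\ i); have := cardsD1 n (J :\ i :\ j).
    rewrite !inE iJ jJ nJ; lia.
  by rewrite !inE => /and4P[mn mj mi mJ]; exists m.
have flipn y : flip_at n y n = ~~ y n by rewrite /flip_at eqxx addbT.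
have flipE y l : l != n -> flip_at n y l = y l by rewrite /flip_at => /negbTE->; rewrite addbF.
have ext y : agree (J :\ n) i j y -> y n (+) y m = a i j n (+) a i j m -> agree J i j y.
  move=> /agreeP h e; apply/agreeP.
  have hw l l' : l \in J -> l' \in J -> l != i -> l != j -> l' != i -> l' != j -> l' != n ->
      y l (+) y l' = a i j l (+) a i j l'.
    move=> lJ l'J li lj l'i l'j l'n; have [->|ln] := eqVneq l n; last by apply: h; rewrite ?inE ?ln ?l'n.
    have := h l' m; rewrite !inE l'n l'J mn mJ l'i l'j mi mj => /(_ isT isT isT isT isT isT) e'.
    by move: e e'; case: (y n) (y m) (y l') (a i j n) (a i j m) (a i j l') => [] [] [] [] [] [].
  move=> l l' lJ l'J li lj l'i l'j.
  have [->|l'n] := eqVneq l' n; last exact: hw.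
  have [->|ln] := eqVneq l n; first by rewrite !addbb.
  by rewrite addbC [RHS]addbC; apply: hw => //; rewrite eq_sym.
have restr y : agree J i j y -> agree (J :\ n) i j y by apply: agreeS (subsetDl _ _).
have eqD : agree (J :\ n) i j (flip_at n x) = agree (J :\ n) i j x.
  apply/agreeP/agreeP => h l l' lJ l'J li lj l'i l'j; have := h l l' lJ l'J li lj l'i l'j;
  by move: lJ l'J; rewrite !inE => /andP[ln _] /andP[l'n _]; rewrite !flipE.
have [Ex|Ex] := boolP (agree (J :\ n) i j x); last first.
  rewrite (negbTE (contra (restr _) Ex)) (negbTE (contra (restr _) _))//.
  by rewrite eqD.
have := ext x Ex; have := ext (flip_at n x); rewrite eqD Ex flipn flipE// => /(_ isT).
have nEn y : agree J i j y -> y n (+) y m = a i j n (+) a i j m.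
  by move/agreeP; apply => //; rewrite eq_sym.
have := nEn x; have := nEn (flip_at n x); rewrite flipn flipE//.
case: (agree J i j x); case: (agree J i j _); case: (x n) (x m) (a i j n) (a i j m) => [] [] [] [] //=;
by [move=> _ /(_ isT)|move=> /(_ isT)|move=> _ _ /(_ erefl)|move=> _ _ _ /(_ erefl)].
Qed.

Lemma agree_flip_at J n i x : agree J i n (flip_at n x) = agree J i n x.
Proof.
apply/agreeP/agreeP => h l l' lJ l'J li lj l'i l'j; have := h l l' lJ l'J li lj l'i l'j;
by rewrite /flip_at (negbTE lj) (negbTE l'j) !addbF.
Qed.

Lemma odd_card (P : pred K) (A : {set K}) :
  odd #|[set j in A | P j]| = \big[addb/false]_(j in A) P j.
Proof.
rewrite -sum1dep_card big_mkcondr /= (big_morph odd oddD (erefl (odd 0))).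
by apply: eq_bigr => j _; case: (P j).
Qed.

(** Add the parities at i for both values at n: the two contributions of the edge
    from i to n cancel, since that edge does not depend on the value at n. *)
Lemma even_degrees_del J n : 3 < #|J| -> n \in J -> even_degrees J -> even_degrees (J :\ n).
Proof.
move=> J3 nJ ev i x iJn; have := iJn; rewrite !inE => /andP[ni iJ].
rewrite odd_card (eq_bigr (fun j => agree J i j x (+) agree J i j (flip_at n x))); last first.
  move=> j; rewrite !inE => /and3P[ji jn jJ]; apply: agree_del => //; rewrite ?inE ?jn//.
  by rewrite eq_sym.
rewrite big_split /=.
have sum0 y : \big[addb/false]_(j in J :\ n :\ i) agree J i j y = agree J i n y.
  have := ev i y iJ; rewrite odd_card (bigD1 n) ?inE 1?eq_sym ?ni//= => e.
  rewrite (eq_bigl (fun j => (j \in J :\ i) && (j != n))); last first.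
    by move=> j; rewrite !inE; case: (j == i); case: (j == n); rewrite ?andbF ?andbT.
  by move: e; case: (agree J i n y); case: (bigop _ _).
by rewrite !sum0 agree_flip_at addbb.
Qed.

Lemma restrict_phase J J' x : even_degrees J -> J' \subset J -> 2 < #|J'| ->
  (even_degrees J') /\ (covered J x -> covered J' x).
Proof.
have [m] := ubnP #|J :\: J'|; elim: m J => // m IH J lt_m ev JJ J3.
have [J'J|] := boolP (J \subset J').
  by have -> : J' = J by apply/eqP; rewrite eqEsubset JJ.
case/subsetPn => n nJ nJ'.
have J'Jn : J' \subset J :\ n by rewrite subsetD1 JJ.
have J4 : 3 < #|J| by have := subset_leq_card J'Jn; have := cardsD1 n J; rewrite nJ; lia.
have lt_m' : #|(J :\ n) :\: J'| < m.
  have -> : (J :\ n) :\: J' = (J :\: J') :\ n by rewrite !setDDl setUC.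
  by have := cardsD1 n (J :\: J'); rewrite inE nJ nJ'; lia.
have [ev' cov'] := IH _ lt_m' (even_degrees_del J4 nJ ev) J'Jn J3.
by split => // /(covered_del n ev)/cov'.
Qed.

(** On four indices, [agree J i j x] compares one difference x k - x l with a
    constant. By parity the negated constants add up to 0 along every triangle, so
    they are the differences of some y, which then satisfies no agreement. *)
Lemma missing_pattern J : #|J| = 4 -> even_degrees J ->
  exists y, forall x, covered J x -> exists2 l, l \in J & x l != y l.
Proof.
move=> J4 ev.
have [s [us ss sJ]] : exists s, [/\ uniq s, size s = 4 & J =i s].
  by exists (enum J); rewrite enum_uniq -cardE; split => // l; rewrite mem_enum.
case: s us ss sJ => // i [] // j [] // k [] // l [] //=.
rewrite !inE !negb_or -!andbA => /and4P[ij ik il /and4P[jk jl kl _]] _ sJ.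
have ji : j != i by rewrite eq_sym. have ki : k != i by rewrite eq_sym.
have li : l != i by rewrite eq_sym. have kj : k != j by rewrite eq_sym.
have lj : l != j by rewrite eq_sym. have lk : l != k by rewrite eq_sym.
have [iJ jJ kJ lJ] : [/\ i \in J, j \in J, k \in J & l \in J].
  by rewrite !sJ !inE !eqxx !orbT.
have agreeE p q r t x : J =i [:: p; q; r; t] -> p != r -> p != t -> q != r -> q != t ->
    agree J p q x = (x r (+) x t == a p q r (+) a p q t).
  move=> eJ pr pt qr qt; apply/agreeP/eqP => [h|h r' t'].
    by apply: h; rewrite 1?eq_sym// eJ !inE eqxx ?orbT.
  rewrite !eJ !inE => + + r'p r'q t'p t'q.
  rewrite (negbTE r'p) (negbTE r'q) (negbTE t'p) (negbTE t'q) /=.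
  move=> /orP[]/eqP-> /orP[]/eqP->//; rewrite ?addbb//.
  by rewrite addbC h addbC.
have perm4 s' : perm_eq s' [:: i; j; k; l] -> J =i s'.
  by move=> e r; rewrite sJ (perm_mem e).
have deg p q r t : perm_eq [:: p; q; r; t] [:: i; j; k; l] ->
    p != q -> p != r -> p != t -> q != r -> q != t -> r != t ->
    (a p q r (+) a p q t) (+) (a p r q (+) a p r t) (+) (a p t q (+) a p t r).
  move=> e pq pr pt qr qt rt; have eJ := perm4 _ e.
  have pJ : p \in J by rewrite eJ inE eqxx.
  have := ev p (fun=> false) pJ; rewrite odd_card.
  have -> : J :\ p = [set q; r; t].
    apply/setP => z; rewrite !inE eJ !inE.
    have [->|zp] := eqVneq z p; last by rewrite -orbA.
    by rewrite (negbTE pq) (negbTE pr) (negbTE pt).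
  rewrite -setUA (big_setU1 q) ?inE ?negb_or ?qr ?qt//= (big_setU1 r) ?inE//= big_set1.
  have eJ2 : J =i [:: p; r; q; t] by move=> z; rewrite eJ !inE; case: (z == q); case: (z == r); rewrite ?orbT.
  have eJ3 : J =i [:: p; t; q; r] by move=> z; rewrite eJ !inE; case: (z == q); case: (z == r);
    case: (z == t); rewrite ?orbT.
  rewrite (agreeE _ _ _ _ _ eJ)// (agreeE _ _ _ _ _ eJ2)// 1?eq_sym//.
  rewrite (agreeE _ _ _ _ _ eJ3)//; last by rewrite eq_sym. 2: by rewrite eq_sym.
  by case: (a p q r) (a p q t) (a p r q) (a p r t) (a p t q) (a p t r) => [] [] [] [] [] [].
(* the pair p, q compares x r - x t with al p q r t; so y i = 0 and y j, say, is
   the negation of the constant with which k, l compare x i - x j *)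
pose al p q r t := a p q r (+) a p q t.
exists (fun z => if z == j then ~~ al k l i j else if z == k then ~~ al j l i k
   else if z == l then ~~ al j k i l else false) => x [p [q [pJ qJ pq Epq]]].
apply/exists_inP; apply: contraLR Epq; rewrite negb_exists_in => /forall_inP/= eqx.
have xi : x i = false by have := eqx i iJ; rewrite negbK (negbTE ij) (negbTE ik) (negbTE il) => /eqP.
have xj : x j = ~~ al k l i j by have := eqx j jJ; rewrite negbK eqxx => /eqP.
have xk : x k = ~~ al j l i k by have := eqx k kJ; rewrite negbK (negbTE kj) eqxx => /eqP.
have xl : x l = ~~ al j k i l by have := eqx l lJ; rewrite negbK (negbTE lj) (negbTE lk) eqxx => /eqP.
have perms : [/\ perm_eq [:: j; i; k; l] [:: i; j; k; l], perm_eq [:: k; i; j; l] [:: i; j; k; l] &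
   perm_eq [:: l; i; j; k] [:: i; j; k; l]].
  by split; apply/permP => P /=; case: (P i); case: (P j); case: (P k); case: (P l).
case: perms => pm1 pm2 pm3.
have di := deg i j k l (perm_refl _) ij ik il jk jl kl.
have dj := deg j i k l pm1 ji jk jl ik il kl.
have dk := deg k i j l pm2 ki kj kl ij il jl.
have dl := deg l i j k pm3 li lj lk ij ik jk.
rewrite (a_sym j i) in dj; rewrite (a_sym k i) (a_sym k j) in dk.
rewrite (a_sym l i) (a_sym l j) (a_sym l k) in dl.
rewrite /al in xj xk xl.
wlog lt_pq : p q pJ qJ pq / (index p [:: i; j; k; l] < index q [:: i; j; k; l])%N => [hw|].
  case: (ltngtP (index p [:: i; j; k; l]) (index q [:: i; j; k; l])) => [||e].
  - exact: hw.
  - by rewrite agreeC; apply: hw; rewrite // eq_sym.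
  - by case/eqP: pq; rewrite -(nth_index i (s := [:: i; j; k; l]) (x := p)) ?e ?nth_index -?sJ.
have fin r t : perm_eq [:: p; q; r; t] [:: i; j; k; l] ->
    p != r -> p != t -> q != r -> q != t -> x r (+) x t != a p q r (+) a p q t ->
    ~~ agree J p q x.
  by move=> /perm4 e pr pt qr qt; rewrite (agreeE _ _ _ _ _ e).
move: pJ qJ lt_pq fin; rewrite !sJ !inE => /or4P[]/eqP-> /or4P[]/eqP-> /=; rewrite ?eqxx
  ?(negbTE ij) ?(negbTE ik) ?(negbTE il) ?(negbTE jk) ?(negbTE jl) ?(negbTE kl) ?(negbTE ji)
  ?(negbTE ki) ?(negbTE li) ?(negbTE kj) ?(negbTE lj) ?(negbTE lk) //= => _ fin;
[apply: (fin k l)|apply: (fin j l)|apply: (fin j k)|apply: (fin i l)|apply: (fin i k)|apply: (fin i j)];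
 rewrite // ?xi ?xj ?xk ?xl; try by apply/permP => P /=; case: (P i); case: (P j); case: (P k); case: (P l).
all: move: di dj dk dl.
all: move: (a i j k (+) a i j l) (a i k j (+) a i k l) (a i l j (+) a i l k)
  (a j k i (+) a j k l) (a j l i (+) a j l k) (a k l i (+) a k l j); clear.
all: by move=> [] [] [] [] [] [].
Qed.
End Phase.

(** * Counting the cells of one simplex *)

(** A class with b elements leaves at most b (b - 1) + (n + 1 - b) (n - b) such
    pairs, a convex function of b whose value is n (n - 1) for b = 1 and b = n. *)
Lemma card_class_pairs n (C : eqType) (k : 'I_n.+1 -> C) :
  (exists i j, k i != k j) ->
  #|[set p : 'I_n.+1 * 'I_n.+1 | (p.1 != p.2) && (k p.1 == k p.2)]| <= n * n.-1.
Proof.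
move=> [i [j kij]]; pose B := [set l | k l == k i].
have cB : #|B| + #|~: B| = n.+1 by rewrite cardsC card_ord.
have B0 : 0 < #|B| by apply/card_gt0P; exists i; rewrite inE.
have B0' : 0 < #|~: B| by apply/card_gt0P; exists j; rewrite !inE eq_sym.
set P := [set p | _].
have : #|P :|: [set (l, l) | l in 'I_n.+1]| <= #|setX B B :|: setX (~: B) (~: B)|.
  apply/subset_leq_card/subsetP => -[l m]; rewrite !inE /=.
  by case/orP => [/andP[_ /eqP->]|/imsetP[r _ [-> ->]]]; case: (_ == k i).
rewrite !cardsU !cardsX (_ : P :&: _ = set0); last first.
  apply/setP => -[l m]; rewrite !inE /=; apply/negP => /andP[/andP[lm _] /imsetP[r _ [e1 e2]]].
  by rewrite e1 e2 eqxx in lm.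
rewrite (_ : setX B B :&: _ = set0); last first.
  by apply/setP => -[l m]; rewrite !inE /=; case: (k l == k i); rewrite ?andbF.
rewrite cards0 !subn0 card_imset; last by move=> ? ? [].
rewrite card_ord; move: #|B| #|~: B| #|P| cB B0 B0'; clear; move=> b c p.
by case: n => [|m] /=; nia.
Qed.

(** V is the set of orthants, [chi s l] the value of s at the vertex l, and [u i] the
    linear part of the i-th barycentric coordinate, all modulo 2. *)
Section Simplex.
Variables (n : nat) (V : finZmodType).
Notation K := 'I_n.+1.
Variables (chi : V -> K -> bool) (u : K -> V).
Hypothesis chi_inj : forall s t, (forall l m, chi s l (+) chi s m = chi t l (+) chi t m) -> s = t.
Hypothesis chiD : forall s t l, chi (s + t)%R l = chi s l (+) chi t l.
Hypothesis chi_u : forall i l m, chi (u i) l (+) chi (u i) m = (l == i) (+) (m == i).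

Lemma chi_addu s i l m : l != i -> m != i -> chi (s + u i)%R l (+) chi (s + u i)%R m = chi s l (+) chi s m.
Proof.
move=> li mi; have := chi_u i l m; rewrite !chiD (negbTE li) (negbTE mi) /=.
by case: (chi s l) (chi s m) (chi (u i) l) (chi (u i) m) => [] [] [] [].
Qed.

Section Curve.
Variable a : K -> K -> bool.
Definition facet_phase i := [set s | [forall l in [set~ i], forall m in [set~ i],
  chi s l (+) chi s m == a i l (+) a i m]].

Lemma facet_phaseP i s : reflect (forall l m, l != i -> m != i ->
  chi s l (+) chi s m = a i l (+) a i m) (s \in facet_phase i).
Proof.
rewrite inE; apply: (iffP forall_inP) => [h l m li mi|h l].
  have := h l; rewrite !inE li => /(_ isT)/forall_inP/(_ m).
  by rewrite !inE => /(_ mi)/eqP.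
by rewrite !inE => li; apply/forall_inP => m; rewrite !inE => mi; apply/eqP/h.
Qed.

Lemma card_facet_phase i : 0 < n -> #|facet_phase i| <= 2.
Proof.
move=> n0; have [r ri] : exists r, r != i.
  have : 0 < #|[set~ i]| by rewrite cardsC1 card_ord.
  by case/card_gt0P => r; rewrite !inE; exists r.
have -> : 2 = #|{: bool}| by rewrite card_bool.
apply: (@leq_card_in _ _ (fun s => chi s i (+) chi s r)).
move=> s t /facet_phaseP hs /facet_phaseP ht e.
suff hr l : chi s l (+) chi s r = chi t l (+) chi t r.
  apply: chi_inj => l m; have := hr l; have := hr m.
  by case: (chi s l) (chi s r) (chi s m) (chi t l) (chi t r) (chi t m) => [] [] [] [] [] [].
by have [->//|li] := eqVneq l i; rewrite hs// ht.
Qed.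

(** Each of the n + 1 facets contributes at most two orthants, and an orthant that
    occurs does so an even number of times, hence at least twice. *)
Lemma card_curve_phase : 0 < n -> (forall s, ~~ odd #|[set i | s \in facet_phase i]|) ->
  #|\bigcup_i facet_phase i| <= n.+1.
Proof.
move=> n0 ev; set D := \bigcup_i _.
have : \sum_(s in D) 2 <= \sum_(s in D) #|[set i | s \in facet_phase i]|.
  apply: leq_sum => s /bigcupP[i _ si]; have := ev s.
  have : 0 < #|[set i | s \in facet_phase i]| by apply/card_gt0P; exists i; rewrite inE.
  by case: #|_| => [|[]].
rewrite sum_nat_const.
have -> : \sum_(s in D) #|[set i | s \in facet_phase i]| = \sum_i #|facet_phase i|.
  under eq_bigr do rewrite -sum1dep_card.
  rewrite (exchange_big_dep predT)//=; apply: eq_bigr => i _.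
  rewrite -sum1_card; apply: eq_bigl => s; apply: andb_idl => si.
  by apply/bigcupP; exists i.
have : \sum_i #|facet_phase i| <= \sum_(i < n.+1) 2 by apply: leq_sum => i _; apply: card_facet_phase.
rewrite sum_nat_const card_ord; lia.
Qed.
End Curve.

Section Surface.
Variable a : K -> K -> K -> bool.
Hypothesis a_sym : forall i j, a i j = a j i.
Hypothesis ev : even_degrees a setT.
Definition ridge_phase i j := [set s | agree a setT i j (chi s)].

(** The facets crossed by the cell of the orthant s, whose corners are the ridges. *)
Definition sides s := [set i | [exists j in [set~ i], s \in ridge_phase i j]].

Lemma sidesP s i : reflect (exists2 j, j != i & s \in ridge_phase i j) (i \in sides s).
Proof.
by rewrite inE; apply: (iffP exists_inP) => -[j]; rewrite ?inE => ji h; exists j; rewrite ?inE.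
Qed.

Lemma ridge_phaseC i j : ridge_phase i j = ridge_phase j i.
Proof. by apply/setP => s; rewrite !inE agreeC. Qed.

(** Patterns are normalized to vanish at vertex 0, which leaves a family of subsets
    of the n other vertices. A shattered triple together with 0 would be a set of
    four vertices that has no missing pattern. *)
Lemma card_surface_phase (D : {set V}) : (forall s, s \in D -> sides s != set0) ->
  #|D| <= 1 + n + 'C(n, 2).
Proof.
move=> hD.
pose A s := [set l : 'I_n | chi s (lift ord0 l) (+) chi s ord0].
have injA : injective A.
  move=> s t /setP e; apply: chi_inj.
  suff h l : chi s l (+) chi s ord0 = chi t l (+) chi t ord0.
    move=> l m; have := h l; have := h m.
    by case: (chi s l) (chi s ord0) (chi s m) (chi t l) (chi t ord0) (chi t m) => [] [] [] [] [] [].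
  by case: (unliftP ord0 l) => [j|] ->; rewrite ?addbb//; have := e j; rewrite !inE.
have := @card_vc2 _ (A @: D); rewrite card_ord card_imset//; apply => S S3.
apply/negP => /shattersP sh.
pose J := ord0 |: [set lift ord0 l | l in S].
have J4 : #|J| = 4.
  rewrite cardsU1 card_imset ?S3; last exact: lift_inj.
  by rewrite (_ : _ \notin _)//; apply/imsetP => -[l _ /(congr1 val)].
have J3 : 2 < #|J| by rewrite J4.
have [evJ covJ] : even_degrees a J /\ forall x, covered a setT x -> covered a J x.
  by split=> [|x]; [have [] := restrict_phase a_sym (fun=> true) ev (subsetT J) J3
    |have [] := restrict_phase a_sym x ev (subsetT J) J3].
have [y hy] := missing_pattern a_sym J4 evJ.
pose B := [set l in S | y (lift ord0 l) (+) y ord0].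
have [|_ /imsetP[s sD ->] e] := sh B; first by apply/subsetP => l; rewrite inE => /andP[].
pose c := chi s ord0 (+) y ord0.
have /hy[l lJ] : covered a J (fun l => chi s l (+) c).
  apply: covJ; have /set0Pn[i /sidesP[j ji]] := hD s sD; rewrite inE => /agreeP Eij.
  exists i, j; split; rewrite ?inE 1?eq_sym//; apply/agreeP => p q pT qT pi pj qi qj.
  have := Eij p q pT qT pi pj qi qj.
  by case: (chi s p) (chi s q) c (a i j p) (a i j q) => [] [] [] [] [].
move: lJ; rewrite /c !inE => /orP[/eqP->|/imsetP[l' l'S ->]].
  by case: (chi s _) (y _) => [] [].
move/setP/(_ l'): e; rewrite !inE l'S andbT /=.
by case: (chi s _) (chi s _) (y _) (y _) => [] [] [] [].
Qed.

Lemma ridge_phase_addu s i j : (s + u i \in ridge_phase i j)%R = (s \in ridge_phase i j).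
Proof.
rewrite !inE; apply/agreeP/agreeP => h l m lT mT li lj mi mj; have := h l m lT mT li lj mi mj;
by rewrite chi_addu.
Qed.

Lemma adj_sides s i j : i != j -> s \in ridge_phase i j -> i \in sides s.
Proof. by move=> ij h; apply/sidesP; exists j; rewrite // eq_sym. Qed.

Lemma even_nbrs s i : ~~ odd #|[set j in [set~ i] | s \in ridge_phase i j]|.
Proof.
have := ev (chi s) (in_setT i); congr (~~ odd _); apply: eq_card => j.
by rewrite !inE andbT.
Qed.

Lemma nbrs_sides s i : [set j in [set~ i] | s \in ridge_phase i j] \subset sides s :\ i.
Proof.
apply/subsetP => j; rewrite inE in_setC1 => /andP[ji h]; rewrite in_setD1 ji /=.
by apply: (adj_sides (j := i)) => //; rewrite ridge_phaseC.
Qed.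

Lemma two_le_nbrs s i : i \in sides s -> 1 < #|[set j in [set~ i] | s \in ridge_phase i j]|.
Proof.
move=> /sidesP[j ji sE]; have := even_nbrs s i.
have : 0 < #|[set j in [set~ i] | s \in ridge_phase i j]|.
  by apply/card_gt0P; exists j; rewrite inE in_setC1 ji.
by case: #|_| => [|[]].
Qed.

(** A nonempty graph with even degrees and no loops or double edges has at least
    three vertices. *)
Lemma three_le_sides s : sides s != set0 -> 2 < #|sides s|.
Proof.
case/set0Pn => i si; have := two_le_nbrs si; have := subset_leq_card (nbrs_sides s i).
by have := cardsD1 i (sides s); rewrite si; lia.
Qed.

Lemma triangle_ridges s i j : #|sides s| = 3 -> i \in sides s -> j \in sides s -> i != j ->
  s \in ridge_phase i j.
Proof.
move=> c3 si sj ij; have h := two_le_nbrs si.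
have := nbrs_sides s i; have := cardsD1 i (sides s); rewrite si c3 => cD sub.
have /eqP e : [set j in [set~ i] | s \in ridge_phase i j] == sides s :\ i by rewrite eqEcard sub; lia.
have : j \in sides s :\ i by rewrite in_setD1 eq_sym ij.
by rewrite -e inE => /andP[].
Qed.

Lemma card_ridge_phase i j : 1 < n -> i != j -> #|ridge_phase i j| <= 4.
Proof.
move=> n1 ij; have [r ri rj] : exists2 r, r != i & r != j.
  have : 0 < #|~: [set i; j]| by have := cardsC [set i; j]; rewrite cards2 card_ord; case: (_ != _); lia.
  by case/card_gt0P => r; rewrite !inE negb_or => /andP[]; exists r.
have -> : 4 = #|{: bool * bool}| by rewrite card_prod !card_bool.
apply: (@leq_card_in _ _ (fun s => (chi s i (+) chi s r, chi s j (+) chi s r))).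
move=> s t; rewrite !inE => /agreeP hs /agreeP ht [ei ej].
suff hr l : chi s l (+) chi s r = chi t l (+) chi t r.
  apply: chi_inj => l m; have := hr l; have := hr m.
  by case: (chi s l) (chi s r) (chi s m) (chi t l) (chi t r) (chi t m) => [] [] [] [] [] [].
have [->//|li] := eqVneq l i; have [->//|lj] := eqVneq l j.
by rewrite hs// ht.
Qed.

(** The phase of the ridge i, j consists of four orthants, and s and s + u i are
    not both triangles: they would have the same sides i, j, r, whereas u i is not
    constant on the ridge opposite to j and r when n > 2. So each pair of sides
    belongs to at most two triangles, while a triangle has three pairs, all of them
    inside a class of k. *)
Lemma card_triangles (C : eqType) (k : K -> C) (T : {set V}) : 2 < n ->
  (exists i j, k i != k j) ->
  (forall s, s \in T -> #|sides s| = 3) ->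
  (forall s i j, s \in T -> i \in sides s -> j \in sides s -> k i = k j) ->
  3 * #|T| <= n * n.-1.
Proof.
move=> n2 kN T3 Tk.
pose A i j := [set s in T | (i \in sides s) && (j \in sides s)].
have A2 i j : i != j -> #|A i j| <= 2.
  move=> ij; (* A i j and its translate by u i are disjoint inside the four orthants *)
  pose A' := [set s + u i | s in A i j]%R.
  have cA' : #|A'| = #|A i j| by apply: card_imset; apply: addIr.
  have AE : A i j \subset ridge_phase i j.
    by apply/subsetP => s; rewrite inE => /and3P[sT si sj]; apply: triangle_ridges => //; apply: T3.
  have A'E : A' \subset ridge_phase i j.
    by apply/subsetP => _ /imsetP[s /(subsetP AE) h ->]; rewrite ridge_phase_addu.
  have : #|A i j :|: A'| <= 4.
    by apply: leq_trans (card_ridge_phase (ltnW n2) ij); rewrite subset_leq_card// subUset AE.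
  rewrite cardsU cA' (_ : _ :&: _ = set0) ?cards0; first lia.
  apply/setP => t; rewrite inE in_set0; apply/negP => /andP[tA /imsetP[s sA et]].
  have := sA; have := tA; rewrite inE => /and3P[tT ti tj]; rewrite inE => /and3P[sT si sj].
  have [r sr] : exists r, r \in sides s :\ i :\ j.
    apply/card_gt0P; have := cardsD1 i (sides s); have := cardsD1 j (sides s :\ i).
    by rewrite (T3 _ sT) in_setD1 si eq_sym ij sj; lia.
  have [rj ri rs] : [/\ r != j, r != i & r \in sides s].
    by move: sr; rewrite !in_setD1 => /and3P[].
  have sE p q : p != q -> p \in sides s -> q \in sides s -> s \in ridge_phase p q.
    by move=> pq sp sq; apply: triangle_ridges => //; apply: T3.
  have rt : r \in sides t.
    apply: (@adj_sides _ _ i) => //; rewrite et ridge_phaseC ridge_phase_addu.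
    by apply: sE => //; rewrite eq_sym.
  have tE : t \in ridge_phase j r by apply: triangle_ridges; rewrite ?T3// eq_sym.
  have sjr : s \in ridge_phase j r by apply: sE; rewrite // eq_sym.
  have [q [qi qj qr]] : exists q, [/\ q != i, q != j & q != r].
    have : 0 < #|~: [set i; j; r]|.
      by have := cardsC [set i; j; r]; rewrite card_ord -setUA !cardsU1 cards1 !inE;
        move: #|~: _| (~~ _) (~~ _) => c [] []; clear -n2; lia.
    by case/card_gt0P => q; rewrite !inE !negb_or -andbA => /and3P[]; exists q.
  move: tE sjr; rewrite !inE => /agreeP ht /agreeP hs.
  have := ht i q; have := hs i q; rewrite !in_setT => /(_ isT isT ij) hs' /(_ isT isT ij) ht'.
  have ir : i != r by rewrite eq_sym.
  have := ht' ir qj qr; rewrite -(hs' ir qj qr) et !chiD.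
  have := chi_u i i q; rewrite eqxx (negbTE qi).
  by case: (chi s i) (chi s q) (chi (u i) i) (chi (u i) q) => [] [] [] [].
pose P := [set p : K * K | (p.1 != p.2) && (k p.1 == k p.2)].
have : \sum_(s in T) #|[set p : K * K | (p.1 != p.2) && (p \in setX (sides s) (sides s))]| <= \sum_(p in P) 2.
  under eq_bigr do rewrite -sum1dep_card.
  rewrite (exchange_big_dep (mem P))/=; last first.
    move=> s p sT /andP[pp]; rewrite !inE pp /=; case/andP => p1 p2.
    by apply/eqP; apply: (Tk s); rewrite // inE.
  apply: leq_sum => -[i j]; rewrite inE /= => /andP[pp _].
  apply: leq_trans (A2 _ _ pp); rewrite -sum1_card leq_eqVlt; apply/orP; left; apply/eqP.
  by apply: eq_bigl => s; rewrite pp [in RHS]inE !in_setX.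
rewrite (eq_bigr (fun _ => 6)); last first.
  move=> s /T3 s3.
  have := cardsID [set p : K * K | p.1 != p.2] (setX (sides s) (sides s)).
  rewrite cardsX s3 [X in X + _](_ : _ =
      #|[set p : K * K | (p.1 != p.2) && (p \in setX (sides s) (sides s))]|); last first.
    by apply: eq_card => p; rewrite !inE andbC.
  rewrite [X in _ + X](_ : _ = 3); first lia.
  rewrite -s3 -(card_imset (sides s) (f := fun i => (i, i))); last by move=> ? ? [].
  apply: eq_card => -[l m]; rewrite 3!inE /= negbK; apply/andP/imsetP.
    by move=> [/eqP-> /andP[? ?]]; exists m.
  by move=> [r rs [-> ->]]; rewrite rs.
rewrite !sum_nat_const; have := card_class_pairs kN; rewrite -/P; lia.
Qed.
End Surface.
End Simplex.

(** * Cells, neighbours and components *)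

Lemma classes_le (T : finType) (C : eqType) (cls : T -> C) (D : {set T}) (g : T -> nat) m :
  (forall x, x \in D -> m <= \sum_(y in D | cls y == cls x) g y) ->
  m * size (undup [seq cls x | x in D]) <= \sum_(x in D) g x.
Proof.
move=> h; set l := undup _.
have -> : \sum_(x in D) g x = \sum_(c <- l) \sum_(x in D | cls x == c) g x.
  rewrite (exchange_big_dep (mem D))/=; last by move=> ? ? _ /andP[].
  apply: eq_bigr => x xD; rewrite (eq_bigl (pred1 (cls x))); last first.
    by move=> c; rewrite xD eq_sym.
  rewrite -big_filter filter_pred1_uniq ?undup_uniq ?big_seq1// mem_undup.
  by apply/imageP; exists x.
apply: (@leq_trans (\sum_(c <- l) m)).
  by rewrite big_const_seq count_predT iter_addn_0.
rewrite big_seq [leqRHS]big_seq; apply: leq_sum => c; rewrite mem_undup => /imageP[x xD ->].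
exact: h.
Qed.

(** S is the set of full simplices and [p t] enumerates the vertices [vs t]. The
    simplex across the facet opposite to [p t i] is [opp t i], with new vertex
    [q t i]; None stands for a facet in the boundary, and crossing it changes the
    orthant by [u t i]. The cells of D are mapped to their components by cls, and
    [sd t s] lists the sides of a cell. *)
Section Components.
Variables (n : nat) (V : finZmodType) (Z : choiceType) (S : finType) (C : eqType).
Notation K := 'I_n.+1.
Local Open Scope fset_scope.
Local Open Scope ring_scope.
Variables (vs : S -> {fset Z}) (p : S -> K -> Z) (opp : S -> K -> option S) (q : S -> K -> Z).
Variables (u : S -> K -> V) (D : {set S * V}) (sd : S -> V -> {set K}) (cls : S * V -> C).
Hypothesis p_inj : forall t, injective (p t).
Hypothesis p_vs : forall t i, p t i \in vs t.
Hypothesis oppE : forall t i t', opp t i = Some t' ->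
  q t i \notin vs t /\ vs t' = q t i |` (vs t `\ p t i).
Hypothesis V2 : forall s : V, s + s = 0.
Hypothesis u_neq0 : forall t i, u t i != 0.
Hypothesis u_neq : forall t i j, i != j -> opp t i = None -> opp t j = None -> u t i != u t j.

Definition nbr (x : S * V) i : S * V :=
  if opp x.1 i is Some t' then (t', x.2) else (x.1, x.2 + u x.1 i).

Hypothesis nbrD : forall x i, x \in D -> i \in sd x.1 x.2 -> nbr x i \in D /\ cls (nbr x i) = cls x.

Lemma opp_neq t i t' : opp t i = Some t' -> t' != t.
Proof.
move=> /oppE[qt e]; apply/eqP => tt'; subst t'; move: qt.
by rewrite e fset1U1.
Qed.

Lemma nbr_neq x i : nbr x i != x.
Proof.
case: x => t s; rewrite /nbr/=; case e: (opp t i) => [t'|]; apply/eqP => -[].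
  by move/eqP; apply/negP; exact: opp_neq e.
by rewrite -[RHS]addr0 => /addrI/eqP; apply/negP.
Qed.

(** A simplex across facet i keeps the vertex opposite to any other facet j, and
    loses it across j. *)
Lemma nbr_inj x : injective (nbr x).
Proof.
case: x => t s i j; apply: contra_eq => ij; rewrite /nbr/=.
case ei: (opp t i) => [ti|]; case ej: (opp t j) => [tj|]; apply/eqP => -[].
- have [qi ei'] := oppE ei; have [qj ej'] := oppE ej => tij; move: (p_vs t j).
  have : p t j \in vs ti.
    by rewrite ei' !inE (inj_eq (@p_inj t)) (eq_sym j) ij p_vs orbT.
  rewrite tij ej' !inE eqxx /= orbF => /eqP-> h; case/negP: qj; exact: h.
- by move/eqP; rewrite (negbTE (opp_neq ei)).
- by move/eqP; rewrite eq_sym (negbTE (opp_neq ej)).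
- by move/addrI/eqP; apply/negP; apply: u_neq.
Qed.

Definition class_of x := [set y in D | cls y == cls x].

Lemma nbr_class x i : x \in D -> i \in sd x.1 x.2 -> nbr x i \in class_of x :\ x.
Proof. by move=> xD /(nbrD xD)[nD e]; rewrite !inE nbr_neq nD e eqxx. Qed.

Lemma sides_class x : x \in D -> (#|sd x.1 x.2| < #|class_of x|)%N.
Proof.
move=> xD; rewrite (cardsD1 x (class_of x)) inE xD eqxx add1n ltnS.
rewrite -(card_imset _ (@nbr_inj x)); apply/subset_leq_card/subsetP => _ /imsetP[i si ->].
exact: nbr_class.
Qed.

Hypothesis u_closed : forall t i j l, i != j -> opp t i = None -> opp t j = None ->
  opp t l = None -> u t l != u t i + u t j.
Hypothesis sd3 : forall x, x \in D -> (2 < #|sd x.1 x.2|)%N.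

(** In a class of four cells any two are neighbours. Two cells in different
    orthants of t are adjacent only through the boundary, which leaves the case of
    three boundary facets with dependent [u t], and that is excluded by [u_closed];
    a cell of t in another orthant and one in another simplex are never adjacent.
    So the neighbours of x lie in three other simplices, any two of which share a
    facet; since they omit different vertices of t, they have the same new vertex. *)
Lemma small_class x : x \in D -> #|class_of x| = 4%N ->
  #|sd x.1 x.2| = 3%N /\ {in sd x.1 x.2 &, forall i j,
     opp x.1 i != None /\ q x.1 i = q x.1 j}.
Proof.
have all_nbrs y : y \in D -> #|class_of y| = 4%N -> #|sd y.1 y.2| = 3%N /\
    class_of y :\ y = [set nbr y i | i in sd y.1 y.2].
  move=> yD c4; have := sides_class yD; rewrite c4 => lt4.
  have s3 : #|sd y.1 y.2| = 3%N by have := sd3 yD; lia.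
  split=> //; apply/esym/eqP; rewrite eqEcard card_imset; last exact: nbr_inj.
  have := cardsD1 y (class_of y); rewrite c4 inE yD eqxx s3 add1n => -[<-]; rewrite leqnn andbT.
  by apply/subsetP => _ /imsetP[i si ->]; exact: nbr_class.
move=> xD c4; have [s3 eN] := all_nbrs x xD c4; split => //.
have key i j : i \in sd x.1 x.2 -> j \in sd x.1 x.2 -> i != j ->
    opp x.1 i != None /\ q x.1 i = q x.1 j.
  move=> si sj ij; have [niD nic] := nbrD xD si; have [njD njc] := nbrD xD sj.
  have ec : class_of (nbr x i) = class_of x by apply/setP => y; rewrite !inE nic.
  have c4' : #|class_of (nbr x i)| = 4%N by rewrite ec.
  have [_] := all_nbrs _ niD c4'; rewrite ec => eNi.
  have : nbr x j \in [set nbr (nbr x i) l | l in sd (nbr x i).1 (nbr x i).2].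
    by rewrite -eNi !inE (inj_eq (@nbr_inj x)) eq_sym ij njD njc eqxx.
  case/imsetP => l _; case: (x) => t s; rewrite /nbr/=.
  case ei: (opp t i) => [ti|]; case ej: (opp t j) => [tj|] /=.
  - case el: (opp ti l) => [tl|] => -[]; last first.
      move=> tji; have := @nbr_inj (t, s) i j; rewrite /nbr /= ei ej tji => /(_ erefl)/eqP.
      by rewrite (negbTE ij).
    move=> tjl; split => //; apply/eqP; apply: contraT => qij.
    have [qi ei'] := oppE ei; have [qj ej'] := oppE ej; have [_ el'] := oppE el.
    (* tj and ti differ by one vertex, but if the apexes were different, both
       p t i and q t j would be vertices of tj outside ti *)
    have notin_i v : v \in vs tj -> v \notin vs ti -> v = q ti l.
      by rewrite tjl el' !inE => /orP[/eqP//|/andP[_ ->]].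
    have pi : p t i = q ti l.
      apply: notin_i; rewrite ?ej' ?ei' !inE ?eqxx ?(inj_eq (@p_inj t)) ?ij ?p_vs ?orbT ?orbF//.
      by apply: contraNneq qi => <-.
    have qjE : q t j = q ti l.
      apply: notin_i; first by rewrite ej' fset1U1.
      by rewrite ei' !inE eq_sym (negbTE qij) (negbTE qj) andbF.
    by case/negP: qj; rewrite qjE -pi.
  - case el: (opp ti l) => [tl|] => -[]; last first.
      by move/eqP; rewrite eq_sym (negbTE (opp_neq ei)).
    by move=> _ /eqP; rewrite -[X in _ == X]addr0 (inj_eq (addrI _)) (negbTE (u_neq0 _ _)).
  - case el: (opp t l) => [tl|] => -[].
      by move=> _ /eqP; rewrite -[X in X == _]addr0 (inj_eq (addrI _)) eq_sym (negbTE (u_neq0 _ _)).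
    by move/eqP; rewrite (negbTE (opp_neq ej)).
  - case el: (opp t l) => [tl|] => -[].
      by move/eqP; rewrite eq_sym (negbTE (opp_neq el)).
    rewrite -addrA => /addrI e; have := u_closed ij ei ej el.
    by rewrite e addrA V2 add0r eqxx.
move=> i j si sj; have [<-|] := eqVneq i j; last exact: key.
have : (0 < #|sd x.1 x.2 :\ i|)%N by have := cardsD1 i (sd x.1 x.2); rewrite si s3; lia.
case/card_gt0P => r; rewrite !inE => /andP[ri sr].
by have [|] := key i r si sr; rewrite 1?eq_sym.
Qed.
End Components.

Require Import Defs.
From mathcomp Require Import all_classical all_reals all_analysis.
Import numFieldNormedType.Exports.

Local Open Scope classical_set_scope.
Local Open Scope ring_scope.

(** * Lower bounds for volumes *)

Section LowerIntegral.
Local Open Scope ereal_scope.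
Context d (T : measurableType d) (R : realType) (mu : {measure set T -> \bar R}).
Import HBNNSimple.

(** The integral of a nonnegative function is the supremum of the integrals of the
    simple functions below it, so superadditivity holds without measurability. *)
Lemma integral_superadditive (f g : T -> \bar R) :
  (forall x, 0 <= f x) -> (forall x, 0 <= g x) ->
  \int[mu]_x f x + \int[mu]_x g x <= \int[mu]_x (f x + g x).
Proof.
move=> f0 g0; have fg0 x : 0 <= f x + g x by rewrite adde_ge0.
set I := \int[mu]_x (f x + g x).
have [->|Ify] := eqVneq I +oo; first exact: leey.
have I0 : 0 <= I by apply: integral_ge0.
have Ifin : I \is a fin_num by rewrite ge0_fin_numE // ltey.
have key (h1 h2 : {nnsfun T >-> R}) : (forall x, (h1 x)%:E <= f x) ->
    (forall x, (h2 x)%:E <= g x) -> sintegral mu h1 + sintegral mu h2 <= I.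
  move=> h1f h2g; rewrite -sintegralD /I ge0_integralTE//.
  apply: ereal_sup_ubound => /=; exists (add_nnsfun h1 h2) => //= x.
  by rewrite EFinD leeD.
have fin1 (h : {nnsfun T >-> R}) : (forall x, (h x)%:E <= f x) -> sintegral mu h \is a fin_num.
  move=> hf; rewrite ge0_fin_numE ?sintegral_ge0//.
  have := key h nnsfun0 hf; rewrite sintegral0 adde0 => /(_ (fun x => g0 x)) hI.
  by apply: le_lt_trans hI _; rewrite -ge0_fin_numE.
have le1 (h2 : {nnsfun T >-> R}) : (forall x, (h2 x)%:E <= g x) ->
    \int[mu]_x f x + sintegral mu h2 <= I.
  move=> h2g.
  have fin2 : sintegral mu h2 \is a fin_num.
    rewrite ge0_fin_numE ?sintegral_ge0//.
    have := key nnsfun0 h2; rewrite sintegral0 add0e => /(_ (fun x => f0 x) h2g) hI.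
    by apply: le_lt_trans hI _; rewrite -ge0_fin_numE.
  rewrite -leeBrDr// ge0_integralTE//; apply: ge_ereal_sup => _ [h1 /= h1f <-].
  by rewrite leeBrDr//; apply: key.
have finf : \int[mu]_x f x \is a fin_num.
  rewrite ge0_fin_numE ?integral_ge0//.
  have := le1 nnsfun0 (fun x => g0 x); rewrite sintegral0 adde0 => hI.
  by apply: le_lt_trans hI _; rewrite -ge0_fin_numE.
rewrite -leeBrDl// [X in X <= _]ge0_integralTE//.
by apply: ge_ereal_sup => _ [h2 /= h2g <-]; rewrite leeBrDl//; apply: le1.
Qed.

Lemma integral_superadditive_sum (I : Type) (s : seq I) (f : I -> T -> \bar R) :
  (forall i x, 0 <= f i x) ->
  \sum_(i <- s) \int[mu]_x f i x <= \int[mu]_x \sum_(i <- s) f i x.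
Proof.
move=> f0; elim: s => [|i s IH].
  by rewrite big_nil; apply: integral_ge0 => x _; rewrite big_nil.
rewrite big_cons; apply: le_trans (leeD2l _ IH) _.
apply: le_trans (integral_superadditive _ _) _ => // [x|]; first exact: sume_ge0.
by under [leRHS]eq_integral do rewrite big_cons.
Qed.

(** A simple function below f, restricted to the complement of N, is below g and
    has the same integral. *)
Lemma le_integral_off_null (N : set T) (f g : T -> \bar R) :
  measurable N -> mu N = 0 -> (forall x, 0 <= f x) -> (forall x, 0 <= g x) ->
  (forall x, ~ N x -> f x <= g x) -> \int[mu]_x f x <= \int[mu]_x g x.
Proof.
move=> mN N0 f0 g0 fg; rewrite !ge0_integralTE//.
apply: ge_ereal_sup => _ [h /= hf <-].
pose h' := proj_nnsfun h (measurableC mN).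
have h'E x : h' x = (h x * \1_(~` N) x)%R by [].
have -> : sintegral mu h = sintegral mu h'.
  rewrite -!integralT_nnsfun; apply: ae_eq_integral => //.
  - exact/measurable_realfun.measurable_EFinP.
  - exact/measurable_realfun.measurable_EFinP.
  exists N; split => // x hx; apply: contrapT => Nx; apply: hx => _; congr EFin; change (h x = h' x).
  by rewrite h'E indicE mem_set// mulr1.
apply: ereal_sup_ubound => /=; exists h' => // x; rewrite h'E indicE.
have [Nx|Nx] := pselect (N x); first by rewrite memNset ?mulr0//= => /(_ Nx).
by rewrite mem_set// mulr1; apply: le_trans (hf x) _; apply: fg.
Qed.
End LowerIntegral.

Section Volume.
Context {R : realType}.
Local Open Scope ereal_scope.
Notation mu := (@lebesgue_measure R).

Lemma euclidean_volume_ge0 n (A : set 'rV[R]_n) : 0 <= euclidean_volume A.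
Proof.
elim: n A => [|n IH] A /=; first by rewrite lee_fin.
by apply: integral_ge0.
Qed.

Definition slice n (A : set 'rV[R]_n.+1) (t : R) : set 'rV[R]_n :=
  [set y | A (row_mx (const_mx t : 'rV[R]_1) y)].

Lemma euclidean_volume0 n : euclidean_volume (set0 : set 'rV[R]_n) = 0.
Proof.
elim: n => [|n IH] /=; first by rewrite indic0.
apply: integral0_eq => t _; rewrite (_ : [set _ | _] = set0)//.
Qed.

Lemma le_euclidean_volume n (A B : set 'rV[R]_n) : A `<=` B ->
  euclidean_volume A <= euclidean_volume B.
Proof.
elim: n A B => [|n IH] A B AB /=.
  rewrite lee_fin !indicE; have [/set_mem/AB/mem_set ->//|_] := boolP (_ \in A).
  exact: ler0n.
apply: (@le_integral_off_null _ _ _ _ set0); rewrite ?measure0//.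
- by move=> t; apply: euclidean_volume_ge0.
- by move=> t; apply: euclidean_volume_ge0.
move=> t _.
by apply: IH => y; apply: AB.
Qed.

(** A set inside an affine hyperplane. The case c = 0, b != 0 includes the empty
    set, which is the only flat set in dimension 0. *)
Definition flat n (A : set 'rV[R]_n) := exists (c : 'cV[R]_n) (b : R),
  ((c != 0) || (b != 0))%R /\ forall x, A x -> ((x *m c) 0 0 = b)%R.

Lemma row_mx_ord0 n (t : R) (y : 'rV[R]_n) :
  ((row_mx (const_mx t : 'rV[R]_1) y : 'rV_n.+1) 0 ord0 = t)%R.
Proof.
transitivity (row_mx (const_mx t : 'rV[R]_1) y 0 (lshift n (ord0 : 'I_1)))%R; last by rewrite row_mxEl mxE.
by congr (fun_of_matrix _ _ _); exact/val_inj.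
Qed.

Lemma row_mx_lift0 n (t : R) (y : 'rV[R]_n) i :
  ((row_mx (const_mx t : 'rV[R]_1) y : 'rV_n.+1) 0 (lift ord0 i) = y 0 i)%R.
Proof.
transitivity (row_mx (const_mx t : 'rV[R]_1) y 0 (rshift 1 i))%R; last by rewrite row_mxEr.
by congr (fun_of_matrix _ _ _); exact/val_inj.
Qed.

Lemma mul_row_mx_const n (t : R) (y : 'rV[R]_n) (c : 'cV[R]_n.+1) :
  ((row_mx (const_mx t : 'rV[R]_1) y *m c) 0 0 = t * c 0 0 + (y *m dsubmx (c : 'cV_(1 + n))) 0 0)%R.
Proof.
rewrite mxE [X in _ = (_ + X)%R]mxE big_ord_recl row_mx_ord0; congr (_ + _)%R.
apply: eq_bigr => i _; rewrite row_mx_lift0 [dsubmx _ _ _]mxE; congr (_ * c _ _)%R.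
exact/val_inj.
Qed.

(** The hyperplane cuts the slice at t along the hyperplane of [dsubmx c] and
    [b - t * c 0 0], which degenerates for one value of t at most. *)
Lemma flat_slice n (A : set 'rV[R]_n.+1) : flat A ->
  exists r : R, forall t, t <> r -> flat (slice A t).
Proof.
move=> [c [b [cb h]]]; pose c0 : R := (c 0 0)%R; pose c' : 'cV[R]_n := dsubmx (c : 'cV_(1 + n)).
exists (b / c0)%R => t tr; exists c', (b - t * c0)%R; split; last first.
  by move=> y /h <-; rewrite mul_row_mx_const addrAC subrr add0r.
case: eqVneq => //= c'0; case: (eqVneq c0 0%R) => [c00|c0n].
  rewrite c00 mulr0 subr0; move: cb; suff -> : c = 0%R by rewrite eqxx.
  apply/matrixP => i j; rewrite mxE ord1; case: (unliftP 0%R i) => [k|] ->; last exact: c00.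
  by move/matrixP/(_ k 0%R): c'0; rewrite !mxE => <-; congr (c _ _); exact/val_inj.
apply/eqP => e; apply: tr; apply: (canRL (mulfK c0n)).
by apply/eqP; rewrite eq_sym -subr_eq0 e.
Qed.

(** By induction on the dimension: all but finitely many slices satisfy the
    hypothesis again. *)
Lemma euclidean_volume_superadditive n (I : finType) (A : I -> set 'rV[R]_n) :
  (forall i j, i != j -> flat (A i `&` A j)) ->
  \sum_i euclidean_volume (A i) <= euclidean_volume (\bigcup_i A i).
Proof.
elim: n A => [|n IH] A fA /=.
  have [[i Ai]|nA] := pselect (exists i, A i 0%R); last first.
    rewrite big1 => [|i _]; first by rewrite lee_fin.
    by rewrite indicE memNset// => Ai; apply: nA; exists i.
  rewrite (bigD1 i)//= big1 ?adde0 => [|j ji].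
    by rewrite lee_fin !indicE !mem_set//; exists i.
  rewrite indicE memNset// => Aj; have [c [b [cb /(_ 0%R)]]] := fA _ _ ji.
  move=> /(_ (conj Aj Ai)); rewrite mul0mx mxE => e; move: cb; by rewrite -e (flatmx0 c) !eqxx.
apply: le_trans (integral_superadditive_sum _ _ _) _ => [i t|].
  exact: euclidean_volume_ge0.
have hr : forall p : I * I, exists r : R, p.1 != p.2 -> forall t, t <> r -> flat (slice (A p.1 `&` A p.2) t).
  move=> [i j] /=; have [->|ij] := eqVneq i j; first by exists 0%R.
  by have [r hr] := flat_slice (fA _ _ ij); exists r.
have {hr}[r hr] := choice hr.
(* the values of t at which a slice may be degenerate *)
pose N : set R := [set r p | p in [set: I * I]].
have finN : finite_set N by apply: finite_image; apply: finite_finset.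
apply: (@le_integral_off_null _ (measurableTypeR R) R (@lebesgue_measure R) N).
- exact: countable_measurable (fun=> measurable_set1 _) (finite_set_countable finN).
- exact: countable_lebesgue_measure0 (finite_set_countable finN).
- by move=> t; apply: sume_ge0 => i _; apply: euclidean_volume_ge0.
- by move=> t; apply: euclidean_volume_ge0.
move=> t Nt; apply: le_trans (IH (fun i => slice (A i) t) _) _ => [i j ij|].
  by apply: (hr (i, j) ij t) => e; apply: Nt; exists (i, j).
by apply: le_euclidean_volume => y [i _ Ay]; exists i.
Qed.

Lemma euclidean_volume_cube n (a : 'rV[R]_n) (h : R) : (0 <= h)%R ->
  euclidean_volume [set x : 'rV[R]_n | forall i, (a 0 i <= x 0 i <= a 0 i + h)%R] = (h ^+ n)%:E.
Proof.
move=> h0; elim: n a => [|n IH] a /=.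
  by rewrite indicE mem_set//= => -[].
pose a' : 'rV[R]_n := rsubmx (a : 'rV_(1 + n)).
have lift0E (i : 'I_n) : lift ord0 i = rshift 1 i by exact/val_inj.
under eq_integral => t _.
  rewrite (_ : [set y | _] = if (a 0 0 <= t <= a 0 0 + h)%R then
     [set x : 'rV[R]_n | forall i, (a' 0 i <= x 0 i <= a' 0 i + h)%R] else set0); last first.
    apply/seteqP; split => y /=.
      move=> hy; have := hy ord0; rewrite row_mx_ord0 => -> /= i.
      by have := hy (lift ord0 i); rewrite row_mx_lift0 /a' mxE -lift0E.
    case: ifP => // ht hy i; case: (unliftP ord0 i) => [j|] ->; last by rewrite row_mx_ord0.
    by have := hy j; rewrite row_mx_lift0 mxE -lift0E.
  over.
rewrite (_ : (fun t => _) = (fun t => (h ^+ n)%:E * (\1_(`[a 0%R 0%R, a 0%R 0%R + h]%classic) t)%:E)); last first.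
  apply/funext => t; rewrite indicE; case: ifP => ht.
    by rewrite IH mem_set ?mule1//= in_itv.
  by rewrite euclidean_volume0 memNset ?mule0//= in_itv/= ht.
rewrite ge0_integralZl//=; last 2 first.
- apply/measurable_realfun.measurable_EFinP; exact: measurable_realfun.measurable_indic.
- by rewrite lee_fin exprn_ge0.
rewrite integral_indic// setIT exprSr EFinM; congr (_ * _).
apply: etrans (lebesgue_measure_itv _) _; rewrite /= lte_fin.
case: ltP => hh; first by rewrite -EFinB addrAC subrr add0r.
suff -> : h = 0%R by [].
by apply/eqP; rewrite eq_le h0 andbT -(lerD2l (a ord0 ord0)) addr0.
Qed.
End Volume.

(** * Hulls and affine functionals *)

Section Hull.
Context {R : realType} {n : nat}.
Implicit Types (A C : set 'rV[R]_n) (S : {fset 'rV[int]_n}) (c : 'cV[R]_(1 + n)).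

Lemma convex_setP C : @convex_set R 'rV[R]_n C <->
  forall x y t, 0 <= t -> t <= 1 -> C x -> C y -> C (t *: x + (1 - t) *: y).
Proof.
split=> [cC x y t t0 t1 Cx Cy|cC x y t /set_mem Cx /set_mem Cy]; last first.
  by apply/mem_set; apply: (cC x y t%:num (ge0 t) (le1 t) Cx Cy).
have t01 : Itv.spec (@Itv.num_sem R) (Itv.Real `[0%Z, 1%Z]) t.
  by rewrite /= /Itv.num_sem/= in_itv/= t0 t1 ger0_real.
by have /set_mem := cC x y (Itv.mk t01) (mem_set Cx) (mem_set Cy).
Qed.

Lemma hull_convex A : @convex_set R 'rV[R]_n (hull A).
Proof.
apply/convex_setP => x y t t0 t1 Ax Ay C [cC AC].
by move/convex_setP: (cC); apply => //; [exact: Ax|exact: Ay].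
Qed.

Lemma sub_hull A : A `<=` hull A.
Proof. by move=> x Ax C [_]; apply. Qed.

Lemma hull_min A C : @convex_set R 'rV[R]_n C -> A `<=` C -> hull A `<=` C.
Proof. by move=> cC AC x; apply. Qed.

Lemma hullS A B : A `<=` B -> hull A `<=` hull B.
Proof. by move=> AB; apply: hull_min; [exact: hull_convex|exact: subset_trans AB (@sub_hull B)]. Qed.

(** The induction is over sums of weights that are positive but need not be 1,
    hence the rescaling. *)
Lemma convex_sum C (I : eqType) (s : seq I) (w : I -> R) (x : I -> 'rV[R]_n) :
  @convex_set R 'rV[R]_n C -> {in s, forall i, 0 <= w i} -> \sum_(i <- s) w i = 1 ->
  {in s, forall i, C (x i)} -> C (\sum_(i <- s) w i *: x i).
Proof.
move=> /convex_setP cC w0 w1 Cx.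
suff : 0 < \sum_(i <- s) w i -> C ((\sum_(i <- s) w i)^-1 *: \sum_(i <- s) w i *: x i).
  by rewrite w1 invr1 scale1r; apply.
elim: s w0 Cx {w1} => [|i s IH] w0 Cx; first by rewrite big_nil ltxx.
rewrite !big_cons.
have wi0 : 0 <= w i by apply: w0; rewrite mem_head.
have ws0 : {in s, forall i, 0 <= w i} by move=> j js; apply: w0; rewrite inE js orbT.
have Cs : {in s, forall i, C (x i)} by move=> j js; apply: Cx; rewrite inE js orbT.
have W0 : 0 <= \sum_(j <- s) w j by rewrite big_seq; apply: sumr_ge0.
set W := \sum_(j <- s) w j in W0 *; set y := \sum_(j <- s) _ *: _.
have Ci : C (x i) by apply: Cx; rewrite mem_head.
have := W0; rewrite le_eqVlt => /predU1P[e|Wp].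
  have y0 : y = 0.
    rewrite /y big_seq big1// => j js.
    have : w j <= W by rewrite /W (big_rem j js)/= lerDl big_seq; apply: sumr_ge0 => k /mem_rem/ws0.
    by rewrite -e => le0; rewrite (_ : w j = 0) ?scale0r//; apply/eqP; rewrite eq_le le0 ws0.
  by rewrite -e y0 !addr0 => wp; rewrite scalerA mulVf ?gt_eqF// scale1r.
move=> tot; have Cy := IH ws0 Cs Wp.
have -> : (w i + W)^-1 *: (w i *: x i + y) =
    (w i / (w i + W)) *: x i + (1 - w i / (w i + W)) *: (W^-1 *: y).
  rewrite scalerDr !scalerA; congr (_ *: _ + _ *: _); field; rewrite ?gt_eqF//.
apply: cC => //; first by rewrite divr_ge0// ltW.
by rewrite ler_pdivrMr// mul1r lerDl.
Qed.

Lemma simplex_hullP S x : simplex_hull S x <-> exists w : 'rV[int]_n -> R,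
  [/\ {in S, forall v, 0 <= w v}, \sum_(v <- S) w v = 1
    & x = \sum_(v <- S) w v *: real_point v].
Proof.
split=> [|[w [w0 w1 ->]]]; last first.
  apply: convex_sum => //; first exact: hull_convex.
  by move=> v vS; apply: sub_hull; exists v.
move=> Sx; pose C := [set x : 'rV[R]_n | exists w : 'rV[int]_n -> R,
  [/\ {in S, forall v, 0 <= w v}, \sum_(v <- S) w v = 1
    & x = \sum_(v <- S) w v *: real_point v]].
apply: (Sx C); split; last first.
  move=> _ [v /= vS <-]; exists (fun u => (u == v)%:R); split=> [u _||].
  - exact: ler0n.
  - rewrite (big_rem v)//= eqxx big_seq big1 ?addr0// => u.
    by rewrite mem_rem_uniq ?fset_uniq// inE => /andP[/negbTE->].
  - rewrite (big_rem v)//= eqxx scale1r big_seq big1 ?addr0// => u.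
    by rewrite mem_rem_uniq ?fset_uniq// inE => /andP[/negbTE-> _]; rewrite scale0r.
apply/convex_setP => y z t t0 t1 [wy [wy0 wy1 ->]] [wz [wz0 wz1 ->]].
exists (fun v => t * wy v + (1 - t) * wz v); split.
- by move=> v vS; rewrite addr_ge0// mulr_ge0// ?subr_ge0//; [exact: wy0|exact: wz0].
- by rewrite big_split/= -!mulr_sumr wy1 wz1 !mulr1 addrC subrK.
- rewrite !scaler_sumr -big_split/=; apply: eq_bigr => v _.
  by rewrite !scalerA -scalerDl.
Qed.

(** With a leading 1, affine functionals become column vectors and affine
    independence becomes linear independence. *)
Definition homog (x : 'rV[R]_n) : 'rV[R]_(1 + n) := row_mx 1%:M x.
Definition aff c (x : 'rV[R]_n) : R := (homog x *m c) 0 0.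

Lemma affE c x : aff c x = c 0 0 + (x *m dsubmx c) 0 0.
Proof.
rewrite /aff /homog -[c in LHS]vsubmxK mul_row_col mul1mx mxE; congr (_ + _).
by rewrite mxE; congr (c _ _); exact/val_inj.
Qed.

(** The last term measures how far the weights are from adding up to 1. *)
Lemma aff_sum c (I : Type) (s : seq I) (w : I -> R) (x : I -> 'rV[R]_n) :
  aff c (\sum_(i <- s) w i *: x i) =
  \sum_(i <- s) w i * aff c (x i) + (1 - \sum_(i <- s) w i) * c 0 0.
Proof.
rewrite affE mulmx_suml summxE; under [in RHS]eq_bigr do rewrite affE mulrDr.
rewrite big_split/= -mulr_suml; under eq_bigr do rewrite -scalemxAl mxE.
ring.
Qed.

Lemma aff_conv c (I : Type) (s : seq I) (w : I -> R) (x : I -> 'rV[R]_n) :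
  \sum_(i <- s) w i = 1 ->
  aff c (\sum_(i <- s) w i *: x i) = \sum_(i <- s) w i * aff c (x i).
Proof. by move=> w1; rewrite aff_sum w1 subrr mul0r addr0. Qed.

Definition vertex_mx m (p : 'I_m -> 'rV[int]_n) : 'M[int]_(m, 1 + n) :=
  \matrix_i row_mx 1%:M (p i).

Definition vertex_mxR m (p : 'I_m -> 'rV[int]_n) : 'M[R]_(m, 1 + n) := map_mx intr (vertex_mx p).

Lemma row_vertex_mxR m (p : 'I_m -> 'rV[int]_n) i : row i (vertex_mxR p) = homog (real_point (p i)).
Proof. by rewrite /vertex_mxR -map_row rowK map_row_mx map_mx1. Qed.

Lemma mul_vertex_mxR m (p : 'I_m -> 'rV[int]_n) (w : 'rV[R]_m) :
  w *m vertex_mxR p = row_mx (\sum_i w 0 i)%:M (\sum_i w 0 i *: real_point (p i)).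
Proof.
rewrite mulmx_sum_row; under eq_bigr do rewrite row_vertex_mxR /homog scale_row_mx.
elim/big_rec3: _ => [|i y1 y2 y3 _ ->]; first by rewrite raddf0 row_mx0.
by rewrite add_row_mx raddfD scale_scalar_mx mulr1.
Qed.

Lemma has_dim_le A d : has_dim A d -> (d <= n)%N.
Proof. by move=> [[x [B [_ _ <-]]] _]; exact: rank_leq_col. Qed.

Definition vertices_of m S (p : 'I_m -> 'rV[int]_n) :=
  injective p /\ forall v, (v \in S) = [exists i, v == p i].

Lemma sum_vertices m S (p : 'I_m -> 'rV[int]_n) (V : nmodType) (F : 'rV[int]_n -> V) :
  vertices_of S p -> \sum_(v <- S) F v = \sum_i F (p i).
Proof.
move=> [pI pS]; rewrite -(big_map p predT F); apply: perm_big.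
apply: uniq_perm; rewrite ?fset_uniq ?(map_inj_uniq pI) ?index_enum_uniq// => v.
rewrite pS; apply/existsP/mapP => [[i /eqP->]|[i _ ->]]; first by exists i; rewrite ?mem_index_enum.
by exists i.
Qed.

Lemma vertices_exist S m : #|` S| = m -> exists p : 'I_m -> 'rV[int]_n, vertices_of S p.
Proof.
move=> Sm; exists (fun i => nth 0 S i); split => [i j /eqP|v].
  have sz k : ((k : 'I_m) < size S)%N by rewrite -/(#|` S|) Sm.
  by rewrite nth_uniq ?fset_uniq// => /eqP/val_inj.
apply/idP/existsP => [vS|[i /eqP->]]; last by apply: mem_nth; rewrite -/(#|` S|) Sm.
have iv : (index v S < m)%N by rewrite -Sm index_mem.
by exists (Ordinal iv); rewrite /= nth_index.
Qed.

Lemma simplex_hull_vertices m S (p : 'I_m -> 'rV[int]_n) x : vertices_of S p ->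
  simplex_hull S x <-> exists w : 'rV[R]_m,
  [/\ forall i, 0 <= w 0 i, \sum_i w 0 i = 1 & x = \sum_i w 0 i *: real_point (p i)].
Proof.
move=> pS; have [pI pE] := pS; split.
  move/simplex_hullP => [w [w0 w1 ->]]; exists (\row_i w (p i)); split.
  - by move=> i; rewrite mxE; apply: w0; rewrite pE; apply/existsP; exists i.
  - by rewrite -w1 (sum_vertices _ pS); apply: eq_bigr => i _; rewrite mxE.
  - by rewrite (sum_vertices _ pS); apply: eq_bigr => i _; rewrite mxE.
move=> [w [w0 w1 ->]]; apply/simplex_hullP.
pose w' v := \sum_(i | p i == v) w 0 i.
have w'E i : w' (p i) = w 0 i.
  by rewrite /w' (bigD1 i)//= big1 ?addr0// => j /andP[/eqP/pI->]; rewrite eqxx.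
exists w'; split => [v _||]; first exact: sumr_ge0.
  by rewrite (sum_vertices _ pS) -w1; apply: eq_bigr => i _.
by rewrite (sum_vertices _ pS); apply: eq_bigr => i _; rewrite w'E.
Qed.

(** The rows of the vertex matrix span the homogenized points of the hull, among
    which the dimension provides as many independent ones as there are vertices. *)
Lemma row_free_vertex_mx S m (p : 'I_m -> 'rV[int]_n) : vertices_of S p ->
  S != fset0 -> #|` S| = m -> has_dim (simplex_hull S : set 'rV[R]_n) (#|` S|.-1) -> row_free (vertex_mxR p).
Proof.
move=> pS S0 Sm [[x [A [Sx SA rA]]] _].
have m0 : (0 < m)%N by rewrite -Sm cardfs_gt0.
have inM y : simplex_hull S y -> (homog y <= vertex_mxR p)%MS.
  move=> /(simplex_hull_vertices _ pS)[w [_ w1 ->]]; apply/submxP; exists w.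
  by rewrite mul_vertex_mxR w1.
pose B : 'M[R]_(1 + #|` S|.-1, 1 + n) := block_mx 1%:M x 0 A.
have BM : (B <= vertex_mxR p)%MS.
  rewrite /B /block_mx col_mx_sub (inM x Sx) /=; apply/row_subP => i.
  rewrite row_row_mx row0.
  have -> : row_mx 0 (row i A) = homog (x + row i A) - homog x.
    by rewrite /homog opp_row_mx add_row_mx subrr addrAC subrr add0r.
  by rewrite addmx_sub ?eqmx_opp ?inM.
have rB : row_free B.
  apply: inj_row_free => v; rewrite -[v]hsubmxK /B mul_row_block mulmx0 addr0 mulmx1 => /eqP.
  rewrite row_mx_eq0 => /andP[/eqP v1]; rewrite v1 mul0mx add0r => /eqP v2.
  have fA : row_free A by rewrite /row_free rA.
  have -> : rsubmx v = 0 by apply: (row_free_inj fA); rewrite v2 mul0mx.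
  by rewrite row_mx0.
move: (mxrankS BM); rewrite (eqP rB) /row_free eqn_leq rank_leq_row /=.
by rewrite add1n Sm prednK.
Qed.
End Hull.

(** * Unimodular simplices *)

Section Bary.
Context {R : realType} {n : nat}.
Variables (S : {fset 'rV[int]_n}) (p : 'I_(1 + n) -> 'rV[int]_n).
Hypothesis pS : vertices_of S p.
Hypothesis pU : (vertex_mxR p : 'M[R]_(1 + n)) \in unitmx.

(** Column i of the inverse of the vertex matrix is the functional with value 1 at
    [p i] and 0 at the other vertices, that is, a barycentric coordinate. *)
Definition bary i : 'cV[R]_(1 + n) := col i (invmx (vertex_mxR p)).
Notation lam i x := (aff (bary i) x).

Lemma homog_mul x : homog x *m invmx (vertex_mxR p) = \row_i lam i x.
Proof.
apply/rowP => i; rewrite [RHS]mxE /aff /bary !mxE.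
by apply: eq_bigr => k _; rewrite [X in _ = _ * X]mxE.
Qed.

Lemma bary_vertex i j : lam i (real_point (p j)) = (j == i)%:R.
Proof.
have := homog_mul (real_point (p j)); rewrite -row_vertex_mxR -row_mul mulmxV//.
by move/rowP/(_ i); rewrite !mxE.
Qed.

Lemma baryK x : \sum_i lam i x = 1 /\ \sum_i lam i x *: real_point (p i) = x.
Proof.
have := mulmxKV pU (homog x); rewrite homog_mul mul_vertex_mxR => /eq_row_mx[].
rewrite -scalemx1 => /matrixP/(_ 0 0); rewrite !mxE mulr1 => e1 e2.
split; first by rewrite -e1; apply: eq_bigr => i _; rewrite mxE.
by rewrite -[RHS]e2; apply: eq_bigr => i _; rewrite mxE.
Qed.

Lemma in_simplex x : simplex_hull S x <-> forall i, 0 <= lam i x.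
Proof.
split=> [/(simplex_hull_vertices _ pS)[w [w0 w1 ->]] i|h].
  rewrite aff_conv//; apply: sumr_ge0 => j _; rewrite bary_vertex mulr_ge0//.
apply/(simplex_hull_vertices _ pS); exists (\row_i lam i x); have [h1 h2] := baryK x.
split=> [i||]; first by rewrite mxE.
  by rewrite -[RHS]h1; apply: eq_bigr => i _; rewrite mxE.
by rewrite -[LHS]h2; apply: eq_bigr => i _; rewrite mxE.
Qed.

(** The linear part of the i-th barycentric coordinate. *)
Definition blin i (y : 'rV[R]_n) : R := (y *m dsubmx (bary i)) 0 0.

Lemma blinD i x y : blin i (x + y) = blin i x + blin i y.
Proof. by rewrite /blin mulmxDl mxE. Qed.
Lemma aff_blin i x y : lam i (x + y) = lam i x + blin i y.
Proof. by rewrite !affE -!/(blin i _) blinD addrA. Qed.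

Lemma blinZ i a x : blin i (a *: x) = a * blin i x.
Proof. by rewrite /blin -scalemxAl mxE. Qed.
Lemma blin_sum i (I : Type) (s : seq I) (F : I -> 'rV[R]_n) :
  blin i (\sum_(j <- s) F j) = \sum_(j <- s) blin i (F j).
Proof. by rewrite /blin mulmx_suml summxE. Qed.

Lemma blin_edge i j k : blin i (real_point (p j) - real_point (p k)) = (j == i)%:R - (k == i)%:R.
Proof.
apply: (addrI (lam i (real_point (p k)))); rewrite -aff_blin addrCA subrr addr0 !bary_vertex.
by rewrite addrCA subrr addr0.
Qed.

Lemma sum_blin y : \sum_i blin i y = 0.
Proof.
have [h0 _] := baryK 0; have [hy _] := baryK (0 + y).
apply: (addrI (\sum_i lam i 0)); rewrite -big_split/= addr0 [RHS]h0 -[RHS]hy.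
by apply: eq_bigr => i _; rewrite aff_blin.
Qed.

Lemma blin_norm i (y : 'rV[R]_n) : (forall j, `|y 0 j| <= 1) ->
  `|blin i y| <= \sum_j `|(dsubmx (bary i)) j 0|.
Proof.
move=> hy; rewrite /blin mxE; apply: le_trans (ler_norm_sum _ _ _) _; apply: ler_sum => j _.
by rewrite normrM ler_piMl.
Qed.

(** The linear parts of all coordinates add up to 0, which covers the coordinate of
    [p ord0], and the constant terms are determined by the values at [p ord0]. *)
Lemma unimodular_of_int :
  (forall (i : 'I_n) (j : 'I_n), blin (lift ord0 i) (real_point (delta_mx 0 j)) \is a Num.int) ->
  vertex_mx p \in unitmx.
Proof.
move=> h.
have h' i j : blin i (real_point (delta_mx 0 j)) \is a Num.int.
  case: (unliftP ord0 i) => [k|] ->; first exact: h.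
  have := sum_blin (real_point (delta_mx 0 j)); rewrite big_ord_recl => /eqP.
  by rewrite addr_eq0 => /eqP->; rewrite rpredN; apply: rpred_sum.
pose Q : 'M[R]_(1 + n) := invmx (vertex_mxR p).
have blinE i j : blin i (real_point (delta_mx 0 j)) = Q (rshift 1 j) i.
  rewrite /blin /real_point map_delta_mx -rowE mxE /bary.
  by rewrite !mxE.
have hN : forall j i, Q j i \is a Num.int.
  move=> j i; case: (fintype.split_ordP j) => k ->; last by rewrite -blinE.
  have -> : Q (lshift n k) i = bary i 0 0.
    by rewrite mxE; congr (Q _ _); rewrite ord1; exact/val_inj.
  have := bary_vertex i ord0; rewrite affE => /eqP; rewrite -subr_eq0 -addrA addr_eq0 => /eqP->.
  rewrite rpredN rpredB//; last by case: (_ == _); rewrite ?rpred0 ?rpred1.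
  rewrite mxE; apply: rpred_sum => l _; apply: rpredM; first by rewrite mxE; exact: intr_int.
  by rewrite /bary !mxE -blinE.
pose N : 'M[int]_(1 + n) := map_mx Num.floor Q.
have NE : map_mx intr N = Q.
  by apply/matrixP => j i; rewrite [LHS]mxE [X in X%:~R]mxE; apply/eqP; rewrite -intrEfloor.
suff : vertex_mx p *m N = 1%:M by move/mulmx1_unit => [].
have /matrixP e : map_mx intr (vertex_mx p *m N) = map_mx intr 1%:M :> 'M[R]_(1 + n).
  by rewrite map_mxM NE [RHS]map_mx1; exact: mulmxV pU.
by apply/matrixP => i j; have := e i j; rewrite [LHS]mxE [RHS]mxE => /intr_inj.
Qed.

End Bary.

(** A consequence of Bernoulli's inequality for (1 - D / (K + D))^n, which is proved
    first and without division. *)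
Lemma expn_shift_lt n D K : (2 * n * D < K + D)%N -> ((K + D) ^ n < 2 * K ^ n)%N.
Proof.
move=> h.
have bern : ((K + D) ^ n.+1 <= K ^ n * (K + D) + n * D * (K + D) ^ n)%N.
  elim: n {h} => [|m IH]; first by rewrite expn1 expn0; lia.
  have := leq_mul IH (leqnn (K + D)); rewrite -expnSr => /leq_trans; apply.
  rewrite [(K ^ m.+1)%N]expnSr [((K + D) ^ m.+1)%N]expnSr.
  have : (K ^ m <= (K + D) ^ m)%N by case: (posnP m) => [->|m0]; rewrite ?expn0// leq_exp2r// leq_addr.
  move: (K ^ m)%N ((K + D) ^ m)%N => x y /(leq_mul (leqnn ((K + D) * D)%N)); nia.
have h0 : (0 < K + D)%N by lia.
have h1 : (0 < (K + D) ^ n)%N by rewrite expn_gt0 h0.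
rewrite -(ltn_pmul2r h0); rewrite expnSr in bern.
move: bern h1 h; move: (K ^ n)%N ((K + D) ^ n)%N => x y bern y0 h.
have := leq_mul h (leqnn y); nia.
Qed.

Lemma fact_bin_ge n K : (K ^ n <= 'C(n + K, n) * n`!)%N.
Proof.
rewrite bin_ffact; elim: n => [|n IH]; first by rewrite ffactn0.
rewrite addSn ffactSS expnS leq_mul//; lia.
Qed.

Section CubeCount.
Context {R : realType} {n : nat}.
Variables (S : {fset 'rV[int]_n}) (p : 'I_(1 + n) -> 'rV[int]_n).
Hypothesis pS : vertices_of S p.
Hypothesis pU : (vertex_mxR p : 'M[R]_(1 + n)) \in unitmx.
Notation lam i x := (aff (bary p i) x).
Notation blin i y := (blin p i y).
Notation rp := (@real_point R n).

Definition grid_cube (k : nat) (w : 'rV[int]_n) : set 'rV[R]_n :=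
  [set x | forall j, (w 0 j)%:~R / k%:R <= x 0 j <= (w 0 j)%:~R / k%:R + k%:R^-1].

Lemma grid_cube_flat k (w w' : 'rV[int]_n) : (0 < k)%N -> w != w' ->
  flat (grid_cube k w `&` grid_cube k w').
Proof.
move=> k0 ww'; have kR : (0 : R) < k%:R by rewrite ltr0n.
have [j wj] : exists j, w 0 j != w' 0 j.
  by apply/existsP; apply: contraNT ww' => /existsPn h; apply/eqP/rowP => j; apply/eqP/negPn/h.
wlog lt_w : w w' {ww' wj} / w 0 j < w' 0 j => [hw|].
  by case: (ltgtP (w 0 j) (w' 0 j)) wj => // h _; [|rewrite setIC]; exact: hw.
exists (delta_mx j 0), ((w' 0 j)%:~R / k%:R); split.
  apply/orP; left; apply/eqP => /matrixP/(_ j 0); rewrite !mxE !eqxx/=.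
  by move/eqP; rewrite oner_eq0.
move=> x [/(_ j)/andP[_ h1] /(_ j)/andP[h2 _]].
have -> : (x *m (delta_mx j 0 : 'cV[R]_n)) 0 0 = x 0 j by rewrite -colE mxE.
apply/eqP; rewrite eq_le h2 andbT; apply: le_trans h1 _.
rewrite -[X in _ + X]mul1r -mulrDl ler_pM2r ?invr_gt0// -(intrD _ _ 1) ler_int.
by rewrite -ltzD1 ltrD2r.
Qed.

(** Dilate the simplex by k and count the unit cubes at lattice points well inside
    it. Those in the coset of the vertices are about k^n / n! in number; e provides
    a second coset, hence as many further cubes. Rescaled to side 1 / k, they have
    a total volume close to 2 / n!. *)
Lemma volume_gt_of_nonint (e : 'rV[int]_n) (i0 : 'I_n) :
  blin (lift ord0 i0) (rp e) \isn't a Num.int ->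
  ((n`!)%:R^-1%:E < euclidean_volume (simplex_hull S : set 'rV[R]_n))%E.
Proof.
move=> ne.
pose c i : R := `|blin i (rp e)| + \sum_j `|(dsubmx (bary p i : 'cV[R]__)) j 0|.
have [C hC] : exists C : nat, forall i, c i <= C%:R.
  exists (\max_i (Num.truncn (c i)).+1) => i; apply/ltW.
  have := truncnS_gt (c i); move/lt_le_trans; apply.
  by rewrite ler_nat leq_bigmax.
(* C bounds the effect of e and of the offset inside a unit cube on every
   coordinate, so that a margin C keeps the cubes inside; K is the number of
   steps available, large compared with the total margin D *)
pose D := (n * C + C)%N; pose K := (2 * n * D).+1; pose k := (K + D)%N.
have k0 : (0 < k)%N by rewrite /k /K.
have kR : (0 : R) < k%:R by rewrite ltr0n.
pose T := {t : n.-tuple 'I_K.+1 | (\sum_(i <- t) i <= K)%N}.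
pose m (t : T) (i : 'I_n) : nat := (C + tnth (val t) i)%N.
(* a = (t, r) selects the point of multiplicities m t in the coset of r * e *)
pose v i := p (lift ord0 i) - p ord0.
pose w (a : T * bool) : 'rV[int]_n :=
  p ord0 *+ k + \sum_i (v i *+ m a.1 i) + e *+ a.2.
have rpD (x y : 'rV[int]_n) : rp (x + y) = rp x + rp y :> 'rV[R]_n.
  by apply/rowP => j; rewrite !mxE intrD.
have rpN (x : 'rV[int]_n) : rp (- x) = - rp x :> 'rV[R]_n.
  by apply/rowP => j; rewrite !mxE intrN.
have rpn (x : 'rV[int]_n) a : rp (x *+ a) = a%:R *: rp x :> 'rV[R]_n.
  by apply/rowP => j; rewrite !mxE mulmxnE rmorphMn/= mulr_natl.
have rps (F : 'I_n -> 'rV[int]_n) : rp (\sum_i F i) = \sum_i rp (F i) :> 'rV[R]_n.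
  by apply: (big_morph (rp) rpD); apply/rowP => j; rewrite !mxE.
have blin_w i a : blin i (rp (w a) - k%:R *: rp (p ord0)) =
   \sum_l (m a.1 l)%:R * ((lift ord0 l == i)%:R - (ord0 == i)%:R) + a.2%:R * blin i (rp e) :> R.
  have -> : rp (w a) - k%:R *: rp (p ord0) = \sum_l rp (v l *+ m a.1 l) + a.2%:R *: rp e.
    by rewrite /w !rpD !rpn rps addrC !addrA addNr add0r.
  rewrite blinD blinZ; congr (_ + _); rewrite blin_sum; apply: eq_bigr => l _.
  by rewrite rpn blinZ rpD rpN blin_edge.
have blin_wl i a : blin (lift ord0 i) (rp (w a) - k%:R *: rp (p ord0)) =
   (m a.1 i)%:R + a.2%:R * blin (lift ord0 i) (rp e) :> R.
  rewrite blin_w; congr (_ + _); rewrite (bigD1 i)//= eqxx subr0 mulr1 big1 ?addr0// => l li.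
  by rewrite (inj_eq lift_inj) (negbTE li) subr0 mulr0.
have blin_w0 a : blin ord0 (rp (w a) - k%:R *: rp (p ord0)) =
   - (\sum_l m a.1 l)%:R + a.2%:R * blin ord0 (rp e) :> R.
  rewrite blin_w; congr (_ + _); rewrite raddf_sum -sumrN; apply: eq_bigr => l _.
  by rewrite eqxx sub0r mulrN1.
have w_inj : injective w.
  move=> [t r] [t' r'] eqw.
  have key i : (m t i)%:R + r%:R * blin (lift ord0 i) (rp e) =
      (m t' i)%:R + r'%:R * blin (lift ord0 i) (rp e) :> R.
    by have := blin_wl i (t, r); rewrite eqw blin_wl /= => ->.
  have eqr : r = r'.
    apply/eqP; apply: contraNT ne => rr'; have := key i0.
    case: (r) (r') rr' => [] [] //= _; rewrite mul1r mul0r addr0 => /eqP; rewrite 1?[_ == (m t' i0)%:R]eq_sym.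
      by rewrite addrC -subr_eq => /eqP<-; rewrite rpredB// natr_int.
    by rewrite addrC -subr_eq => /eqP<-; rewrite rpredB// natr_int.
  congr (_, _) => //; apply/val_inj/eq_from_tnth => i; apply/val_inj.
  by have := key i; rewrite eqr => /addIr/eqP; rewrite eqr_nat eqn_add2l => /eqP.
have sum_m t : (\sum_l m t l <= n * C + K)%N.
  rewrite /m big_split/= sum_nat_const card_ord leq_add2l.
  by apply: leq_trans (valP t); rewrite big_tuple.
have sub a : grid_cube k (w a) `<=` simplex_hull S.
  move=> x hx; apply/(in_simplex pS pU) => i.
  pose y := k%:R *: x - rp (w a).
  have y1 j : `|y 0 j| <= 1.
    have := hx j; rewrite /y !mxE => /andP[h1 h2].
    rewrite ger0_norm;
      first by rewrite lerBlDl addrC -(@ler_pM2l _ k%:R^-1) ?invr_gt0//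
        mulrDr mulKf ?gt_eqF// mulr1 mulrC addrC.
    by rewrite subr_ge0 -(@ler_pM2l _ k%:R^-1) ?invr_gt0// mulKf ?gt_eqF// mulrC.
  have muy l : `|blin l y| <= \sum_j `|(dsubmx (bary p l : 'cV[R]__)) j 0| by exact: blin_norm.
  have bound l (b : bool) : - C%:R <= b%:R * blin l (rp e) + blin l y :> R.
    have := hC l; rewrite /c; have := muy l; set z := blin l y; set z' := blin l (rp e).
    have := ler_norm (- z); have := ler_norm (- z'); have := normr_ge0 z'; rewrite !normrN.
    by case: b => /=; lra.
  have xE : x = rp (p ord0) + k%:R^-1 *: ((rp (w a) - k%:R *: rp (p ord0)) + y).
    rewrite /y addrAC addrCA subrr addr0 scalerBr !scalerA mulVf ?gt_eqF// !scale1r.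
    by rewrite addrC subrK.
  rewrite xE aff_blin bary_vertex// blinZ blinD.
  case: (unliftP ord0 i) => [l|] ->.
    rewrite /= add0r mulr_ge0 ?invr_ge0 ?ler0n// blin_wl -addrA.
    have := bound (lift ord0 l) a.2; have : (C%:R <= (m a.1 l)%:R :> R) by rewrite ler_nat leq_addr.
    lra.
  rewrite eqxx blin_w0 -addrA -(@pmulr_rge0 _ k%:R)// mulrDr mulr1 mulVKf ?gt_eqF//.
  have := bound ord0 a.2; have : ((\sum_l m a.1 l)%:R + C%:R <= k%:R :> R).
    by rewrite -natrD ler_nat /k /D; have := sum_m a.1; lia.
  lra.
have vol_cube a : euclidean_volume (grid_cube k (w a)) = ((k%:R^-1) ^+ n)%:E.
  have := @euclidean_volume_cube R n (\row_j ((w a 0 j)%:~R / k%:R)) k%:R^-1.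
  rewrite invr_ge0 ler0n => /(_ isT) <-; congr euclidean_volume.
  by rewrite /grid_cube; apply/seteqP; split => x hx j; have := hx j; rewrite [(\row__ _) _ _]mxE.
have : (\sum_a euclidean_volume (grid_cube k (w a)) <= euclidean_volume (simplex_hull S : set 'rV[R]_n))%E.
  apply: (le_trans (euclidean_volume_superadditive _)) => [a b ab|].
    by apply: grid_cube_flat => //; apply: contra ab => /eqP/w_inj->.
  by apply: le_euclidean_volume => x [a _]; apply: sub.
apply: lt_le_trans; under eq_bigr do rewrite vol_cube.
rewrite sumEFin lte_fin sumr_const card_prod card_bool card_sig.
have -> : #|[pred t : n.-tuple 'I_K.+1 | (\sum_(i <- t) i <= K)%N]| = 'C(n + K, n).
  by rewrite -card_partial_ord_partitions cardsE.
have kn : (k ^ n < 2 * K ^ n)%N by apply: expn_shift_lt; rewrite /K; lia.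
have := fact_bin_ge n K => Kn; have f0 := fact_gt0 n.
rewrite exprVn -[X in _ < X]mulr_natl -natrX ltr_pdivlMr ?ltr0n ?expn_gt0 ?k0// mulrC.
rewrite ltr_pdivrMr ?ltr0n// -!natrM ltr_nat; lia.
Qed.

End CubeCount.

(** * Simplices around a point of a triangulation *)

Section Germ.
Context {R : realType}.
Implicit Type q : {poly R}.

Definition recip (M : nat) : R := (M.+2)%:R^-1.

Lemma recip_gt0 M : 0 < recip M. Proof. by rewrite invr_gt0 ltr0n. Qed.

Lemma recip_le M N : (N <= M)%N -> recip M <= recip N.
Proof. by move=> NM; rewrite lef_pV2 ?posrE ?ltr0n// ler_nat. Qed.

Lemma recip_small (e : R) : 0 < e -> exists N, recip N < e.
Proof.
move=> e0; exists (Num.truncn e^-1); rewrite invf_plt ?posrE ?ltr0n//.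
apply: lt_trans (truncnS_gt _) _; by rewrite ltr_nat.
Qed.

Lemma horner_bound q t : 0 <= t <= 1 -> `|q.[t]| <= \sum_(i < size q) `|q`_i|.
Proof.
move=> /andP[t0 t1]; rewrite horner_coef; apply: le_trans (ler_norm_sum _ _ _) _.
apply: ler_sum => i _; rewrite normrM normrX ler_piMr// (ger0_norm t0).
exact: exprn_ile1.
Qed.

(** Near 0 on the right, the sign of a polynomial is the sign of its lowest nonzero
    coefficient. *)
Lemma poly_germ_gt0 q k : 0 < q`_k -> (forall j, (j < k)%N -> q`_j = 0) ->
  exists N, forall M, (N <= M)%N -> 0 < q.[recip M].
Proof.
move=> qk qj; pose r := drop_poly k q; pose s := drop_poly 1 r.
have qE : q = r * 'X^k.
  rewrite -[LHS](poly_take_drop k) (_ : take_poly k q = 0) ?add0r//.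
  by apply/polyP => j; rewrite coef_take_poly coef0; case: ifP => // /qj.
have rE : r = (q`_k)%:P + s * 'X.
  rewrite -[LHS](poly_take_drop 1) expr1; congr (_ + _); apply/polyP => j.
  by rewrite coef_take_poly coefC coef_drop_poly; case: j.
pose B := \sum_(i < size s) `|s`_i|.
have B0 : 0 <= B by apply: sumr_ge0.
have [N hN] : exists N, recip N < q`_k / (B + 1) by apply: recip_small; rewrite divr_gt0// ltr_wpDl.
exists N => M NM; rewrite qE hornerM hornerXn mulr_gt0 ?exprn_gt0 ?recip_gt0//.
have e0 := recip_gt0 M; have e1 : recip M <= 1 by rewrite invf_le1 ?ltr0n// ler1n.
have := @horner_bound s (recip M); rewrite (ltW e0) e1 => /(_ isT).
rewrite -/B ler_norml => /andP[sB _].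
rewrite rE hornerD hornerC hornerM hornerX.
have : recip M < q`_k / (B + 1) by apply: le_lt_trans (recip_le NM) hN.
have B1 : 0 < B + 1 by rewrite ltr_wpDl.
rewrite (ltr_pdivlMr _ _ B1) => h.
have := ler_wpM2r (ltW e0) sB; lra.
Qed.

Lemma poly_germ_root q : (forall N, exists2 M, (N <= M)%N & q.[recip M] = 0) -> q = 0.
Proof.
move=> fr; apply/eqP; apply/negPn/negP => q0.
have ex : exists k, q`_k != 0 by exists (size q).-1; rewrite -lead_coefE lead_coef_eq0.
have [k qk kmin] := ex_minnP ex.
have qj j : (j < k)%N -> q`_j = 0.
  by move=> jk; apply/eqP; apply: contraTT jk => /kmin; rewrite -leqNgt.
have [qk0|qk0|e] := ltgtP 0 q`_k; last by rewrite -e eqxx in qk.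
  have [N hN] := poly_germ_gt0 qk0 qj; have [M NM e] := fr N.
  by have := hN M NM; rewrite e ltxx.
have [||N hN] := @poly_germ_gt0 (- q) k; first by rewrite coefN oppr_gt0.
  by move=> j /qj; rewrite coefN => ->; rewrite oppr0.
have [M NM e] := fr N.
by have := hN M NM; rewrite hornerN e oppr0 ltxx.
Qed.

Lemma poly_germ_ge0 q : (forall N, exists2 M, (N <= M)%N & 0 <= q.[recip M]) -> 0 <= q`_0.
Proof.
move=> fr; rewrite leNgt; apply/negP => q0.
have [||N hN] := @poly_germ_gt0 (- q) 0; rewrite ?coefN ?oppr_gt0//.
have [M NM e] := fr N.
by have := hN M NM; rewrite hornerN oppr_gt0 ltNge e.
Qed.
End Germ.

Section Curve.
Context {R : realType} {n : nat}.
Variables (x0 : 'rV[R]_n) (m : nat) (y : 'I_m -> 'rV[R]_n).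
Implicit Type c : 'cV[R]_(1 + n).

(** The curve x0 + sum_j t^(j+1) (y j - x0), as a convex combination of x0 (index
    None) and the y j. Along it an affine functional is a polynomial in t whose
    coefficients are its value at x0 and the differences of its values at the y j
    and at x0; so a functional that does not vanish at all these points vanishes for
    finitely many t only. *)
Definition curve_point (t : R) : 'rV[R]_n :=
  \sum_(o : option 'I_m) (if o is Some j then t ^+ j.+1 else 1 - \sum_(j < m) t ^+ j.+1) *:
    (if o is Some j then y j else x0).

Lemma sum_pow_le (t : R) : 0 <= t -> 2 * t <= 1 -> \sum_(j < m) t ^+ j.+1 <= 1.
Proof.
move=> t0 t2; suff : \sum_(j < m) t ^+ j.+1 <= 1 - t ^+ m.
  by move/le_trans; apply; rewrite gerBl exprn_ge0.
elim: m => [|k IH]; first by rewrite big_ord0 expr0 subrr.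
rewrite big_ord_recr/=; have := ler_wpM2r (exprn_ge0 k t0) t2; rewrite !exprS; lra.
Qed.

Lemma sum_option (V : nmodType) (F : option 'I_m -> V) :
  \sum_o F o = F None + \sum_j F (Some j).
Proof.
rewrite (bigD1 None)//=; congr (_ + _).
rewrite (reindex_omap Some id)/=; last by case.
by apply: eq_bigl => j; rewrite eqxx.
Qed.

Lemma curve_point_conv C t : @convex_set R 'rV[R]_n C -> C x0 -> (forall j, C (y j)) ->
  0 <= t -> 2 * t <= 1 -> C (curve_point t).
Proof.
move=> cC Cx Cy t0 t2; apply: convex_sum => //.
- by move=> [j|] _; rewrite ?exprn_ge0// subr_ge0 sum_pow_le.
- by rewrite sum_option addrC addrCA subrr addr0.
- by move=> [j|] _.
Qed.

Definition curve_poly c : {poly R} :=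
  (aff c x0)%:P + \sum_(j < m) (aff c (y j) - aff c x0) *: 'X^(j.+1).

Lemma curve_polyE c t : (curve_poly c).[t] = aff c (curve_point t).
Proof.
rewrite /curve_point aff_conv; last by rewrite sum_option addrC addrCA subrr addr0.
rewrite sum_option hornerD hornerC horner_sum mulrBl mul1r -addrA; congr (_ + _).
rewrite mulr_suml addrC -sumrB; apply: eq_bigr => j _.
by rewrite hornerZ hornerXn mulrBl mulrC [X in _ - X]mulrC.
Qed.

Lemma curve_poly0 c : (curve_poly c)`_0 = aff c x0.
Proof.
by rewrite coefD coefC/= coef_sum big1 ?addr0// => j _; rewrite coefZ coefXn mulr0.
Qed.

Lemma curve_polyS c (j : 'I_m) : (curve_poly c)`_j.+1 = aff c (y j) - aff c x0.
Proof.
rewrite coefD coefC/= add0r coef_sum (bigD1 j)//= coefZ coefXn eqxx mulr1 big1 ?addr0// => i ij.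
by rewrite coefZ coefXn eqSS eq_sym (negbTE ij : (i == j :> nat) = false) mulr0.
Qed.
End Curve.

Section Triangulation.
Context {R : realType} {n : nat}.
Variables (Delta : set 'rV[R]_n) (Gamma : {fset {fset 'rV[int]_n}}).
Hypothesis hDelta : lattice_polytope Delta.
Hypothesis hGamma : triangulation Delta Gamma.
Implicit Types (s t : {fset 'rV[int]_n}) (c : 'cV[R]_(1 + n)).
Notation hullR t := (simplex_hull t : set 'rV[R]_n).

Lemma Delta_convex : @convex_set R 'rV[R]_n Delta.
Proof. by have [[S ->] _] := hDelta; apply: hull_convex. Qed.

Lemma sub_Delta t : t \in Gamma -> hullR t `<=` Delta.
Proof. by move=> tG x tx; have [_ _ _ ->] := hGamma; exists t. Qed.

Lemma Delta_cover x : Delta x -> exists2 t, t \in Gamma & hullR t x.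
Proof. by have [_ _ _ {1}->] := hGamma; case=> t tG tx; exists t. Qed.

Lemma simplex_card t : t \in Gamma -> (0 < #|` t| <= n.+1)%N.
Proof.
have [aff_t _ _ _] := hGamma; move=> /aff_t[t0 /has_dim_le dt].
by rewrite cardfs_gt0 t0/=; move: dt; rewrite -ltnS prednK// cardfs_gt0.
Qed.

Lemma simplex_row_free t m (p : 'I_m -> 'rV[int]_n) : t \in Gamma ->
  #|` t| = m -> vertices_of t p -> row_free (vertex_mxR p : 'M[R]_(m, 1 + n)).
Proof.
have [aff_t _ _ _] := hGamma; move=> /aff_t[t0 dt] tm pt.
exact: row_free_vertex_mx pt t0 tm dt.
Qed.

Lemma full_unit t (p : 'I_(1 + n) -> 'rV[int]_n) : t \in Gamma -> #|` t| = n.+1 ->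
  vertices_of t p -> (vertex_mxR p : 'M[R]_(1 + n)) \in unitmx.
Proof. by move=> tG tn pt; rewrite -row_free_unit; apply: simplex_row_free tG tn pt. Qed.

(** Follow the curve from x0 that starts in the direction of z and then uses
    affinely independent points of Delta. Some simplex contains points of the curve
    for arbitrarily small t. It is contained in no hyperplane, hence it is full; it
    contains x0, since the inequalities of its facets pass to the limit; and along
    the curve the sign of c for small t is that of its first-order term. *)
Lemma curve_simplex (x0 z : 'rV[R]_n) : Delta x0 -> Delta z ->
  exists t, [/\ t \in Gamma, #|` t| = n.+1, hullR t x0 &
    forall c, aff c x0 = 0 -> aff c z < 0 -> exists2 x, hullR t x & aff c x < 0].
Proof.
move=> Dx0 Dz; have [_ [[x1 [A [Dx1 DA rA]]] _]] := hDelta.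
pose y (j : 'I_(n.+2)) : 'rV[R]_n := if unlift ord0 j is Some j' then
  (if unlift ord0 j' is Some i then x1 + row i A else x1) else z.
have Dy j : Delta (y j) by rewrite /y; case: unliftP => [j' _|//]; case: unliftP => [i _|//].
pose g M := curve_point x0 y (recip M).
have Dg M : Delta (g M).
  apply: curve_point_conv => //; first exact: Delta_convex; first exact/ltW/recip_gt0.
  by rewrite /recip ler_pdivrMr ?ltr0n// mul1r ler_nat.
have [t tG freq] : exists2 t, t \in Gamma & forall N, exists2 M, (N <= M)%N & hullR t (g M).
  apply: contrapT => nex.
  have bad t : exists N, t \in Gamma -> forall M, (N <= M)%N -> ~ hullR t (g M).
    have [tG|tG] := boolP (t \in Gamma); last by exists 0%N.
    apply: contrapT => nN; apply: nex; exists t => // N; apply: contrapT => nM.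
    by apply: nN; exists N => _ M NM tgM; apply: nM; exists M.
  have [f hf] := choice bad.
  have [t tG] := Delta_cover (Dg (\max_(t <- Gamma) f t)%N).
  by apply: hf => //; apply: (@leq_bigmax_seq _ _ predT f).
have freq0 c : (forall x, hullR t x -> aff c x = 0) -> curve_poly x0 y c = 0.
  move=> h; apply: poly_germ_root => N; have [M NM tM] := freq N.
  by exists M => //; rewrite curve_polyE; apply: h.
(* a functional that vanishes along the curve is 0, as it vanishes at x1 and at
   the points x1 + row i A, which affinely span the space *)
have poly0 c : curve_poly x0 y c = 0 -> c = 0.
  move=> q0; have c0 : aff c x0 = 0 by rewrite -(curve_poly0 x0 y) q0 coef0.
  have cy j : aff c (y j) = 0 by have := curve_polyS x0 y c j; rewrite q0 coef0 c0 subr0.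
  have cx1 : aff c x1 = 0 by have := cy (lift ord0 ord0); rewrite /y liftK unlift_none.
  have cA i : aff c (x1 + row i A) = 0.
    by have := cy (lift ord0 (lift ord0 i)); rewrite /y !liftK.
  have dA : A *m dsubmx c = 0.
    apply/row_matrixP => i; rewrite row_mul row0; apply/matrixP => a b; rewrite !ord1 [RHS]mxE.
    have e3 : ((x1 + row i A) *m dsubmx c) 0 0 = (x1 *m dsubmx c) 0 0 + (row i A *m dsubmx c) 0 0.
      by rewrite mulmxDl mxE.
    by have := cA i; rewrite affE e3 addrA -affE cx1 add0r.
  have fA : A \in unitmx by rewrite -row_free_unit /row_free rA.
  have d0 : dsubmx c = 0 by rewrite -[LHS](mulKmx fA) dA mulmx0.
  rewrite -[c]vsubmxK d0 (_ : usubmx c = 0) ?col_mx0//.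
  apply/matrixP => a b; rewrite !ord1 !mxE -[RHS]c0 affE d0 mulmx0 [X in _ + X]mxE addr0.
  by congr (c _ _); exact/val_inj.
have [p pt] := vertices_exist (erefl #|` t|).
have tn : #|` t| = n.+1.
  apply/eqP; have /andP[_] := simplex_card tG; rewrite leq_eqVlt => /orP[//|lt_t].
  pose K := cokermx (vertex_mxR p : 'M[R]_(_, 1 + n)).
  have K0 : K != 0.
    rewrite -mxrank_eq0 mxrank_coker subn_eq0 -ltnNge.
    by apply: leq_ltn_trans (rank_leq_row _) _.
  have [j Kj] : exists j, col j K != 0.
    apply/existsP; apply: contraNT K0 => /existsPn h; apply/eqP/matrixP => i j.
    by have /negPn/eqP/matrixP/(_ i 0) := h j; rewrite !mxE.
  case/eqP: Kj; apply: poly0; apply: freq0 => x /(simplex_hull_vertices _ pt)[w [_ w1 ->]].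
  have := mul_vertex_mxR p w; rewrite w1 /aff /homog => <-.
  by rewrite colE -mulmxA [vertex_mxR p *m _]mulmxA mulmx_coker mul0mx mulmx0 mxE.
exists t; split => //.
  have [p' pt'] := vertices_exist tn; have pU := full_unit tG tn pt'.
  apply/(in_simplex pt' pU) => i; rewrite -(curve_poly0 x0 y); apply: poly_germ_ge0 => N.
  have [M NM tM] := freq N; exists M => //; rewrite curve_polyE.
  exact: (in_simplex pt' pU _).1 tM i.
move=> c c0 cz.
have [||N hN] := @poly_germ_gt0 _ (- curve_poly x0 y c) 1.
- by rewrite coefN (curve_polyS x0 y c ord0) c0 subr0 /y unlift_none oppr_gt0.
- by case=> // _; rewrite coefN curve_poly0 c0 oppr0.
have [M NM tM] := freq N; exists (g M) => //.
by have := hN M NM; rewrite hornerN curve_polyE oppr_gt0.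
Qed.

Lemma barycenter_in s : s != fset0 -> hullR s (barycenter s).
Proof.
move=> s0; apply/simplex_hullP; exists (fun=> (#|` s|%:R)^-1); split => //.
- by rewrite big_const_seq count_predT iter_addr_0 -[_ *+ _]mulr_natl mulfV// pnatr_eq0 cardfs_eq0.
- by rewrite /barycenter scaler_sumr.
Qed.

(** The barycenter of s lies in the hull of the common face of s and t; as its
    barycentric coordinates in s are all nonzero, that face is s. *)
Lemma barycenter_sub s t : s \in Gamma -> t \in Gamma -> hullR t (barycenter s) -> (s `<=` t)%fset.
Proof.
move=> sG tG tb; have [aff_s _ cap _] := hGamma; have [s0 _] := aff_s s sG.
have [p ps] := vertices_exist (erefl #|` s|).
have rf := simplex_row_free sG erefl ps.
have : (hullR s `&` hullR t) (barycenter s) by split=> //; apply: barycenter_in.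
rewrite cap// => /simplex_hullP[w [w0 w1 eb]].
pose w' v := if v \in t then w v else 0.
have sumcap (V : lmodType R) (F : 'rV[int]_n -> V) :
    \sum_(v <- (s `&` t)%fset) w v *: F v = \sum_i w' (p i) *: F (p i).
  rewrite -(sum_vertices (fun v => w' v *: F v) ps).
  transitivity (\sum_(v <- s | v \in t) w v *: F v); last first.
    rewrite big_mkcond; apply: eq_bigr => v _; rewrite /w'.
    by case: ifP => _; rewrite ?scale0r.
  rewrite -[RHS]big_filter.
  apply: perm_big; apply: uniq_perm; rewrite ?filter_uniq ?fset_uniq// => v.
  by rewrite inE mem_filter andbC.
have e : (\row_i (#|` s|%:R)^-1 : 'rV[R]_#|` s|) = \row_i w' (p i).
  apply: (row_free_inj rf); rewrite !mul_vertex_mxR; congr row_mx.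
    congr _%:M; transitivity (1 : R).
      under eq_bigr do rewrite mxE.
      by rewrite sumr_const card_ord -[_ *+ _]mulr_natl mulfV// pnatr_eq0 cardfs_eq0.
    rewrite -w1; have := sumcap R^o (fun=> 1); rewrite /GRing.scale/=.
    under eq_bigr do rewrite mulr1; move->.
    by apply: eq_bigr => i _; rewrite mxE mulr1.
  transitivity (barycenter s : 'rV[R]_n).
    rewrite /barycenter scaler_sumr (sum_vertices _ ps); apply: eq_bigr => i _.
    by rewrite mxE.
  by rewrite eb sumcap; apply: eq_bigr => i _; rewrite mxE.
apply/fsubsetP => v; have [_ ->] := ps => /existsP[i /eqP->].
move/rowP/(_ i): e; rewrite !mxE /w'; case: ifP => // _ /eqP.
by rewrite invr_eq0 pnatr_eq0 cardfs_eq0 (negbTE s0).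
Qed.

Lemma full_superset s : s \in Gamma -> exists t, [/\ t \in Gamma, #|` t| = n.+1 & (s `<=` t)%fset].
Proof.
move=> sG; have [aff_s _ _ _] := hGamma; have [s0 _] := aff_s s sG.
have Db : Delta (barycenter s) by apply: (sub_Delta sG); apply: barycenter_in.
have [t [tG tn tb _]] := curve_simplex Db Db.
by exists t; split => //; apply: barycenter_sub.
Qed.

(** Move from the barycenter of the facet towards z. *)
Lemma opposite_simplex t (p : 'I_(1 + n) -> 'rV[int]_n) i z : (0 < n)%N ->
  t \in Gamma -> #|` t| = n.+1 -> vertices_of t p -> Delta z -> aff (bary p i) z < 0 ->
  exists t' q, [/\ t' \in Gamma, #|` t'| = n.+1, q \notin t, t' = (q |` (t `\ p i))%fset &
    aff (bary p i) (real_point q : 'rV[R]_n) < 0].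
Proof.
move=> n0 tG tn pt Dz iz; have pU := full_unit tG tn pt; have [pI pE] := pt.
have pit j : p j \in t by rewrite pE; apply/existsP; exists j.
pose s := (t `\ p i)%fset.
have sn : #|` s| = n by have := cardfsD1 (p i) t; rewrite pit tn add1n => -[].
have s0 : s != fset0 by rewrite -cardfs_gt0 sn.
have [_ down _ _] := hGamma.
have sG : s \in Gamma by apply: (down _ t) => //; apply: fsubD1set.
have lam_s x : hullR s x -> aff (bary p i) x = 0.
  move=> /simplex_hullP[w [_ w1 ->]]; rewrite aff_conv// big_seq big1// => v.
  rewrite !inE => /andP[vi]; rewrite pE => /existsP[j /eqP vj]; rewrite vj bary_vertex//.
  by rewrite vj (inj_eq pI) in vi; rewrite (negbTE vi) mulr0.
have Db : Delta (barycenter s) by apply: (sub_Delta sG); apply: barycenter_in.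
have [t' [t'G t'n t'b ht']] := curve_simplex Db Dz.
have st' := barycenter_sub sG t'G t'b.
have [x t'x ix] := ht' (bary p i) (lam_s _ (barycenter_in s0)) iz.
have /eqP/cardfs1P[q qE] : #|` (t' `\` s)%fset| = 1%N.
  by rewrite cardfsD (fsetIidPr st') sn t'n subSnn.
have t'E : t' = (q |` s)%fset.
  by rewrite -qE fsetUC; apply/esym; rewrite fsetUDl fsetDv fsetD0; apply/fsetUidPr.
have qs : q \notin s.
  have : q \in (t' `\` s)%fset by rewrite qE inE.
  by rewrite inE => /andP[].
have iq : aff (bary p i) (real_point q : 'rV[R]_n) < 0.
  move/simplex_hullP: t'x ix => [w [w0 w1 ->]]; rewrite aff_conv// t'E big_fsetU1//=.
  rewrite [X in _ + X]big_seq [X in _ + X]big1 ?addr0 => [|v vs]; last first.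
    by rewrite (lam_s (real_point v)) ?mulr0//; apply: sub_hull; exists v.
  have : 0 <= w q by apply: w0; rewrite t'E !inE eqxx.
  rewrite le_eqVlt => /predU1P[<-|wq]; first by rewrite mul0r ltxx.
  by rewrite pmulr_rlt0.
exists t', q; split => //; rewrite pE; apply/existsP => -[j /eqP qj].
by move: iq; rewrite qj bary_vertex// ltNge ler0n.
Qed.

Lemma all_boundary_volume t (p : 'I_(1 + n) -> 'rV[int]_n) : @unimodular R n Gamma ->
  t \in Gamma -> #|` t| = n.+1 -> vertices_of t p ->
  (forall i z, Delta z -> 0 <= aff (bary p i) z) -> lattice_volume Delta = 1%E.
Proof.
move=> uG tG tn pt h; have pU := full_unit tG tn pt.
have -> : Delta = hullR t.
  apply/seteqP; split; last exact: sub_Delta.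
  by move=> z Dz; apply/(in_simplex pt pU) => i; apply: h.
by rewrite /lattice_volume uG// -EFinM mulfV// pnatr_eq0 -lt0n fact_gt0.
Qed.

Lemma full_unimodular t (p : 'I_(1 + n) -> 'rV[int]_n) : @unimodular R n Gamma ->
  t \in Gamma -> #|` t| = n.+1 -> vertices_of t p -> vertex_mx p \in unitmx.
Proof.
move=> uG tG tn pt; have pU := full_unit tG tn pt.
apply: (unimodular_of_int pU) => i j; apply: contrapT => /negP h.
by have := volume_gt_of_nonint pt pU h; rewrite uG// ltxx.
Qed.

Definition full_simplices : {fset {fset 'rV[int]_n}} := [fset t in Gamma | #|` t| == n.+1]%fset.

(** Two full simplices meet in a common face, on which the barycentric coordinate of
    a vertex of only one of them vanishes. *)
Lemma card_full_le : @unimodular R n Gamma -> ((#|` full_simplices|%:R)%:E <= lattice_volume Delta)%E.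
Proof.
move=> uG; set F := full_simplices.
have inF (t : F) : val t \in Gamma /\ #|` val t| = n.+1.
  by have := valP t; rewrite !inE/= => /andP[-> /eqP->].
have : (\sum_(t : F) euclidean_volume (hullR (val t)) <= euclidean_volume Delta)%E.
  apply: (le_trans (euclidean_volume_superadditive _)) => [t t' tt'|]; last first.
    by apply: le_euclidean_volume => x [t _]; apply: sub_Delta; have [] := inF t.
  have [tG tn] := inF t; have [t'G t'n] := inF t'.
  have [_ _ cap _] := hGamma; rewrite cap//.
  have [p pt] := vertices_exist tn; have pU := full_unit tG tn pt.
  have [v vt vt'] : exists2 v, v \in val t & v \notin val t'.
    apply/fsubsetPn; apply: contra tt' => sub; apply/eqP/val_inj/eqP.
    by rewrite eqEfcard sub t'n tn leqnn.
  have [pI pE] := pt; move: vt; rewrite pE => /existsP[i /eqP vi].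
  exists (dsubmx (bary p i)), (- (bary p i : 'cV[R]__) 0 0); split.
    rewrite oppr_eq0; apply: contraT; rewrite negb_or !negbK => /andP[/eqP d0 /eqP b0].
    have := bary_vertex pU i i; rewrite affE d0 b0 mulmx0 mxE addr0 eqxx => /esym/eqP.
    by rewrite oner_eq0.
  move=> x /simplex_hullP[w [_ w1 ->]]; apply/eqP; rewrite -addr_eq0 addrC -affE aff_conv//.
  rewrite big_seq big1// => u; rewrite !inE pE => /andP[/existsP[j /eqP uj] ut'].
  rewrite uj bary_vertex// (_ : j == i = false) ?mulr0//; apply/eqP => ji.
  by move: vt'; rewrite vi -ji -uj ut'.
rewrite (eq_bigr (fun=> ((n`!)%:R^-1)%:E)); last by move=> t _; apply: uG; have [] := inF t.
rewrite sumEFin sumr_const -cardfE /lattice_volume => h.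
rewrite -[leLHS](_ : ((n`!)%:R%:E * ((n`!)%:R^-1 *+ #|` F|)%:E)%E = _); last first.
  by rewrite -EFinM mulrnAr mulfV ?pnatr_eq0 -?lt0n ?fact_gt0.
by apply: lee_wpmul2l => //; rewrite lee_fin.
Qed.
End Triangulation.

(** * Reduction modulo 2 *)

Lemma bitD (a b : 'F_2) : (a + b != 0) = (a != 0) (+) (b != 0).
Proof. by case: a b => [[|[]]//? [[|[]]//?]]. Qed.

Lemma bit_inj (a b : 'F_2) : (a != 0) = (b != 0) -> a = b.
Proof. by case: a b => [[|[]]//? [[|[]]//?]] _; apply: val_inj. Qed.

Lemma intr_unitmx (F : comUnitRingType) m (A : 'M[int]_m) :
  A \in unitmx -> map_mx intr A \in (unitmx : {pred 'M[F]_m}).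
Proof.
move=> AU; have := congr1 (map_mx (intr : int -> F)) (mulmxV AU).
by rewrite map_mxM map_mx1 => /mulmx1_unit[].
Qed.

Lemma intr_invmx (F : comUnitRingType) m (A : 'M[int]_m) :
  A \in unitmx -> invmx (map_mx intr A) = map_mx intr (invmx A) :> 'M[F]_m.
Proof.
move=> AU; rewrite -[RHS](mulKmx (intr_unitmx F AU)) -map_mxM mulmxV//.
by rewrite map_mx1 mulmx1.
Qed.

Section Mod2.
Context {n : nat}.
Definition mod2 (z : 'rV[int]_n) : 'rV['F_2]_n := map_mx (fun a : int => a%:~R : 'F_2) z.

Lemma mod2D x y : mod2 (x + y) = mod2 x + mod2 y.
Proof. by apply/rowP => j; rewrite !mxE intrD. Qed.
Lemma mod2B x y : mod2 (x - y) = mod2 x - mod2 y.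
Proof. by apply/rowP => j; rewrite !mxE intrD intrN. Qed.
Lemma mod20 : mod2 0 = 0.
Proof. by apply/rowP => j; rewrite !mxE. Qed.
Lemma mod2Z a x : mod2 (a *: x) = a%:~R *: mod2 x.
Proof. by apply/rowP => j; rewrite !mxE intrM. Qed.
Lemma mod2_sum (I : Type) (r : seq I) (F : I -> 'rV[int]_n) :
  mod2 (\sum_(i <- r) F i) = \sum_(i <- r) mod2 (F i).
Proof. exact: (big_morph mod2 mod2D mod20). Qed.

(** T(P) is spanned by differences, and the annihilation of differences is preserved
    by the group operations. *)
Lemma T2_perpP (R : realType) (P : set 'rV[R]_n) (s : 'cV['F_2]_n) :
  s \in T2_perp P <-> forall x y, lattice_points P x -> lattice_points P y -> mod2 x *m s = mod2 y *m s.
Proof.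
rewrite inE; split=> [/asboolP h x y Px Py|h].
  apply/eqP; rewrite -subr_eq0 -mulmxBl -mod2B; apply/eqP/h; exists (x - y) => //.
  by move=> H [_]; apply; exists x => //; exists y.
apply/asboolP => _ [z zT <-]; rewrite -/(mod2 z).
apply: (zT [set z | mod2 z *m s = 0]); split; last first.
  by move=> _ [x Px [y Py <-]] /=; rewrite mod2B mulmxBl (h x y) ?subrr.
split; first by rewrite inE /= mod20 mul0mx.
by move=> x y; rewrite !inE /= mod2B mulmxBl => -> ->; rewrite subr0.
Qed.

Section Simplex.
Variable (p : 'I_(1 + n) -> 'rV[int]_n).
Hypothesis pZ : vertex_mx p \in unitmx.

(** The value of the orthant s at vertex l, modulo 2. *)
Definition chi (s : 'cV['F_2]_n) (l : 'I_(1 + n)) : bool := (mod2 (p l) *m s) 0 0 != 0.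
Definition ibary i : 'cV[int]_(1 + n) := col i (invmx (vertex_mx p)).
(** The linear part of the i-th barycentric coordinate, reduced modulo 2. *)
Definition facet_vec i : 'cV['F_2]_n := map_mx (fun a : int => a%:~R : 'F_2) (dsubmx (ibary i)).

Lemma chiD s t l : chi (s + t) l = chi s l (+) chi t l.
Proof. by rewrite /chi mulmxDr mxE bitD. Qed.

Lemma chi_const (s : 'cV['F_2]_n) (a : 'F_2) : (forall l, (mod2 (p l) *m s) 0 0 = a) -> s = 0.
Proof.
move=> h; pose M : 'M['F_2]_(1 + n) := map_mx intr (vertex_mx p).
have MU : M \in unitmx by apply: intr_unitmx.
have rowM l : row l M = row_mx 1%:M (mod2 (p l)).
  by rewrite /M -map_row rowK map_row_mx map_mx1.
have : M *m col_mx (- a)%:M s = 0.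
  apply/row_matrixP => l; rewrite row_mul rowM mul_row_col mul1mx row0.
  by apply/matrixP => i j; rewrite !ord1 mxE h !mxE mulr1n addNr.
move/(congr1 (mulmx (invmx M))); rewrite mulKmx// mulmx0 => /eqP.
by rewrite col_mx_eq0 => /andP[_ /eqP].
Qed.

(** Modulo 2, the vertex matrix is still invertible. *)
Lemma chi_inj s t : (forall l m, chi s l (+) chi s m = chi t l (+) chi t m) -> s = t.
Proof.
move=> h; apply/eqP; rewrite -subr_eq0; apply/eqP.
apply: (@chi_const _ ((mod2 (p ord0) *m (s - t)) 0 0)) => l; apply: bit_inj.
rewrite -!/(chi _ _) !chiD.
have chiN w i : chi (- w) i = chi w i by rewrite /chi mulmxN mxE oppr_eq0.
rewrite !chiN; have := h l ord0.
by case: (chi s l) (chi s ord0) (chi t l) (chi t ord0) => [] [] [] [].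
Qed.

Lemma ibary_vertex i j : ibary i 0 0 + (p j *m dsubmx (ibary i)) 0 0 = (j == i)%:R.
Proof.
have <- : (row_mx 1%:M (p j) *m ibary i) 0 0 = (j == i)%:R.
  have := congr1 (fun A : 'M[int]_(1 + n) => A j i) (mulmxV pZ); rewrite /= mxE [RHS]mxE => <-.
  by rewrite mxE; apply: eq_bigr => l _; rewrite [vertex_mx p j l]mxE [ibary i l 0]mxE.
rewrite -[ibary i in RHS]vsubmxK mul_row_col mul1mx [RHS]mxE; congr (_ + _).
by rewrite [RHS]mxE; congr (ibary i _ _); exact/val_inj.
Qed.

Lemma mod2_mul_facet_vec x i : (mod2 x *m facet_vec i) 0 0 = ((x *m dsubmx (ibary i)) 0 0)%:~R.
Proof. by rewrite /facet_vec /mod2 -map_mxM mxE. Qed.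

Lemma chi_u i l m : chi (facet_vec i) l (+) chi (facet_vec i) m = (l == i) (+) (m == i).
Proof.
rewrite /chi !mod2_mul_facet_vec.
have key j : ((p j *m dsubmx (ibary i)) 0 0)%:~R = (j == i)%:R - (ibary i 0 0)%:~R :> 'F_2.
  apply: (canRL (addrK _)); rewrite -intrD addrC ibary_vertex.
  by case: (j == i).
rewrite !key !bitD; case: (l == i) (m == i) => [] []; case: (- _ != 0) => //=.
Qed.

Context {R : realType}.
Variables (t : {fset 'rV[int]_n}).
Hypothesis pt : vertices_of t p.
Let pU : (vertex_mxR p : 'M[R]_(1 + n)) \in unitmx.
Proof. by apply: intr_unitmx. Qed.

Lemma baryE i : bary p i = map_mx intr (ibary i) :> 'cV[R]_(1 + n).
Proof. by rewrite /bary /vertex_mxR intr_invmx// map_col. Qed.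

Lemma aff_ibary i (z : 'rV[int]_n) : aff (bary p i) (real_point z : 'rV[R]_n) =
  (ibary i 0 0 + (z *m dsubmx (ibary i)) 0 0)%:~R.
Proof. by rewrite affE baryE -map_dsubmx -map_mxM [X in X + _]mxE [X in _ + X]mxE -intrD. Qed.

Lemma ibaryK (z : 'rV[int]_n) : \sum_i (ibary i 0 0 + (z *m dsubmx (ibary i)) 0 0) = 1 /\
  \sum_i (ibary i 0 0 + (z *m dsubmx (ibary i)) 0 0) *: p i = z.
Proof.
have [e1 e2] := baryK pU (real_point z); split.
  apply: (@intr_inj R); rewrite -[RHS]e1 rmorph_sum; apply: eq_bigr => i _.
  by rewrite aff_ibary.
apply/rowP => j; apply: (@intr_inj R); have := congr1 (fun A : 'rV[R]_n => A 0 j) e2.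
rewrite [X in _ = X -> _]mxE => <-; rewrite !summxE rmorph_sum; apply: eq_bigr => i _.
by rewrite aff_ibary; move: (ibary i 0 0 + _) => c; rewrite !mxE rmorphM.
Qed.

(** A lattice point of the face is an integral combination of the vertices, with
    coefficients that add up to 1 and vanish outside the face. *)
Lemma T2_perp_simplex (sg : {fset 'rV[int]_n}) s : (sg `<=` t)%fset ->
  s \in T2_perp (simplex_hull sg : set 'rV[R]_n) <->
  forall l m, p l \in sg -> p m \in sg -> chi s l = chi s m.
Proof.
move=> sub; have [pI pE] := pt; rewrite T2_perpP; split=> [h l m ls ms|h x y].
  by rewrite /chi (h (p l) (p m))//; apply: sub_hull; [exists (p l)|exists (p m)].
have key z : lattice_points (simplex_hull sg : set 'rV[R]_n) z ->
    exists2 l, p l \in sg & mod2 z *m s = mod2 (p l) *m s.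
  move=> zs; have [e1 e2] := ibaryK z.
  pose L i := ibary i 0 0 + (z *m dsubmx (ibary i)) 0 0.
  have L0 i : p i \notin sg -> L i = 0.
    move=> ins; apply/eqP; rewrite -(intr_eq0 R) -aff_ibary.
    move/simplex_hullP: (zs : simplex_hull sg _) => [w [_ w1 ->]]; rewrite aff_conv// big_seq big1// => v vs.
    have := fsubsetP sub v vs; rewrite pE => /existsP[j /eqP vj]; rewrite vj bary_vertex//.
    case: eqP => [ji|]; rewrite ?mulr0//; by move: ins; rewrite -ji -vj vs.
  have [l ls] : exists l, p l \in sg.
    apply: contrapT => nl; have := e1; rewrite big1 => [/eqP|i _]; first by rewrite eq_sym oner_eq0.
    by apply: L0; apply/negP => ?; apply: nl; exists i.
  exists l => //; rewrite -[in LHS]e2 mod2_sum mulmx_suml -[RHS]scale1r.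
  rewrite (_ : 1 = \sum_i (L i)%:~R); last by rewrite -rmorph_sum e1.
  rewrite scaler_suml; apply: eq_bigr => i _; rewrite mod2Z -scalemxAl.
  have [ins|ins] := boolP (p i \in sg); last by rewrite -/(L i) L0// !scale0r.
  by congr (_ *: _); apply/matrixP => a b; rewrite !ord1; apply: bit_inj; exact: h.
move=> /key[l ls ->] /key[m ms ->].
by apply/matrixP => a b; rewrite !ord1; apply: bit_inj; exact: h.
Qed.

Lemma sub_T2_perp_simplex (sg : {fset 'rV[int]_n}) s a : (sg `<=` t)%fset ->
  s - a \in T2_perp (simplex_hull sg : set 'rV[R]_n) <->
  forall l m, p l \in sg -> p m \in sg -> chi s l (+) chi s m = chi a l (+) chi a m.
Proof.
move=> sub; rewrite T2_perp_simplex//.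
have chiB l : chi (s - a) l = chi s l (+) chi a l.
  by rewrite chiD [chi (- a) l]/chi mulmxN mxE oppr_eq0.
split=> h l m ls ms; have := h l m ls ms; rewrite !chiB;
by case: (chi s l) (chi s m) (chi a l) (chi a m) => [] [] [] [].
Qed.

Lemma facet_vec_T2_perp (D : set 'rV[R]_n) i :
  facet_vec i \in T2_perp [set x | D x /\ aff (bary p i) x = 0].
Proof.
apply/T2_perpP => x y [_ hx] [_ hy]; apply/matrixP => a b; rewrite !ord1 !mod2_mul_facet_vec.
move: hx hy; rewrite !aff_ibary => /eqP; rewrite intr_eq0 => /eqP ex /eqP; rewrite intr_eq0 => /eqP ey.
by congr (_%:~R); apply: (addrI (ibary i 0 0)); rewrite ex ey.
Qed.

Lemma boundary_face (D : set 'rV[R]_n) i : (exists x, D x /\ aff (bary p i) x = 0) ->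
  (forall x, D x -> 0 <= aff (bary p i) x) -> face D [set x | D x /\ aff (bary p i) x = 0].
Proof.
move=> [x0 Dx0] h; split; first by exists x0.
exists (- dsubmx (bary p i)), ((bary p i : 'cV[R]__) 0 0).
have e x : (x *m - dsubmx (bary p i)) 0 0 = (bary p i : 'cV[R]__) 0 0 - aff (bary p i) x :> R.
  by rewrite affE mulmxN mxE opprD addrA subrr add0r.
split=> [x Dx|]; first by rewrite e lerBlDr lerDl h.
apply/seteqP; split=> x [Dx ex]; split=> //; first by rewrite /= e ex subr0.
by move/eqP: ex; rewrite e subr_eq -[eqbLHS]addr0 (inj_eq (addrI _)) => /eqP.
Qed.

End Simplex.
End Mod2.

(** * Connected pieces of the T-manifold *)

Section Star.
Context {R : realType} {n : nat}.
Variable P : set 'rV[R]_n.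
Hypothesis cP : @convex_set R 'rV[R]_n P.

Definition mkpt (x : 'rV[R]_n) (Px : P x) : P := SigSub (mem_set Px).

Variables (T : topologicalType) (h : P -> T).
Hypothesis ch : continuous h.

(** The segment is the image of [0, 1] under a map into the subspace P; continuity
    into P is continuity of the composition with the inclusion. *)
Lemma segment_image_connected (x y : P) :
  exists C : set T, [/\ connected C, C (h x), C (h y) &
    C `<=` [set h z | z in [set z : P | exists t : R, [/\ 0 <= t, t <= 1 &
       set_val z = t *: set_val x + (1 - t) *: set_val y]]]].
Proof.
pose g (t : R) : 'rV[R]_n := t *: set_val x + (1 - t) *: set_val y.
have Pg t : 0 <= t -> t <= 1 -> P (g t).
  by move=> t0 t1; apply: (convex_setP P).1 => //; exact: set_valP.
have f_ex (t : R) : exists z : P, 0 <= t -> t <= 1 -> set_val z = g t.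
  have [/andP[t0 t1]|nt] := boolP (0 <= t <= 1); first by exists (mkpt (Pg t t0 t1)).
  by exists x => t0 t1; rewrite t0 t1 in nt.
have [f hf] := choice f_ex.
have cg : continuous g.
  move=> t; apply: cvgD; apply: cvgZr_tmp.
    exact: cvg_id.
  by apply: cvgB; [exact: cvg_cst|exact: cvg_id].
have cf : {within `[0, 1], continuous (h \o f)}.
  have cf0 : {within `[0, 1], continuous f}.
    apply: (@continuous_comp_initial P (subspace (`[0, 1] : set R)) 'rV[R]_n set_val f).
    apply: (@subspace_eq_continuous _ _ _ g); last exact: continuous_subspaceT.
    by move=> t; rewrite inE/= in_itv/= => /andP[t0 t1]; rewrite hf.
  move=> t; apply: (@continuous_comp (subspace (`[0, 1] : set R)) P T f h); [exact: cf0|exact: ch].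
exists ((h \o f) @` `[0, 1]); split.
- by apply: connected_continuous_connected => //; exact: segment_connected.
- exists 1; first by rewrite /= in_itv/= ler01 lexx.
  by congr h; apply: val_inj; rewrite -[LHS]/(set_val (f 1)) hf// /g subrr scale0r addr0 scale1r.
- exists 0; first by rewrite /= in_itv/= ler01 lexx.
  by congr h; apply: val_inj; rewrite -[LHS]/(set_val (f 0)) hf// /g subr0 scale0r add0r scale1r.
move=> _ [t + <-]; rewrite /= in_itv/= => /andP[t0 t1]; exists (f t) => //=.
by exists t; split => //; apply: hf.
Qed.

Lemma star_connected (A : set 'rV[R]_n) (a : P) :
  (forall x t, A x -> 0 <= t -> t <= 1 -> A (t *: x + (1 - t) *: set_val a)) -> A (set_val a) ->
  connected [set h z | z in [set z : P | A (set_val z)]].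
Proof.
move=> star Aa; set B := [set h z | z in _].
have -> : B = connected_component B (h a).
  apply/seteqP; split; last exact: connected_component_sub.
  move=> _ [x /= Ax <-]; have [C [cC Cx Ca CB]] := segment_image_connected x a.
  apply: (connected_component_max Ca _ cC Cx).
  apply: subset_trans CB _ => _ [z /= [t [t0 t1 ez]] <-].
  by exists z => //=; rewrite ez; apply: star.
exact: component_connected.
Qed.
End Star.

Section Pieces.
Context {R : realType} {n : nat}.
Variables (P : set 'rV[R]_n) (k : nat) (E : {fset 'rV[int]_n} -> {set 'cV['F_2]_n}).
Hypothesis cP : @convex_set R 'rV[R]_n P.
Implicit Types (s : 'cV['F_2]_n) (t sg : {fset 'rV[int]_n}).

Definition piece s t : set (tilde P) :=
  [set tilde_proj (copy s x) | x in [set x : P | phase_piece k E s t (set_val x)]].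

Lemma faces_of_dimP t sg : (sg \in faces_of_dim k t) = (sg `<=` t)%fset && (#|` sg| == k.+1).
Proof. by rewrite !inE /= fpowersetE. Qed.

Lemma phaseP s t : reflect (exists2 sg, sg \in faces_of_dim k t & s \in E sg) (s \in phase k E t).
Proof.
rewrite /phase (big_morph (fun A : {set _} => s \in A) (finset.in_setU s) (finset.in_set0 s)) big_has.
exact: hasP.
Qed.

Lemma phaseS s sg t : (sg `<=` t)%fset -> s \in phase k E sg -> s \in phase k E t.
Proof.
move=> sub /phaseP[r]; rewrite faces_of_dimP => /andP[rs rk] sr.
by apply/phaseP; exists r => //; rewrite faces_of_dimP (fsubset_trans rs sub).
Qed.

Lemma phase_piece_barycenter s sg t : (sg `<=` t)%fset -> s \in phase k E sg ->
  phase_piece k E s t (barycenter sg : 'rV[R]_n).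
Proof.
move=> sub ss; exists [fset sg]%fset; split => //.
- by apply/fset0Pn; exists sg; rewrite inE.
- by move=> r; rewrite inE => /eqP->.
- by move=> r r'; rewrite !inE => /eqP-> /eqP->; rewrite fsubset_refl.
- by apply: sub_hull; exists sg => //=; rewrite inE.
Qed.

(** A chain of faces of t can be extended by t itself. *)
Lemma phase_piece_star s t (x : 'rV[R]_n) a : s \in phase k E t -> phase_piece k E s t x ->
  0 <= a -> a <= 1 -> phase_piece k E s t (a *: x + (1 - a) *: barycenter t).
Proof.
move=> st [c [c0 cs cc cx]] a0 a1; exists (t |` c)%fset; split.
- by apply/fset0Pn; exists t; rewrite !inE eqxx.
- by move=> r; rewrite !inE => /orP[/eqP->|/cs//].
- move=> r r'; rewrite !inE => /orP[/eqP->|rc] /orP[/eqP->|r'c].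
  + by rewrite fsubset_refl.
  + by have [-> _] := cs _ r'c; rewrite orbT.
  + by have [-> _] := cs _ rc.
  + exact: cc.
- move/convex_setP: (@hull_convex R n (barycenter @` [set` (t |` c)%fset])); apply => //.
    by apply: hullS cx => _ [r /= rc <-]; exists r => //=; rewrite !inE rc orbT.
  by apply: sub_hull; exists t => //=; rewrite !inE eqxx.
Qed.

Lemma phase_pieceS s sg t : (sg `<=` t)%fset ->
  (phase_piece k E s sg : set 'rV[R]_n) `<=` phase_piece k E s t.
Proof.
move=> sub x [c [c0 cs cc cx]]; exists c; split => // r /cs[rs ?].
by split => //; apply: fsubset_trans rs sub.
Qed.

Lemma tilde_proj_continuous s : continuous (fun x : P => tilde_proj (copy s x)).
Proof.
move=> x; apply: continuous_comp; first exact: existT_continuous.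
exact: pi_continuous.
Qed.

Lemma piece_connected s t : s \in phase k E t -> P (barycenter t) -> connected (piece s t).
Proof.
move=> st Pb; apply: (star_connected cP (@tilde_proj_continuous s) (a := mkpt Pb)).
  by move=> x a Ax a0 a1; apply: phase_piece_star.
by apply: phase_piece_barycenter.
Qed.

Lemma tilde_glued F s (t : 'cV['F_2]_n) (x : P) : face P F -> F (set_val x) -> t - s \in T2_perp F ->
  tilde_proj (copy s x) = tilde_proj (copy t x).
Proof.
move=> PF Fx ts.
have : glue_rel (copy s x) (copy t x).
  by apply/asboolP; apply: Relation_Operators.rst_step; exists F, s, t, x.
by move/(eqmodP (glue_equiv_rel P) (copy s x) (copy t x)).
Qed.
End Pieces.

(** * Phases on a full simplex *)

Section Faces.
Variable n : nat.
Implicit Types (t r : {fset 'rV[int]_n}).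

Lemma sub_face_exists t r : (r `<=` t)%fset -> (#|` r| < #|` t|)%N ->
  exists v, [/\ v \in t, v \notin r & (r `<=` t `\ v)%fset].
Proof.
move=> rt lt_rt; have [v vt vr] : exists2 v, v \in t & v \notin r.
  by apply/fsubsetPn; apply: contraL lt_rt => /fsubset_leq_card; rewrite -leqNgt.
by exists v; split=> //; rewrite fsubsetD1 rt.
Qed.

Lemma facesP t r k : #|` t| = k.+2 ->
  r \in faces_of_dim k t <-> exists2 v, v \in t & r = (t `\ v)%fset.
Proof.
move=> tk; rewrite faces_of_dimP; split=> [/andP[rt /eqP rk]|[v vt ->]].
  have [|v [vt vr sub]] := sub_face_exists rt; first by rewrite rk tk.
  exists v => //; apply/eqP; rewrite eqEfcard sub rk /=.
  by have := cardfsD1 v t; rewrite vt tk add1n => -[->].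
rewrite fsubD1set /=; have := cardfsD1 v t; rewrite vt tk add1n => -[->].
by rewrite eqxx.
Qed.

Lemma card_faces t k (Q : pred {fset 'rV[int]_n}) : #|` t| = k.+2 ->
  #|` [fset sg in faces_of_dim k t | Q sg]%fset| = #|` [fset v in t | Q (t `\ v)%fset]%fset|.
Proof.
move=> tk; set A := [fset v in t | _]%fset.
have -> : [fset sg in faces_of_dim k t | Q sg]%fset = [fset (t `\ v)%fset | v in A]%fset.
  apply/fsetP => r; rewrite inE /=; apply/andP/imfsetP => /=.
    by move=> [/(facesP _ tk)[v vt ->] Qr]; exists v; rewrite ?inE /= ?vt.
  move=> [v vA ->]; have /andP[vt Qv] : (v \in t) && Q (t `\ v)%fset by move: vA; rewrite !inE.
  by split => //; apply/(facesP _ tk); exists v.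
apply: card_in_imfset => v w; rewrite !inE /= => /andP[vt _] /andP[wt _] /fsetP/(_ v).
by rewrite !inE eqxx vt !andbT /= => /esym/negbT; rewrite negbK => /eqP.
Qed.

(** Transfers the parity condition from faces to indices of vertices. *)
Lemma card_vertices m t (p : 'I_m -> 'rV[int]_n) (A : {fset 'rV[int]_n}) :
  vertices_of t p -> (A `<=` t)%fset -> #|` A| = #|[set i | p i \in A]%SET|.
Proof.
move=> pt /fsubsetP At; rewrite -sum1dep_card big_mkcond.
rewrite -(sum_vertices (fun v => if v \in A then 1 else 0)%N pt) -big_mkcond sum1_count -size_filter.
apply: perm_size; apply: uniq_perm; rewrite ?filter_uniq ?fset_uniq// => v.
by rewrite mem_filter; apply/idP/andP => [vA|[]//]; split=> //; exact: At.
Qed.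
End Faces.

Section Local.
Context {R : realType} {n : nat}.
Variables (Delta : set 'rV[R]_n) (Gamma : {fset {fset 'rV[int]_n}}).
Variables (k : nat) (E : {fset 'rV[int]_n} -> {set 'cV['F_2]_n}).
Hypothesis hDelta : lattice_polytope Delta.
Hypothesis hGamma : triangulation Delta Gamma.
Hypothesis uG : @unimodular R n Gamma.
Hypothesis hE : @real_phase_structure R n Gamma k E.
Hypothesis n0 : (0 < n)%N.
Variables (t : {fset 'rV[int]_n}) (p : 'I_(1 + n) -> 'rV[int]_n).
Hypothesis tG : t \in Gamma.
Hypothesis tn : #|` t| = n.+1.
Hypothesis pt : vertices_of t p.

Let pZ : vertex_mx p \in unitmx := full_unimodular hGamma uG tG tn pt.

Definition vfacet i := (t `\ p i)%fset.
Definition phase_sides s := [set i | s \in phase k E (vfacet i)]%SET.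

Lemma vertex_in i : p i \in t. Proof. by case: pt => _ ->; apply/existsP; exists i. Qed.

Lemma in_vfacet i j : (p j \in vfacet i) = (j != i).
Proof. by rewrite !inE vertex_in andbT (inj_eq (proj1 pt)). Qed.

Lemma card_vfacet i : #|` vfacet i| = n.
Proof. by have := cardfsD1 (p i) t; rewrite vertex_in tn add1n => -[]. Qed.

Lemma vfacet_G i : vfacet i \in Gamma.
Proof.
have [_ down _ _] := hGamma; apply: (down _ t) => //; first exact: fsubD1set.
by rewrite -cardfs_gt0 card_vfacet.
Qed.

(** The i-th barycentric coordinate vanishes on the facet opposite to [p i], so its
    linear part lies in the annihilator of each face of that facet. *)
Lemma addu_phase s i : s \in phase k E (vfacet i) -> s + facet_vec p i \in phase k E (vfacet i).
Proof.
move=> /phaseP[r]; rewrite faces_of_dimP => /andP[ri /eqP rk] sr; apply/phaseP.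
exists r; first by rewrite faces_of_dimP ri rk eqxx.
have [hE1 _] := hE; have [_ down _ _] := hGamma.
have rG : r \in Gamma.
  apply: (down _ t) => //; first exact: fsubset_trans ri (fsubD1set _ _).
  by rewrite -cardfs_gt0 rk.
have rt : (r `<=` t)%fset by exact: fsubset_trans ri (fsubD1set _ _).
have [a ea] := hE1 r rG rk; rewrite ea in sr *; rewrite finset.inE.
move: sr; rewrite finset.inE => /(sub_T2_perp_simplex pZ pt _ _ rt) h.
apply/(sub_T2_perp_simplex pZ pt _ _ rt) => l m lr mr.
rewrite -(h l m lr mr); apply: (chi_addu (chiD p) (chi_u pZ)); rewrite -in_vfacet.
  exact: (fsubsetP ri).
exact: (fsubsetP ri).
Qed.

Section Curve.
Hypothesis kn : k.+1 = n.

Lemma phase_vfacet s i : (s \in phase k E (vfacet i)) = (s \in E (vfacet i)).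
Proof.
apply/phaseP/idP => [[r]|h]; last first.
  by exists (vfacet i) => //; rewrite faces_of_dimP fsubset_refl card_vfacet kn eqxx.
rewrite faces_of_dimP => /andP[ri /eqP rk]; suff -> : r = vfacet i by [].
by apply/eqP; rewrite eqEfcard ri rk card_vfacet kn leqnn.
Qed.

Lemma curve_phaseE : exists a : 'I_n.+1 -> 'I_n.+1 -> bool, forall i, E (vfacet i) = facet_phase (chi p) a i.
Proof.
have [hE1 _] := hE.
have ex i : exists a, E (vfacet i) = [set s | s - a \in T2_perp (simplex_hull (vfacet i) : set 'rV[R]_n)]%SET.
  by apply: hE1; [exact: vfacet_G|rewrite card_vfacet kn].
have [a ha] := choice ex; exists (fun i => chi p (a i)) => i.
apply/setP => s; rewrite ha inE.
apply/idP/facet_phaseP => [/(sub_T2_perp_simplex pZ pt _ _ (fsubD1set _ _)) h l m li mi|h].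
  by apply: h; rewrite in_vfacet.
apply/(sub_T2_perp_simplex pZ pt _ _ (fsubD1set _ _)) => l m.
by rewrite !in_vfacet; apply: h.
Qed.

Lemma mem_phase_full s : (s \in phase k E t) = (phase_sides s != finset.set0).
Proof.
apply/idP/set0Pn => [/phaseP[r rt sr]|[i]]; last first.
  by rewrite inE; apply: phaseS; apply: fsubD1set.
have tk : #|` t| = k.+2 by rewrite tn kn.
have [v vt rE] := (facesP r tk).1 rt; move: vt; case: pt => _ -> /existsP[i /eqP vi].
by exists i; rewrite inE phase_vfacet /vfacet -vi -rE.
Qed.

Lemma curve_even s : ~~ odd #|phase_sides s|.
Proof.
have [_ hE2] := hE; have tk : #|` t| = k.+2 by rewrite tn kn.
have := hE2 t tG tk s; rewrite (card_faces (fun sg => s \in E sg) tk).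
rewrite (card_vertices pt); last by apply/fsubsetP => v; rewrite !inE => /andP[].
congr (~~ odd _); apply: eq_card => i; rewrite !inE /= vertex_in /=.
by rewrite phase_vfacet.
Qed.

Lemma curve_two_sides s : s \in phase k E t -> (1 < #|phase_sides s|)%N.
Proof.
rewrite mem_phase_full -card_gt0; have := curve_even s.
by case: #|_| => [|[]].
Qed.

Lemma card_curve_local : (#|phase k E t| <= n.+1)%N.
Proof.
have [a ha] := curve_phaseE.
have sdE s : phase_sides s = [set i | s \in facet_phase (chi p) a i]%SET.
  by apply/setP => i; rewrite [LHS]inE phase_vfacet ha [RHS]inE.
have := @card_curve_phase n _ (chi p) (chi_inj pZ) a n0.
have -> : (\bigcup_i facet_phase (chi p) a i)%SET = phase k E t.
  apply/setP => s; rewrite mem_phase_full sdE; apply/bigcupP/set0Pn.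
    by move=> [i _ h]; exists i; rewrite inE.
  by move=> [i]; rewrite inE; exists i.
by apply=> s; rewrite -sdE; exact: curve_even.
Qed.
End Curve.

Section Surface.
Hypothesis kn : k.+2 = n.

Definition vridge i j := (t `\ p i `\ p j)%fset.

Lemma vridgeC i j : vridge i j = vridge j i.
Proof. by apply/fsetP => v; rewrite !inE; case: (v == p i); case: (v == p j). Qed.

Lemma in_vridge i j l : (p l \in vridge i j) = (l != j) && (l != i).
Proof. by rewrite in_fsetD1 in_vfacet (inj_eq (proj1 pt)). Qed.

Lemma card_vridge i j : i != j -> #|` vridge i j| = k.+1.
Proof.
move=> ij; have := cardfsD1 (p j) (vfacet i).
by rewrite in_vfacet eq_sym ij card_vfacet add1n => e; apply: succn_inj; rewrite kn [RHS]e.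
Qed.

Lemma vridge_sub i j : (vridge i j `<=` t)%fset.
Proof. exact: fsubset_trans (fsubD1set _ _) (fsubD1set _ _). Qed.

Lemma vridge_G i j : i != j -> vridge i j \in Gamma.
Proof.
move=> ij; have [_ down _ _] := hGamma; apply: (down _ t) => //; first exact: vridge_sub.
by rewrite -cardfs_gt0 card_vridge.
Qed.

(** The parity condition is only given for orthants, but every pattern of values on
    the vertices comes from one, up to a constant. *)
Lemma chi_surj (x : 'I_(1 + n) -> bool) : exists s, forall l m, chi p s l (+) chi p s m = x l (+) x m.
Proof.
exists (\sum_(i | x i) facet_vec p i) => l m.
have chi0 i : chi p 0 i = false by rewrite /chi mulmx0 mxE eqxx.
rewrite !(big_morph (fun s => chi p s _) (fun a b => chiD p a b _) (chi0 _)) -big_split/=.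
under eq_bigr do rewrite chi_u//.
have sumx r : \big[addb/false]_(i | x i) (r == i) = x r.
  have [xr|xr] := boolP (x r).
    by rewrite (bigD1 r)//= eqxx big1// => i /andP[_]; rewrite eq_sym => /negbTE.
  by rewrite big1// => i xi; apply/negbTE; apply: contraNneq xr => ->.
by rewrite big_split/= !sumx.
Qed.

Lemma agree_ext (a : 'I_n.+1 -> 'I_n.+1 -> 'I_n.+1 -> bool) J i j (x y : 'I_n.+1 -> bool) :
  (forall l m, x l (+) x m = y l (+) y m) -> agree a J i j x = agree a J i j y.
Proof.
by move=> h; apply/agreeP/agreeP => H l m lJ mJ li lj mi mj; rewrite -(H l m)// h.
Qed.

Lemma surface_phaseE : exists a : 'I_n.+1 -> 'I_n.+1 -> 'I_n.+1 -> bool,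
  [/\ forall i j, a i j = a j i, even_degrees a (finset.setTfor 'I_n.+1),
   forall i j, i != j -> E (vridge i j) = ridge_phase (chi p) a i j
   & forall s, phase_sides s = sides (chi p) a s].
Proof.
have [hE1 hE2] := hE.
have ex (r : {fset 'rV[int]_n}) : exists a, r \in Gamma -> #|` r| = k.+1 ->
    E r = [set s | s - a \in T2_perp (simplex_hull r : set 'rV[R]_n)]%SET.
  have [[rG rk]|h] := pselect (r \in Gamma /\ #|` r| = k.+1).
    by have [a ha] := hE1 r rG rk; exists a.
  by exists 0 => rG rk; case: h.
have [a ha] := choice ex; pose b i j : 'I_n.+1 -> bool := chi p (a (vridge i j)).
have bE i j : i != j -> E (vridge i j) = ridge_phase (chi p) b i j.
  move=> ij; apply/setP => s; rewrite ha ?vridge_G ?card_vridge// [LHS]finset.inE [RHS]finset.inE.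
  apply/idP/agreeP => [/(sub_T2_perp_simplex pZ pt _ _ (vridge_sub _ _)) h l m _ _ li lj mi mj|h].
    by apply: h; rewrite in_vridge ?li ?lj ?mi ?mj.
  apply/(sub_T2_perp_simplex pZ pt _ _ (vridge_sub _ _)) => l m.
  by rewrite !in_vridge => /andP[lj li] /andP[mj mi]; apply: h; rewrite ?finset.in_setT.
have fk i : #|` vfacet i| = k.+2 by rewrite card_vfacet kn.
exists b; split => //.
- by move=> i j; rewrite /b vridgeC.
- move=> i x _; have [s hs] := chi_surj x.
  have := hE2 _ (vfacet_G i) (fk i) s; rewrite (card_faces (fun sg => s \in E sg) (fk i)).
  rewrite (card_vertices pt); last first.
    by apply/fsubsetP => v; rewrite !inE => /andP[/andP[_ ->]].
  congr (~~ odd _); apply: eq_card => j; rewrite !finset.inE andbT /=.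
  rewrite !inE /= vertex_in (inj_eq (proj1 pt)) andbT; apply: andb_id2l => ji.
  by rewrite -[(_ `\ _)%fset]/(vridge i j) bE 1?eq_sym// inE; apply: agree_ext.
move=> s; apply/setP => i; rewrite [LHS]inE; apply/phaseP/sidesP => [[r]|[j ji sE]].
  move=> /(facesP _ (fk i))[v + ->]; rewrite in_fsetD1 => /andP[vi].
  case: (pt) => _ -> /existsP[j /eqP vj]; rewrite vj -/(vridge i j) bE.
    by exists j => //; rewrite vj (inj_eq (proj1 pt)) in vi.
  by rewrite eq_sym; rewrite vj (inj_eq (proj1 pt)) in vi.
exists (vridge i j); last by rewrite bE 1?eq_sym.
by apply/(facesP _ (fk i)); exists (p j); rewrite ?in_vfacet.
Qed.

Lemma surface_sides_neq0 s : s \in phase k E t -> phase_sides s != finset.set0.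
Proof.
move=> /phaseP[r]; rewrite faces_of_dimP => /andP[rt /eqP rk] sr.
have [|v [vt vr sub]] := sub_face_exists rt; first by rewrite rk tn -kn.
move: vt; case: (pt) => _ -> /existsP[i /eqP vi]; apply/set0Pn; exists i.
by rewrite inE; apply/phaseP; exists r => //; rewrite faces_of_dimP /vfacet -vi sub rk eqxx.
Qed.

Lemma surface_three_sides s : s \in phase k E t -> (2 < #|phase_sides s|)%N.
Proof.
have [a [asym ev _ sE]] := surface_phaseE.
by move/surface_sides_neq0; rewrite sE; apply: three_le_sides.
Qed.

Lemma card_surface_local : (#|phase k E t| <= 1 + n + 'C(n, 2))%N.
Proof.
have [a [asym ev _ sE]] := surface_phaseE.
apply: (card_surface_phase (chi_inj pZ) asym ev) => s /surface_sides_neq0.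
by rewrite sE.
Qed.

Lemma card_triangles_local (C : eqType) (f : 'I_n.+1 -> C) (T : {set 'cV['F_2]_n}) : (2 < n)%N ->
  (exists i j, f i != f j) -> (forall s, s \in T -> #|phase_sides s| = 3%N) ->
  (forall s i j, s \in T -> i \in phase_sides s -> j \in phase_sides s -> f i = f j) ->
  (3 * #|T| <= n * n.-1)%N.
Proof.
have [a [asym ev _ sE]] := surface_phaseE; move=> n2 fN T3 Tf.
apply: (card_triangles (chi_inj pZ) (chiD p) (chi_u pZ) asym ev n2 fN).
  by move=> s; rewrite -sE; apply: T3.
by move=> s i j; rewrite -sE; apply: Tf.
Qed.
End Surface.
End Local.

(** * Counting components *)

Section Global.
Context {R : realType} {n : nat}.
Variables (Delta : set 'rV[R]_n) (Gamma : {fset {fset 'rV[int]_n}}).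
Variables (k : nat) (E : {fset 'rV[int]_n} -> {set 'cV['F_2]_n}).
Hypothesis hDelta : lattice_polytope Delta.
Hypothesis hGamma : triangulation Delta Gamma.
Hypothesis uG : @unimodular R n Gamma.
Hypothesis hE : @real_phase_structure R n Gamma k E.
Hypothesis n0 : (0 < n)%N.

Notation V := ('cV['F_2]_n).
Notation F := (full_simplices Gamma).
Let X := @T_manifold_of R n Delta Gamma k E.

Lemma fullG (t : F) : val t \in Gamma.
Proof. by have := valP t; rewrite !inE /= => /andP[]. Qed.

Lemma full_card (t : F) : #|` val t| = n.+1.
Proof. by have := valP t; rewrite !inE /= => /andP[_ /eqP]. Qed.

Definition vert (t : F) : 'I_(1 + n) -> 'rV[int]_n := sval (cid (vertices_exist (full_card t))).

Lemma vertP t : vertices_of (val t) (vert t).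
Proof. exact: svalP (cid (vertices_exist (full_card t))). Qed.

Lemma vert_unimod t : vertex_mx (vert t) \in unitmx.
Proof. exact: (full_unimodular hGamma uG (fullG t) (full_card t) (vertP t)). Qed.

Lemma vert_unit t : (vertex_mxR (vert t) : 'M[R]_(1 + n)) \in unitmx.
Proof. exact: (full_unit hGamma (fullG t) (full_card t) (vertP t)). Qed.

Definition lam (t : F) i (x : 'rV[R]_n) : R := aff (bary (vert t) i) x.

(** Either a full simplex on the other side of the facet opposite to vertex i, with
    its new vertex, or None when Delta lies on one side of the facet. *)
Definition across_spec (t : F) i (o : option F * 'rV[int]_n) : Prop :=
  if o.1 is Some t' then
    [/\ o.2 \notin val t, val t' = (o.2 |` (val t `\ vert t i))%fset & lam t i (real_point o.2) < 0]
  else forall x, Delta x -> 0 <= lam t i x.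

Lemma across_exists (a : F * 'I_(1 + n)) : exists o, across_spec a.1 a.2 o.
Proof.
case: a => t i /=; have [h|] := pselect (forall x, Delta x -> 0 <= lam t i x).
  by exists (None, 0).
move/existsNP => [x /not_implyP[Dx /negP]]; rewrite -ltNge => ltx.
have [t' [q [t'G t'n qt t'E lq]]] :=
  opposite_simplex hDelta hGamma n0 (fullG t) (full_card t) (vertP t) Dx ltx.
have t'F : t' \in F by rewrite !inE /= t'G t'n eqxx.
by exists (Some [` t'F]%fset, q).
Qed.

Definition across (a : F * 'I_(1 + n)) := sval (cid (across_exists a)).
Definition neighbor (t : F) i : option F := (across (t, i)).1.
Definition apex (t : F) i : 'rV[int]_n := (across (t, i)).2.

Lemma acrossP t i : across_spec t i (neighbor t i, apex t i).
Proof. by have := svalP (cid (across_exists (t, i))); rewrite /neighbor /apex -surjective_pairing. Qed.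

Lemma neighborE t i t' : neighbor t i = Some t' ->
  apex t i \notin val t /\ val t' = (apex t i |` (val t `\ vert t i))%fset.
Proof. by move=> e; have := acrossP t i; rewrite e => -[]. Qed.

Lemma apex_lt0 t i : neighbor t i != None -> lam t i (real_point (apex t i)) < 0.
Proof. by have := acrossP t i; rewrite /across_spec/=; case: (neighbor t i) => [t'|//] [_ _ h] _. Qed.

Lemma neighbor_None t i : neighbor t i = None -> forall x, Delta x -> 0 <= lam t i x.
Proof. by move=> e; have := acrossP t i; rewrite e. Qed.

Lemma not_all_boundary t : (1 < lattice_volume Delta)%E -> ~ forall i, neighbor t i = None.
Proof.
move=> + h; rewrite (all_boundary_volume hGamma uG (fullG t) (full_card t) (vertP t)) ?ltxx//.
by move=> i x Dx; apply: neighbor_None.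
Qed.

(** Barycentric coordinates add up to 1, so they are not all negative at one point. *)
Lemma apex_not_const t : ~ forall i, neighbor t i != None /\ apex t i = apex t ord0.
Proof.
move=> h; have [s1 _] := baryK (vert_unit t) (real_point (apex t ord0)).
have : \sum_i lam t i (real_point (apex t ord0)) <= 0.
  by apply: sumr_le0 => i _; have [/apex_lt0 + e] := h i; rewrite e => /ltW.
by rewrite /lam s1 ler10.
Qed.

Definition facet_dir (t : F) i : V := facet_vec (vert t) i.

Lemma addvv (s : V) : s + s = 0.
Proof. by apply/matrixP => i j; rewrite !mxE; apply: bit_inj; rewrite bitD addbb eqxx. Qed.

Lemma chi0 t l : chi (vert t) 0 l = false.
Proof. by rewrite /chi mulmx0 mxE eqxx. Qed.

Lemma facet_dir_neq0 t i : facet_dir t i != 0.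
Proof.
apply/eqP => u0; have [j ji] : exists j : 'I_(1 + n), j != i.
  have : (0 < #|[set~ i]%SET|)%N by rewrite cardsC1 card_ord.
  by case/card_gt0P => j; rewrite !inE; exists j.
have := chi_u (vert_unimod t) i i j; rewrite -/(facet_dir t i) u0 !chi0 eqxx (negbTE ji).
by [].
Qed.

(** Two linear parts of barycentric coordinates coincide modulo 2 only if n = 1; then
    the two facets are all facets of t, and Delta = t has volume 1. *)
Lemma facet_dir_neq t i j : (1 < n)%N \/ (1 < lattice_volume Delta)%E -> i != j ->
  neighbor t i = None -> neighbor t j = None -> facet_dir t i != facet_dir t j.
Proof.
move=> hV ij oi oj; apply/eqP => uij.
have chiu := chi_u (vert_unimod t).
have all2 l : l = i \/ l = j.
  have [->|li] := eqVneq l i; first by left.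
  have [->|lj] := eqVneq l j; first by right.
  have := chiu i i l; rewrite -/(facet_dir t i) uij chiu eqxx (negbTE ij) (negbTE li) (negbTE lj).
  by [].
case: hV => [n1|/(not_all_boundary (t := t))]; last first.
  by apply=> l; case: (all2 l) => ->.
have : (#|[set i; j]%SET| = n.+1)%N.
  rewrite -[RHS](card_ord n.+1) -[RHS]cardsT; apply: eq_card => l; rewrite !inE.
  by case: (all2 l) => ->; rewrite eqxx ?orbT.
by rewrite cards2 ij; lia.
Qed.

(** The linear parts of the barycentric coordinates satisfy one relation, their sum
    is 0, so a relation with three terms forces n = 2; then all facets of t are in
    the boundary and Delta = t has volume 1. *)
Lemma facet_dir_closed t i j l : (2 < n)%N \/ (1 < lattice_volume Delta)%E -> i != j ->
  neighbor t i = None -> neighbor t j = None -> neighbor t l = None ->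
  facet_dir t l != facet_dir t i + facet_dir t j.
Proof.
move=> hV ij oi oj ol; apply/eqP => ul.
have chiu := chi_u (vert_unimod t).
have li : l != i.
  apply/eqP => li; move: ul; rewrite li -[LHS]addr0 => /addrI/esym/eqP.
  by rewrite (negbTE (facet_dir_neq0 _ _)).
have lj : l != j.
  apply/eqP => lj; move: ul; rewrite lj -[LHS]add0r => /addIr/esym/eqP.
  by rewrite (negbTE (facet_dir_neq0 _ _)).
have all3 m : [\/ m = i, m = j | m = l].
  have [->|mi] := eqVneq m i; first by constructor 1.
  have [->|mj] := eqVneq m j; first by constructor 2.
  have [->|ml] := eqVneq m l; first by constructor 3.
  have := chiu l l m; rewrite -/(facet_dir t l) ul !chiD eqxx (negbTE ml).
  have := chiu i l m; have := chiu j l m; rewrite -!/(facet_dir t _).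
  rewrite (negbTE li) (negbTE lj) (negbTE mi) (negbTE mj).
  by case: (chi _ _ l) (chi _ _ m) (chi _ _ l) (chi _ _ m) => [] [] [] [].
case: hV => [n1|/(not_all_boundary (t := t))]; last first.
  by apply=> m; case: (all3 m) => ->.
have : (#|[set i; j; l]%SET| = n.+1)%N.
  rewrite -[RHS](card_ord n.+1) -[RHS]cardsT; apply: eq_card => m; rewrite !inE.
  by case: (all3 m) => ->; rewrite eqxx ?orbT.
by rewrite -finset.setUA !cardsU1 cards1 !inE negb_or ij eq_sym li eq_sym lj; lia.
Qed.

Lemma Delta_barycenter (t : F) : Delta (barycenter (val t)).
Proof.
apply: (sub_Delta hGamma (fullG t)); apply: barycenter_in.
by rewrite -cardfs_gt0 full_card.
Qed.

Definition cells : {set F * V} := [set x | x.2 \in phase k E (val x.1)]%SET.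
Definition base_point (x : F * V) : tilde Delta := tilde_proj (copy x.2 (mkpt (Delta_barycenter x.1))).
Definition component (x : F * V) : set (tilde Delta) := connected_component X (base_point x).
Definition cell_sides (t : F) (s : V) := phase_sides k E (val t) (vert t) s.

Let cD : @convex_set R 'rV[R]_n Delta := Delta_convex hDelta.

Lemma piece_component x y : x \in cells -> piece (P := Delta) k E x.2 (val x.1) y ->
  connected_component X y = component x.
Proof.
rewrite inE => xc py; apply/esym/same_connected_component.
apply: (@connected_component_max _ X (piece k E x.2 (val x.1))) => //.
- exists (mkpt (Delta_barycenter x.1)) => //=.
  by apply: phase_piece_barycenter => //; exact: fsubset_refl.
- move=> _ [z /= hz <-]; exists (val x.1), x.2, z; split => //; exact: fullG.
- by apply: piece_connected => //; exact: Delta_barycenter.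
Qed.

(** The common point of a cell and its neighbour. *)
Lemma facet_barycenter t i : Delta (barycenter (vfacet (val t) (vert t) i)) /\
  lam t i (barycenter (vfacet (val t) (vert t) i)) = 0.
Proof.
have cf := card_vfacet (full_card t) (vertP t) i.
have fb : simplex_hull (vfacet (val t) (vert t) i) (barycenter (vfacet (val t) (vert t) i) : 'rV[R]_n).
  by apply: barycenter_in; rewrite -cardfs_gt0 cf.
split.
  by apply: (sub_Delta hGamma _ fb); apply: (vfacet_G hGamma n0 (fullG t) (full_card t) (vertP t)).
move: fb => /simplex_hullP[w [_ w1 ->]]; rewrite /lam aff_conv// big_seq big1// => v.
have [pI pE] := vertP t; rewrite !inE pE => /andP[vi /existsP[j /eqP vj]].
rewrite vj bary_vertex ?vert_unit// (_ : j == i = false) ?mulr0//; apply/eqP => ji.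
by move: vi; rewrite vj ji eqxx.
Qed.

(** Across an interior facet, the cells share the barycenter of the facet in the same
    copy of Delta. On a boundary facet of t, the two copies of this barycenter are
    glued, because the linear part of the barycentric coordinate that vanishes on
    the facet annihilates the face of Delta containing it. *)
Lemma nbr_cells x i : x \in cells -> i \in cell_sides x.1 x.2 ->
  nbr neighbor facet_dir x i \in cells /\ component (nbr neighbor facet_dir x i) = component x.
Proof.
case: x => t s xc /=; rewrite inE => si.
have [Db lb] := facet_barycenter t i.
pose y := tilde_proj (copy s (mkpt Db)).
have py : piece k E s (val t) y.
  by exists (mkpt Db) => //=; apply: phase_piece_barycenter => //; exact: fsubD1set.
rewrite /nbr /=; case e: (neighbor t i) => [t'|].
  have [_ t'E] := neighborE e.
  have sub : (vfacet (val t) (vert t) i `<=` val t')%fset by rewrite t'E fsubsetUr.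
  have xc' : (t', s) \in cells by rewrite inE; apply: phaseS sub si.
  split => //; rewrite -(piece_component xc py) -(piece_component (x := (t', s)) (y := y))//.
  by exists (mkpt Db) => //=; apply: phase_piece_barycenter.
have si' : s + facet_dir t i \in phase k E (vfacet (val t) (vert t) i).
  exact: (addu_phase hGamma uG hE (fullG t) (full_card t) (vertP t)).
have xc' : (t, s + facet_dir t i) \in cells by rewrite inE; apply: phaseS si'; exact: fsubD1set.
split => //; rewrite -(piece_component xc py) -(piece_component (x := (t, s + facet_dir t i)) (y := y))//.
have -> : y = tilde_proj (copy (s + facet_dir t i) (mkpt Db)).
  apply: (@tilde_glued _ _ Delta [set x | Delta x /\ lam t i x = 0]).
  - apply: boundary_face; first by exists (barycenter (vfacet (val t) (vert t) i)).
    exact: neighbor_None.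
  - by split.
  - by rewrite addrAC subrr add0r; apply: facet_vec_T2_perp; exact: vert_unimod.
by exists (mkpt Db) => //=; apply: phase_piece_barycenter => //; exact: fsubD1set.
Qed.

Lemma components_cells : [set connected_component X x | x in X] = [set component x | x in [set` cells]].
Proof.
apply/seteqP; split=> [_ [y Xy <-]|_ [x /= xc <-]]; last first.
  exists (base_point x) => //.
  exists (val x.1), x.2, (mkpt (Delta_barycenter x.1)); split => //; first exact: fullG.
    by move: xc; rewrite inE.
  apply: phase_piece_barycenter; first exact: fsubset_refl.
  by move: xc; rewrite inE.
move: Xy => [r [s [z [rG sr hz ->]]]].
have [t [tG tn rt]] := full_superset hDelta hGamma rG.
have tF : t \in F by rewrite !inE /= tG tn eqxx.
have xc : ([` tF]%fset, s) \in cells by rewrite inE /=; apply: phaseS rt sr.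
exists ([` tF]%fset, s) => //; apply/esym/piece_component => //=.
by exists z => //=; apply: phase_pieceS rt _ hz.
Qed.

Lemma b0_cells : b0 R X = (size (undup [seq component x | x in cells]))%:R%:E.
Proof.
rewrite /b0 components_cells /counting.
have -> : [set component x | x in [set` cells]] = [set` [fset c in [seq component x | x in cells]]%fset].
  apply/seteqP; split=> [_ [x /= xc <-]|c /=]; first by rewrite inE /=; apply: map_f; rewrite mem_enum.
  by rewrite inE /= => /mapP[x xc ->]; exists x => //=; rewrite mem_enum in xc.
by rewrite asboolT// set_fsetK card_fseq.
Qed.

Lemma sum_cells (g : F * V -> nat) :
  (\sum_(x in cells) g x = \sum_t \sum_(s in phase k E (val t)) g (t, s))%N.
Proof.
rewrite pair_big_dep /=; apply: eq_big => [[t s]|[t s] _]//.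
by rewrite inE.
Qed.

Lemma class_sum x : (\sum_(y in cells | component y == component x) 1 = #|class_of cells component x|)%N.
Proof. by rewrite -sum1_card; apply: eq_bigl => y; rewrite [RHS]finset.inE. Qed.

Lemma lee_b0 (a : nat) (c : R) : (0 < a)%N -> 0 <= c ->
  (a * size (undup [seq component x | x in cells]))%:R <= a%:R * c * (#|` F|)%:R ->
  (b0 R X <= c%:E * lattice_volume Delta)%E.
Proof.
move=> a0 c0 h; rewrite b0_cells.
apply: (@le_trans _ _ (c%:E * (#|` F|)%:R%:E)%E); last first.
  by apply: lee_wpmul2l; rewrite ?lee_fin//; apply: card_full_le.
by rewrite -EFinM lee_fin -(@ler_pM2l _ a%:R) ?ltr0n// -natrM mulrA.
Qed.

Lemma vert_in t i : vert t i \in val t.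
Proof. exact: (vertex_in (vertP t)). Qed.

Lemma cell_sides_class x : (1 < n)%N \/ (1 < lattice_volume Delta)%E -> x \in cells ->
  (#|cell_sides x.1 x.2| < #|class_of cells component x|)%N.
Proof.
move=> hV; exact: (sides_class (fun t => proj1 (vertP t)) vert_in neighborE facet_dir_neq0
  (fun t i j => @facet_dir_neq t i j hV) nbr_cells).
Qed.

Lemma curve_bound : k.+1 = n -> (1 < n)%N \/ (1 < lattice_volume Delta)%E ->
  (b0 R X <= ((n%:R + 1) / 3)%:E * lattice_volume Delta)%E.
Proof.
move=> kn hV; have c0 : 0 <= (n%:R + 1) / 3 :> R by rewrite divr_ge0// addr_ge0.
apply: (lee_b0 (a := 3)) => //.
have sdc : forall x, x \in cells -> (2 < #|class_of cells component x|)%N.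
  move=> x xc; apply: (leq_ltn_trans _ (cell_sides_class hV xc)).
  rewrite /cells inE in xc.
  exact: (curve_two_sides hE (fullG x.1) (full_card x.1) (vertP x.1) kn xc).
have le3 : (3 * size (undup [seq component x | x in cells]) <= \sum_(x in cells) 1)%N.
  by apply: classes_le => x xc; rewrite class_sum; apply: sdc.
have : (\sum_(x in cells) 1 <= #|` F| * n.+1)%N.
  rewrite sum_cells cardfE -sum_nat_const; apply: leq_sum => t _; rewrite sum1_card.
  exact: (card_curve_local hGamma uG hE n0 (fullG t) (full_card t) (vertP t) kn).
move/(leq_trans le3); rewrite -(@ler_nat R) => /le_trans; apply.
rewrite natrM -natr1 mulrC ler_wpM2r// mulrC -mulrA mulVf ?mulr1//.
Qed.

Definition triangle_cells t : {set V} :=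
  [set s in phase k E (val t) | #|class_of cells component (t, s)| == 4%N]%SET.

Lemma cells_phase t s : ((t, s) \in cells) = (s \in phase k E (val t)).
Proof. by rewrite inE. Qed.

Lemma surface_sides x : k.+2 = n -> x \in cells -> (2 < #|cell_sides x.1 x.2|)%N.
Proof.
move=> kn; case: x => t s; rewrite cells_phase /= => sc.
exact: (surface_three_sides hGamma uG hE n0 (fullG t) (full_card t) (vertP t) kn sc).
Qed.

(** By [small_class], sides of such a cell have equal values under f. If f were
    constant, then all facets of t would have the same apex. *)
Lemma card_triangle_cells t : k.+2 = n -> (2 < n)%N \/ (1 < lattice_volume Delta)%E ->
  (3 * #|triangle_cells t| <= n * n.-1)%N.
Proof.
move=> kn hV; have hV' : (1 < n)%N \/ (1 < lattice_volume Delta)%E.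
  by case: hV; [left; lia|right].
have small s : s \in triangle_cells t -> #|cell_sides t s| = 3%N /\
    {in cell_sides t s &, forall i j, neighbor t i != None /\ apex t i = apex t j}.
  rewrite finset.inE => /andP[sc /eqP c4].
  apply: (small_class (x := (t, s)) (fun t => proj1 (vertP t)) vert_in neighborE addvv facet_dir_neq0
    (fun t i j => @facet_dir_neq t i j hV') nbr_cells (fun t i j l => @facet_dir_closed t i j l hV)
    (fun x => surface_sides kn)) => //.
  by rewrite cells_phase.
(* the classes of facets with the same apex *)
pose f i := if neighbor t i is Some _ then Some (apex t i) else None.
have fsd s i j : s \in triangle_cells t -> i \in cell_sides t s -> j \in cell_sides t s -> f i = f j.
  move=> sT si sj; have [_ h] := small s sT; have [oi e] := h i j si sj; have [oj _] := h j i sj si.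
  by rewrite /f; case: (neighbor t i) oi => // ? _; case: (neighbor t j) oj => // ? _; rewrite e.
have fN s : s \in triangle_cells t -> exists i j, f i != f j.
  move=> sT; apply: contrapT => nf.
  have fE i j : f i = f j by apply/eqP; apply: contraT => ij; case: nf; exists i, j.
  have [s3 h] := small s sT; have [i si] : exists i, i \in cell_sides t s by apply/card_gt0P; rewrite s3.
  apply: (@apex_not_const t) => j; have [oi _] := h i i si si.
  have : f j = f i by []. have : f ord0 = f i by [].
  by rewrite /f; case: (neighbor t i) oi => // ? _; case: (neighbor t ord0) => // ? [<-];
    case: (neighbor t j) => // ? [<-].
have [->|[s sT]] := finset.set_0Vmem (triangle_cells t); first by rewrite cards0 muln0.
have n2 : (2 < n)%N.
  rewrite ltnNge; apply/negP => n2; have [i [j]] := fN s sT; apply/negP; rewrite negbK; apply/eqP.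
  have full l : l \in cell_sides t s.
    suff -> : cell_sides t s = finset.setTfor 'I_(1 + n) by rewrite finset.in_setT.
    apply/eqP; rewrite eqEcard finset.subsetT cardsT card_ord.
    by have [-> _] := small s sT; lia.
  exact: fsd sT _ _.
apply: (card_triangles_local hGamma uG hE n0 (fullG t) (full_card t) (vertP t) kn n2 (fN s sT)).
  by move=> s' /small[].
by move=> s' i j; apply: fsd.
Qed.

(** The weights 1/4 and 1/5 are multiplied by 20: a cell counts 4, and 5 if its
    component has four cells, so that every component counts at least 20. *)
Lemma surface_bound : k.+2 = n -> (2 < n)%N \/ (1 < lattice_volume Delta)%E ->
  (b0 R X <= ((7 * n%:R ^+ 2 + 5 * n%:R + 12) / 60)%:E * lattice_volume Delta)%E.
Proof.
move=> kn hV; have hV' : (1 < n)%N \/ (1 < lattice_volume Delta)%E.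
  by case: hV; [left; lia|right].
have c0 : 0 <= (7 * n%:R ^+ 2 + 5 * n%:R + 12) / 60 :> R.
  by rewrite divr_ge0// !addr_ge0// mulr_ge0// exprn_ge0.
apply: (lee_b0 (a := 60)) => //.
pose g (x : F * V) := (4 + (#|class_of cells component x| == 4))%N.
have cls20 : (20 * size (undup [seq component x | x in cells]) <= \sum_(x in cells) g x)%N.
  apply: classes_le => x xc.
  have c4 : (3 < #|class_of cells component x|)%N.
    by apply: (leq_ltn_trans _ (cell_sides_class hV' xc)); apply: surface_sides.
  rewrite (eq_bigr (fun _ => (4 + (#|class_of cells component x| == 4)) * 1)%N); last first.
    move=> y /andP[_ /eqP yx]; rewrite muln1 /g; congr (_ + _)%N; congr ((_ == _) : nat).
    by apply: eq_card => z; rewrite !finset.inE yx.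
  rewrite -big_distrr /= class_sum; move: c4; move: #|_| => c; clear.
  by case: eqVneq => [->//|]; lia.
have local t : (\sum_(s in phase k E (val t)) 3 * g (t, s) <= 12 * (1 + n + 'C(n, 2)) + n * n.-1)%N.
  under eq_bigr do rewrite /g mulnDr.
  rewrite big_split /= sum_nat_const -big_distrr /= leq_add//.
    rewrite mulnC leq_mul//.
    exact: (card_surface_local hGamma uG hE n0 (fullG t) (full_card t) (vertP t) kn).
  apply: leq_trans (card_triangle_cells t kn hV); rewrite leq_mul2l /=.
  rewrite -big_mkcondr /= sum1_card; apply: eq_leq; apply: eq_card => s.
  by rewrite [RHS]finset.inE.
have : (60 * size (undup [seq component x | x in cells]) <= #|` F| * (12 * (1 + n + 'C(n, 2)) + n * n.-1))%N.
  apply: (@leq_trans (3 * \sum_(x in cells) g x)%N); first by lia.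
  rewrite sum_cells big_distrr /= cardfE -sum_nat_const; apply: leq_sum => t _.
  by rewrite big_distrr; exact: local.
have -> : (12 * (1 + n + 'C(n, 2)) + n * n.-1 = 7 * n ^ 2 + 5 * n + 12)%N.
  have := bin_ffact n 2; rewrite ffactnS ffactn1 -mulnn (_ : 2`! = 2)%N//.
  by move: 'C(n, 2) => c; clear -n0; case: n n0 => [//|m] _ /=; nia.
rewrite -(@ler_nat R) => /le_trans; apply.
have e : (7 * n ^ 2 + 5 * n + 12)%:R = 7 * n%:R ^+ 2 + 5 * n%:R + 12 :> R.
  by rewrite 2!natrD natrM natrX natrM.
by rewrite natrM e [60 * _]mulrC mulfVK ?pnatr_eq0// mulrC.
Qed.

End Global.

Theorem theorem1p3 (R : realType) (n : nat) (Delta : set 'rV[R]_n)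
    (hDelta : lattice_polytope Delta) (smooth_Delta : smooth Delta) :
  (forall X : set (tilde Delta), T_curve X ->
     (1 < n)%N \/ (1 < lattice_volume Delta)%E ->
     (b0 R X <= ((n%:R + 1) / 3)%:E * lattice_volume Delta)%E) /\
  (forall X : set (tilde Delta), T_surface X ->
     (2 < n)%N \/ (1 < lattice_volume Delta)%E ->
     (b0 R X <= ((7 * n%:R ^+ 2 + 5 * n%:R + 12) / 60)%:E
                * lattice_volume Delta)%E).
Proof.
split=> X [k [kn [Gamma [E [hGamma uG hE ->]]]]] hV.
  by rewrite addn1 in kn; apply: (curve_bound hDelta hGamma uG hE) => //; rewrite -kn.
by rewrite addn2 in kn; apply: (surface_bound hDelta hGamma uG hE) => //; rewrite -kn.
Qed.
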